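(* Let $\Gamma$ be a lattice of full rank in $\mathbb{R}^d$, with dual lattice $\Gamma^{*}$. Let $\mathcal{D}_{\Gamma}$ and $\mathcal{D}_{\Gamma^{*}}$ be the sets of radii of non-empty shells of $\Gamma$ and $\Gamma^{*}$, with shelling numbers $\eta_{\Gamma}(r)$ and $\eta_{\Gamma^{*}}(r)$. Then, in the sense of tempered distributions, $$\Bigl( \sum_{r \in \mathcal{D}_{\Gamma}} \eta_{\Gamma}(r)\, \mu_r \Bigr)^{\widehat{\ }} = \sum_{r \in \mathcal{D}_{\Gamma}} \eta_{\Gamma}(r)\, \widehat{\mu}_r = \operatorname{dens}(\Gamma) \sum_{r \in \mathcal{D}_{\Gamma^{*}}} \eta_{\Gamma^{*}}(r)\, \mu_r ,$$ where $\mu_r$ denotes the uniform probability measure on the sphere of radius $r$ around the origin.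
   Context: The dual lattice is $\Gamma^{*} = \{x \in \mathbb{R}^d : x\cdot y \in \mathbb{Z} \text{ for all } y \in \Gamma\}$. The density $\operatorname{dens}(\Gamma)$ is the average number of points of $\Gamma$ per unit volume (the reciprocal of the volume of a fundamental domain). For a lattice $L$, $\mathcal{D}_{L} = \{ |x| : x \in L\}$ is the set of radii $r \ge 0$ for which the shell $\{x\in L : |x| = r\}$ is non-empty, and the shelling number $\eta_{L}(r)$ is the number of points of $L$ with $|x| = r$. For $r>0$, $\mu_r$ is the rotation-invariant (uniform) probability measure on $\{x \in \mathbb{R}^d : |x| = r\}$, and $\mu_0 = \delta_0$ is the Dirac measure at the origin. Fourier transform is normalised by $\widehat{g}(k) = \int_{\mathbb{R}^d} e^{-2\pi i k\cdot x} g(x)\,dx$ for functions and $\widehat{\mu}(k) = \int_{\mathbb{R}^d} e^{-2\pi i k\cdot x}\,d\mu(x)$ for finite measures, and is extended to tempered distributions by duality. All infinite sums and identities are understood in the space $\mathcal{S}'(\mathbb{R}^d)$ of tempered distributions. *)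

(* Defs.v *)
From HB Require Import structures.
From mathcomp Require Import all_boot all_order all_algebra complex finmap.
From mathcomp Require Import all_classical all_reals all_analysis.
From mathcomp Require summability.

Set Implicit Arguments.
Unset Strict Implicit.
Unset Printing Implicit Defensive.
Import Order.TTheory GRing.Theory Num.Theory.
Import numFieldNormedType.Exports.

Local Open Scope classical_set_scope.
Local Open Scope ring_scope.

(* R^d is 'rV[R]_d.  Its sigma-algebra is the product of d copies of the     *)
(* Borel sigma-algebra of R, exactly as the library does for d.-tuple R.     *)
Definition rV_display : measure_display. Proof. exact. Qed.

Section rV_measurable.
Context {R : realType} {d : nat}.

Let coord (i : 'I_d) (x : 'rV[R]_d) : measurableTypeR R := x 0 i.

Let rV_set0 : g_sigma_preimage coord set0.
Proof. exact: sigma_algebra0. Qed.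

Let rV_setC A : g_sigma_preimage coord A -> g_sigma_preimage coord (~` A).
Proof. exact: sigma_algebraC. Qed.

Let rV_bigcup (F : (set 'rV[R]_d)^nat) :
  (forall i, g_sigma_preimage coord (F i)) ->
  g_sigma_preimage coord (\bigcup_i (F i)).
Proof. exact: sigma_algebra_bigcup. Qed.

HB.instance Definition _ := @isMeasurable.Build rV_display
  'rV[R]_d (g_sigma_preimage coord) rV_set0 rV_setC rV_bigcup.

Lemma measurable_rV_coord (i : 'I_d) :
  measurable_fun [set: 'rV[R]_d] (fun x => x 0 i : measurableTypeR R).
Proof.
move=> _ Y mY; rewrite setTI; apply: sub_sigma_algebra => /=.
rewrite -bigcup_seq/=; exists i => /=; first by rewrite mem_index_enum.
by exists Y => //; rewrite setTI.
Qed.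

Lemma measurable_fun_rVP d' (T : measurableType d') (f : T -> 'rV[R]_d) :
  (forall i, measurable_fun [set: T] (fun t => f t 0 i : measurableTypeR R)) ->
  measurable_fun [set: T] f.
Proof.
move=> mf; have : g_sigma_preimage coord `<=`
    [set A | measurable (f @^-1` A)].
  apply: smallest_sub.
    split => /=.
    - by rewrite preimage_set0.
    - move=> A mA; rewrite setTD preimage_setC; exact: measurableC.
    - move=> A mA; rewrite preimage_bigcup; exact: bigcup_measurable.
  rewrite -bigcup_seq => A [i _] [B mB <-] /=.
  by rewrite setTI -[X in measurable X]setTI; exact: (mf i).
by move=> sub _ A mA; rewrite setTI; exact: sub.
Qed.

End rV_measurable.

Section lebesgue_rV_succ.
Context {R : realType} {d : nat}.
Variable m : {sigma_finite_measure set 'rV[R]_d -> \bar R}.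

Definition consrV (p : measurableTypeR R * 'rV[R]_d) : 'rV[R]_d.+1 :=
  row_mx (p.1%:M : 'rV[R]_1) p.2.

Lemma measurable_consrV : measurable_fun [set: _ * _] consrV.
Proof.
apply: measurable_fun_rVP => i.
have [j ->|j ->] := split_ordP (i : 'I_(1 + d)).
  rewrite (_ : (fun _ => _) = fst); first exact: measurable_fst.
  apply/funext => p; rewrite /consrV; etransitivity; first exact: row_mxEl.
  by rewrite !ord1 mxE eqxx.
rewrite (_ : (fun _ => _) = (fun x : 'rV[R]_d => x 0 j) \o snd).
  by apply: measurableT_comp; [exact: measurable_rV_coord|exact: measurable_snd].
by apply/funext => p /=; exact: row_mxEr.
Qed.

Let unconsrV (x : 'rV[R]_d.+1) : measurableTypeR R * 'rV[R]_d :=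
  (x 0 (lshift d (0 : 'I_1)), rsubmx (x : 'rV[R]_(1 + d))).

Let consrVK : cancel consrV unconsrV.
Proof.
case=> a v; congr pair; last exact: row_mxKr.
by etransitivity; [exact: row_mxEl|rewrite mxE eqxx].
Qed.

Let measurable_unconsrV : measurable_fun [set: 'rV[R]_d.+1] unconsrV.
Proof.
apply/measurable_fun_pairP; split; first exact: measurable_rV_coord.
apply: measurable_fun_rVP => i; rewrite (_ : (fun _ => _) =
  fun x : 'rV[R]_d.+1 => x 0 (rshift 1 i)); first exact: measurable_rV_coord.
by apply/funext => x /=; rewrite mxE.
Qed.

Definition lebesgue_succ : set 'rV[R]_d.+1 -> \bar R :=
  pushforward (lebesgue_measure \x m)%E consrV.

Let measurable_consrV_preimage A :
  measurable A -> measurable (consrV @^-1` A).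
Proof.
by move=> mA; rewrite -[X in measurable X]setTI; exact: measurable_consrV.
Qed.

Let lebesgue_succ0 : lebesgue_succ set0 = 0%E.
Proof. by rewrite /lebesgue_succ /pushforward preimage_set0 measure0. Qed.

Let lebesgue_succ_ge0 A : (0 <= lebesgue_succ A)%E.
Proof. by rewrite /lebesgue_succ /pushforward measure_ge0. Qed.

Let lebesgue_succ_sigma_additive : semi_sigma_additive lebesgue_succ.
Proof.
move=> F mF tF mUF; rewrite /lebesgue_succ /pushforward preimage_bigcup.
apply: measure_semi_sigma_additive.
- by move=> n; exact: measurable_consrV_preimage.
- apply/trivIsetP => /= i j _ _ ij; rewrite -preimage_setI.
  by move/trivIsetP : tF => /(_ _ _ _ _ ij) ->//; rewrite preimage_set0.
- by rewrite -preimage_bigcup; exact: measurable_consrV_preimage.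
Qed.

HB.instance Definition _ := isMeasure.Build _ _ _ lebesgue_succ
  lebesgue_succ0 lebesgue_succ_ge0 lebesgue_succ_sigma_additive.

Let lebesgue_succ_sigma_finite : sigma_finite setT lebesgue_succ.
Proof.
have /sigma_finiteP[F [TF ndF Foo]] := sigma_finiteT (@lebesgue_measure R).
have /sigma_finiteP[G [TG ndG Goo]] := sigma_finiteT m.
have mFG k : measurable (F k `*` G k).
  by apply: measurableX; [case: (Foo k)|case: (Goo k)].
exists (fun k => unconsrV @^-1` (F k `*` G k)).
  rewrite -preimage_bigcup; apply/seteqP; split=> // x _ /=.
  have [k _ Fk] : (\bigcup_i F i) (unconsrV x).1 by rewrite -TF.
  have [l _ Gl] : (\bigcup_i G i) (unconsrV x).2 by rewrite -TG.
  exists (maxn k l) => //; split.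
  - by move: (unconsrV x).1 Fk; exact/subsetPset/ndF/leq_maxl.
  - by move: (unconsrV x).2 Gl; exact/subsetPset/ndG/leq_maxr.
move=> k; split.
  by rewrite -[X in measurable X]setTI; exact: measurable_unconsrV.
rewrite /lebesgue_succ /pushforward -comp_preimage.
rewrite (_ : unconsrV \o consrV = id); last exact/funext/consrVK.
have [mFk Fkoo] := Foo k; have [mGk Gkoo] := Goo k.
rewrite [X in (X < _)%E]product_measure1E//.
by rewrite lte_mul_pinfty// ge0_fin_numE.
Qed.

HB.instance Definition _ := Measure_isSigmaFinite.Build _ _ _ lebesgue_succ
  lebesgue_succ_sigma_finite.

End lebesgue_rV_succ.

Fixpoint lebesgue_rV (R : realType) (d : nat) :
    {sigma_finite_measure set 'rV[R]_d -> \bar R} :=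
  if d is n.+1 then lebesgue_succ (lebesgue_rV R n) else \d_(0 : 'rV[R]_0).

Section euclidean.
Context {R : realType} {d : nat}.
Implicit Types x y : 'rV[R]_d.

Definition dotp x y : R := \sum_(i < d) x 0 i * y 0 i.

(* The canonical norm `|x| of 'rV[R]_d is the sup norm, hence: *)
Definition enorm x : R := Num.sqrt (dotp x x).

End euclidean.

Section complex_integral.
Context {R : realType}.

Definition cintegral disp (T : measurableType disp)
    (m : {measure set T -> \bar R}) (f : T -> R[i]) : R[i] :=
  (\int[m]_x complex.Re (f x) +i* \int[m]_x complex.Im (f x))%C.

(* exp (i t) *)
Definition expi (t : R) : R[i] := (cos t +i* sin t)%C.

Definition fourier d (g : 'rV[R]_d -> R[i]) (k : 'rV[R]_d) : R[i] :=
  cintegral (lebesgue_rV R d) (fun x => expi (- (2 * pi * dotp k x)) * g x).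

Definition fourier_measure d (m : {measure set 'rV[R]_d -> \bar R})
    (k : 'rV[R]_d) : R[i] :=
  cintegral m (fun x => expi (- (2 * pi * dotp k x))).

End complex_integral.

Section schwartz.
Context {R : realType} {d : nat}.
Implicit Types (f g : 'rV[R]_d -> R[i]) (s : seq 'I_d).

Definition partial (i : 'I_d) f (x : 'rV[R]_d) : R[i] :=
  ('D_'e_i (fun y => complex.Re (f y)) x +i*
   'D_'e_i (fun y => complex.Im (f y)) x)%C.

(* iterated partial derivative, the list s giving the successive directions *)
Definition partials s f : 'rV[R]_d -> R[i] := foldr partial f s.

(* C^oo : all iterated partial derivatives exist and are differentiable *)
Definition smooth f : Prop := forall s (x : 'rV[R]_d),
  differentiable (fun y => complex.Re (partials s f y)) x /\
  differentiable (fun y => complex.Im (partials s f y)) x.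

Definition monomial (a : 'I_d -> nat) (x : 'rV[R]_d) : R :=
  \prod_(i < d) x 0 i ^+ a i.

Definition schwartz_seminorm (a : 'I_d -> nat) s f : \bar R :=
  ereal_sup [set (ComplexField.Normc.normc
      ((monomial a x)%:C%C * partials s f x))%:E | x in [set: 'rV[R]_d]].

Definition schwartz f : Prop :=
  smooth f /\ forall a s, (schwartz_seminorm a s f < +oo)%E.

End schwartz.

(* Functionals are total on functions R^d -> C, but only their values on     *)
(* Schwartz functions are ever constrained or compared.                      *)
Definition functional (R : realType) (d : nat) : Type :=
  ('rV[R]_d -> R[i]) -> R[i].

Section tempered_distributions.
Context {R : realType} {d : nat}.
Implicit Types (T : functional R d) (f g : 'rV[R]_d -> R[i]).

(* continuity is for the topology defined by the seminorms of S(R^d) *)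
Definition tempered T : Prop :=
  (forall (c : R[i]) f g, schwartz f -> schwartz g ->
     T (fun x => c * f x + g x) = c * T f + T g) /\
  (forall f, schwartz f -> forall e : R, 0 < e ->
     exists N : nat, exists2 delta : R, 0 < delta &
     forall g, schwartz g ->
       (forall (a : 'I_d -> nat) (s : seq 'I_d),
          (\sum_(i < d) a i <= N)%N -> (size s <= N)%N ->
          (schwartz_seminorm a s (fun x => (g x - f x)%R) < delta%:E)%E) ->
       ComplexField.Normc.normc (T g - T f) < e).

Definition measure_distribution (m : {measure set 'rV[R]_d -> \bar R}) :
  functional R d := fun f => cintegral m f.

Definition function_distribution (h : 'rV[R]_d -> R[i]) : functional R d :=
  fun f => cintegral (lebesgue_rV R d) (fun x => h x * f x).

Definition fourier_distribution T : functional R d := fun f => T (fourier f).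

(* S = \sum_(r in D) F r in S'(R^d), as an unordered sum (limit along the    *)
(* finite subsets of D) for the weak-* topology.                             *)
Definition distribution_sum (D : set R) (F : R -> functional R d)
    (S : functional R d) : Prop :=
  [/\ forall r, D r -> tempered (F r), tempered S &
      forall f, schwartz f ->
        (fun A : {fset R} => \sum_(r <- A | r \in D) F r f : R[i]^o) @
          summability.totally --> (S f : R[i]^o)].

End tempered_distributions.

Section lattices.
Context {R : realType} {d : nat}.
Implicit Types G : set 'rV[R]_d.

Definition full_lattice G : Prop :=
  exists2 B : 'M[R]_d, row_free B &
  G = [set x | exists n : 'I_d -> int, x = \sum_(i < d) row i B *~ n i].

Definition dual_lattice G : set 'rV[R]_d :=
  [set x | forall y, G y -> dotp x y \is a Num.int].

Definition radii G : set R := [set enorm x | x in G].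

Definition shelling G (r : R) : nat :=
  #|` fset_set (G `&` [set x | enorm x = r])|.

(* average number of points per unit volume, over balls of growing radius *)
Definition dens G : R :=
  lim ((fun rho : R => let K := [set x : 'rV[R]_d | enorm x <= rho] in
    (#|` fset_set (G `&` K)|)%:R / fine (lebesgue_rV R d K)) @ +oo).

(* Orthogonal maps include reflections, so this determines m also if d = 1;  *)
(* for r = 0 it says that m is the Dirac measure at 0.                       *)
Definition uniform_on_sphere (r : R) (m : probability 'rV[R]_d R) : Prop :=
  m [set x | enorm x = r] = 1%E /\
  forall Q : 'M[R]_d, Q *m Q^T = 1%:M ->
  forall A : set 'rV[R]_d, measurable A ->
    m ((fun x => x *m Q) @^-1` A) = m A.

End lattices.

(* Main.v *)
Require Import Defs.
From mathcomp Require Import all_boot all_order all_algebra complex finmap.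
From mathcomp Require Import all_classical all_reals all_analysis.
From mathcomp Require Import measurable_realfun.
From mathcomp Require Import ring lra.

(** Summing over the shells of a lattice amounts to summing, over all lattice
    points [x], the average of the test function over the sphere through [x],
    [average mu f x = cintegral (mu (enorm x)) f]. The two distributions are
    therefore unordered sums of averages over lattice points ([lattice_sum]),
    grouped by the distance to the origin ([hasum_shells]), and the formula is
    Poisson summation for the function [average mu f] in place of [f].

    This rests on two facts. The first is that averaging commutes with the
    Fourier transform ([fourier_averageE]): the Fourier transform of a sphere
    measure is radial, and a function may be replaced by its average when it is
    integrated against a radial function ([average_pairing]). The measures
    [mu r] are only known one at a time, through their invariance under
    orthogonal maps, and have to be compared with Lebesgue measure. For this,
    [f] is smoothed by a kernel that depends on the distance only. The average
    [kappa x z] of the kernel over the sphere through [x] depends on the norms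
    of [x] and [z] only and equals the average over the sphere through [z]
    ([kappaC]), so the averaging moves from [f] to the kernel and then
    disappears against the radial function. The Lipschitz continuity of the
    kernel makes [average mu f] continuous as well ([average_continuous]).

    The second fact is Poisson summation for continuous functions that are
    bounded, together with their Fourier transform, by a multiple of
    [weight x = (1 + |x|^2)^-d]; averages of Schwartz functions are of this
    kind. For the integer lattice ([poisson_Zd]), the function is integrated
    against a positive trigonometric approximate identity. The integral is a
    sum of values of the Fourier transform with coefficients that tend to one,
    and it also tends to the sum of the function over the integer points, one
    unit cube at a time. A linear change of variables gives all lattices
    ([poisson_lattice]), with the factor [|\det B|^-1] for the lattice spanned
    by the rows of [B]; this factor is the density, by comparing balls with
    unions of cells ([dens_pullback]).

    Convergence and continuity of all the functionals come from the same bound: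
    [weight] is summable over lattices ([sum_le_weight_pullback]), and finitely
    many seminorms of a Schwartz function bound it and its Fourier transform by
    a multiple of [weight] ([order_le_decay], [fourier_decay]). *)

Set Implicit Arguments.
Unset Strict Implicit.
Unset Printing Implicit Defensive.
Import Order.TTheory GRing.Theory Num.Theory.
Import numFieldNormedType.Exports.
Local Open Scope classical_set_scope.
Local Open Scope ring_scope.
Local Notation normc := ComplexField.Normc.normc.

(** * Euclidean geometry of row vectors *)

Section euclidean.
Context {R : realType} {d : nat}.
Implicit Types (x y z : 'rV[R]_d) (a : R).

Lemma dotpC x y : dotp x y = dotp y x.
Proof. by apply: eq_bigr => i _; rewrite mulrC. Qed.

Lemma dotpDl x y z : dotp (x + y) z = dotp x z + dotp y z.
Proof. by rewrite -big_split; apply: eq_bigr => i _; rewrite mxE mulrDl. Qed.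

Lemma dotpZl a x y : dotp (a *: x) y = a * dotp x y.
Proof. by rewrite mulr_sumr; apply: eq_bigr => i _; rewrite mxE mulrA. Qed.

Lemma dotpDr x y z : dotp x (y + z) = dotp x y + dotp x z.
Proof. by rewrite dotpC dotpDl !(dotpC x). Qed.

Lemma dotpZr a x y : dotp x (a *: y) = a * dotp x y.
Proof. by rewrite dotpC dotpZl dotpC. Qed.

Lemma dotpNl x y : dotp (- x) y = - dotp x y.
Proof. by rewrite -scaleN1r dotpZl mulN1r. Qed.

Lemma dotpNr x y : dotp x (- y) = - dotp x y.
Proof. by rewrite dotpC dotpNl dotpC. Qed.

Lemma dotp0l x : dotp 0 x = 0.
Proof. by rewrite -(scale0r 0) dotpZl mul0r. Qed.

Lemma dotp0r x : dotp x 0 = 0.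
Proof. by rewrite dotpC dotp0l. Qed.

Lemma dotp_delta x (j : 'I_d) : dotp x 'e_j = x 0 j.
Proof.
rewrite /dotp (bigD1 j)//= mxE !eqxx mulr1 big1 ?addr0// => i ij.
by rewrite mxE eqxx (negbTE ij) mulr0.
Qed.

Lemma dotp_mx x y : dotp x y = (x *m y^T) 0 0.
Proof. by rewrite mxE; apply: eq_bigr => i _; rewrite mxE. Qed.

Lemma dotp_mulmxl (M : 'M[R]_d) x y : dotp (x *m M) y = dotp x (y *m M^T).
Proof. by rewrite !dotp_mx trmx_mul trmxK mulmxA. Qed.

Lemma dotp_ge0 x : 0 <= dotp x x.
Proof. by apply: sumr_ge0 => i _; rewrite -expr2 sqr_ge0. Qed.

Lemma enorm_ge0 x : 0 <= enorm x. Proof. exact: sqrtr_ge0. Qed.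

Lemma enorm_sqr x : enorm x ^+ 2 = dotp x x.
Proof. by rewrite sqr_sqrtr// dotp_ge0. Qed.

Lemma enormE x r : 0 <= r -> dotp x x = r ^+ 2 -> enorm x = r.
Proof. by move=> r0 h; rewrite /enorm h sqrtr_sqr ger0_norm. Qed.

Lemma enorm0 : enorm (0 : 'rV[R]_d) = 0.
Proof. by rewrite /enorm dotp0l sqrtr0. Qed.

Lemma enormZ a x : enorm (a *: x) = `|a| * enorm x.
Proof.
apply: enormE; first by rewrite mulr_ge0// enorm_ge0.
by rewrite dotpZl dotpZr exprMn enorm_sqr real_normK ?num_real// mulrA -expr2.
Qed.

Lemma enormN x : enorm (- x) = enorm x.
Proof. by rewrite -scaleN1r enormZ normrN normr1 mul1r. Qed.

Lemma enormBC x y : enorm (x - y) = enorm (y - x).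
Proof. by rewrite -enormN opprB. Qed.

Lemma dotp_eq0 x : dotp x x = 0 -> x = 0.
Proof.
move/eqP; rewrite psumr_eq0 => [/allP h|i _]; last by rewrite -expr2 sqr_ge0.
apply/rowP => i; rewrite mxE; apply/eqP.
by have := h i (mem_index_enum _); rewrite -expr2 sqrf_eq0.
Qed.

Lemma enorm_eq0 x : enorm x = 0 -> x = 0.
Proof. by move=> h; apply: dotp_eq0; rewrite -enorm_sqr h expr0n. Qed.

Lemma dotp_le x y : dotp x y <= enorm x * enorm y.
Proof.
have [/enorm_eq0 ->|x0] := eqVneq (enorm x) 0; first by rewrite dotp0l enorm0 mul0r.
have [/enorm_eq0 ->|y0] := eqVneq (enorm y) 0; first by rewrite dotp0r enorm0 mulr0.
have xp : 0 < enorm x by rewrite lt_def x0 enorm_ge0.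
have yp : 0 < enorm y by rewrite lt_def y0 enorm_ge0.
have := dotp_ge0 (enorm y *: x - enorm x *: y).
rewrite !(dotpDl, dotpDr, dotpNl, dotpNr, dotpZl, dotpZr) -!enorm_sqr (dotpC y x).
set p := dotp x y; set X := enorm x; set Y := enorm y => h.
suff : 0 <= X * Y * (X * Y - p) by rewrite pmulr_rge0 ?subr_ge0// mulr_gt0.
nra.
Qed.

Lemma norm_dotp_le x y : `|dotp x y| <= enorm x * enorm y.
Proof.
by rewrite ler_norml dotp_le andbT lerNl -dotpNl -(enormN x) dotp_le.
Qed.

Lemma enormD x y : enorm (x + y) <= enorm x + enorm y.
Proof.
rewrite -(ler_pXn2r (_ : 0 < 2)%N)// ?nnegrE ?addr_ge0 ?enorm_ge0//.
rewrite enorm_sqr dotpDl !dotpDr (dotpC y x) sqrrD -!enorm_sqr.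
by have := dotp_le x y; lra.
Qed.

Lemma enorm_distl x y : `|enorm x - enorm y| <= enorm (x - y).
Proof.
have h u v : enorm u - enorm v <= enorm (u - v :> 'rV[R]_d).
  by rewrite lerBlDr; apply: le_trans (enormD _ _); rewrite subrK.
by rewrite ler_norml h andbT lerNl opprB (enormBC x) h.
Qed.

Lemma coord_le_enorm x i : `|x 0 i| <= enorm x.
Proof.
rewrite -(ler_pXn2r (_ : 0 < 2)%N)// ?nnegrE ?enorm_ge0//.
rewrite enorm_sqr real_normK ?num_real// /dotp (bigD1 i)//= -expr2 lerDl.
by apply: sumr_ge0 => j _; rewrite -expr2 sqr_ge0.
Qed.

Lemma enorm_le_sum x : enorm x <= \sum_(i < d) `|x 0 i|.
Proof.
rewrite -(ler_pXn2r (_ : 0 < 2)%N)// ?nnegrE ?enorm_ge0 ?sumr_ge0//.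
rewrite enorm_sqr expr2 mulr_suml; apply: ler_sum => i _.
rewrite -expr2 -(real_normK (num_real _)) expr2 ler_wpM2l//.
by rewrite (bigD1 i)//= lerDl sumr_ge0.
Qed.

Lemma enorm_mulmx (B : 'M[R]_d) :
  exists2 c, 0 < c & forall x, enorm (x *m B) <= c * enorm x.
Proof.
exists (1 + \sum_(i < d) \sum_(j < d) `|B j i|).
  rewrite ltr_pwDl// sumr_ge0// => i _; exact: sumr_ge0.
move=> x; apply: le_trans (enorm_le_sum _) _.
rewrite mulrDl mul1r ler_wpDl ?enorm_ge0// mulr_suml; apply: ler_sum => i _.
rewrite mxE mulr_suml; apply: le_trans (ler_norm_sum _ _ _) _.
by apply: ler_sum => j _; rewrite normrM mulrC ler_wpM2l// coord_le_enorm.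
Qed.

Lemma enorm_orthogonal (Q : 'M[R]_d) x :
  Q *m Q^T = 1%:M -> enorm (x *m Q) = enorm x.
Proof.
move=> Q1; congr Num.sqrt.
by rewrite dotp_mulmxl -mulmxA Q1 mulmx1.
Qed.

(** The reflection in the hyperplane orthogonal to [x - y] exchanges [x] and
    [y]. *)
Lemma orthogonal_transitive x y : enorm x = enorm y ->
  exists2 Q : 'M[R]_d, Q *m Q^T = 1%:M & x *m Q = y.
Proof.
move=> xy; have xxyy : dotp x x = dotp y y by rewrite -!enorm_sqr xy.
have [->|nxy] := eqVneq x y; first by exists 1%:M; rewrite ?trmx1 ?mulmx1.
set v := x - y; set n := dotp v v.
have n0 : n != 0.
  by apply: contra_neq nxy => /dotp_eq0/eqP; rewrite subr_eq0 => /eqP.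
have vvT : v *m v^T = n%:M by rewrite [LHS]mx11_scalar -dotp_mx.
pose Q : 'M[R]_d := 1%:M - (2 / n) *: (v^T *m v).
exists Q.
  have QT : Q^T = Q.
    rewrite /Q [LHS]linearB /= trmx1; congr (_ - _).
    by rewrite linearZ /= trmx_mul trmxK.
  have AA : (v^T *m v) *m (v^T *m v) = n *: (v^T *m v).
    by rewrite mulmxA -(mulmxA v^T) vvT mul_mx_scalar -scalemxAl.
  rewrite QT /Q; move: (v^T *m v) AA => A AA.
  rewrite mulmxBl !mulmxBr !mul1mx mulmx1 -scalemxAl -scalemxAr AA !scalerA.
  rewrite (_ : 2 / n * (2 / n) * n = 2 / n + 2 / n); last by field.
  by rewrite scalerDl opprB addrK subrK.
rewrite /Q mulmxBr mulmx1 -scalemxAr mulmxA [x *m _]mx11_scalar -dotp_mx.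
rewrite mul_scalar_mx scalerA (_ : 2 / n * _ = 1).
  by rewrite scale1r /v opprB addrC subrK.
have h : n = 2 * dotp x v.
  by rewrite /n /v !(dotpDl, dotpDr, dotpNl, dotpNr) -xxyy (dotpC y x); ring.
by rewrite h in n0 *; field; move: n0; rewrite mulf_eq0 negb_or => /andP[].
Qed.

End euclidean.

(** * Measurability of continuous functions *)

Section measurable_dense.
Context {R : realType}.

Lemma natSinv_lt (e : R) : 0 < e -> exists n, n.+1%:R^-1 < e.
Proof.
move=> e0; exists (Num.truncn e^-1).
by rewrite invf_plt ?posrE// truncnS_gt.
Qed.

(** A function that is continuous for a distance with measurable balls and a
    countable dense set is measurable: the superlevel sets are countable unions
    of balls. *)
Lemma measurable_continuous_dense disp (T : measurableType disp) (I : countType)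
    (q : I -> T) (D : T -> T -> R) (f : T -> R) :
  (forall y, measurable_fun setT (D^~ y)) ->
  (forall x y, D x y = D y x) ->
  (forall x y z, D x z <= D x y + D y z) ->
  (forall x e, 0 < e -> exists i, D x (q i) < e) ->
  (forall x e, 0 < e -> exists2 r, 0 < r & forall y, D x y < r -> `|f x - f y| < e) ->
  measurable_fun setT f.
Proof.
move=> mD Dsym Dtri dense fc.
move=> mT; apply: (measurability _ (RGenOInfty.measurableE R)) => //.
move=> _ [_ [a ->] <-]; rewrite setTI.
pose B (p : I * nat) := [set x | D x (q p.1) < p.2.+1%:R^-1].
pose P (p : I * nat) := B p `<=` f @^-1` `]a, +oo[.
have -> : f @^-1` `]a, +oo[ = \bigcup_(p in P) B p.
  apply/seteqP; split => [x|x [p Pp /Pp//]].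
  rewrite /= in_itv/= andbT => ax.
  have [r r0 hr] := fc x (f x - a) (ltac:(by rewrite subr_gt0)).
  have [n hn] : exists n, n.+1%:R^-1 < r / 2 :> R.
    by apply: natSinv_lt; rewrite divr_gt0.
  have [i hi] := dense x n.+1%:R^-1 (ltac:(by [])).
  exists (i, n) => // y; rewrite /B /= => hy.
  have /hr : D x y < r.
    apply: le_lt_trans (Dtri x (q i) y) _; rewrite (Dsym (q i) y).
    by rewrite (splitr r) ltrD// (lt_trans _ hn).
  by rewrite in_itv/= andbT ltr_norml => /andP[_]; rewrite ltrD2l ltrN2.
rewrite bigcup_mkcond; apply: countable_bigcupT_measurable => // p.
case: ifP => // _; rewrite (_ : B p = setT `&` (D^~ (q p.1)) @^-1` `]-oo, p.2.+1%:R^-1[).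
  exact: mD.
by rewrite setTI; apply/seteqP; split => x; rewrite /B /= in_itv.
Qed.

Context {d : nat}.

Lemma measurable_dotp (y : 'rV[R]_d) : measurable_fun setT (fun x => dotp x y).
Proof.
apply: measurable_sum => i.
by apply: measurable_funM => //; exact: measurable_rV_coord.
Qed.

Lemma measurable_enorm : measurable_fun setT (fun x : 'rV[R]_d => enorm x).
Proof.
apply: (measurableT_comp (continuous_measurable_fun (@sqrt_continuous R))).
apply: measurable_sum => i.
by apply: measurable_funM => //; exact: measurable_rV_coord.
Qed.

Lemma measurable_rVD disp (T : measurableType disp) (f g : T -> 'rV[R]_d) :
  measurable_fun setT f -> measurable_fun setT g ->
  measurable_fun setT (fun x => f x + g x).
Proof.
move=> mf mg; apply: measurable_fun_rVP => i.
under eq_fun do rewrite mxE.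
by apply: measurable_funD;
  apply: (measurableT_comp (measurable_rV_coord i)).
Qed.

Lemma measurable_rVZ disp (T : measurableType disp) (f : T -> 'rV[R]_d) a :
  measurable_fun setT f -> measurable_fun setT (fun x => a *: f x).
Proof.
move=> mf; apply: measurable_fun_rVP => i.
under eq_fun do rewrite mxE.
apply: measurable_funM => //.
by apply: (measurableT_comp (measurable_rV_coord i)).
Qed.

Lemma measurable_rVB disp (T : measurableType disp) (f g : T -> 'rV[R]_d) :
  measurable_fun setT f -> measurable_fun setT g ->
  measurable_fun setT (fun x => f x - g x).
Proof.
move=> mf mg; apply: measurable_rVD => //.
by under eq_fun do rewrite -scaleN1r; exact: measurable_rVZ.
Qed.

Lemma measurable_rVM (M : 'M[R]_d) :
  measurable_fun setT (fun x : 'rV[R]_d => x *m M).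
Proof.
apply: measurable_fun_rVP => i.
under eq_fun do rewrite mxE.
apply: measurable_sum => j; apply: measurable_funM => //.
exact: measurable_rV_coord.
Qed.

Lemma rV_dense (x : 'rV[R]_d) e : 0 < e ->
  exists q : 'rV[rat]_d, enorm (x - map_mx ratr q) < e.
Proof.
move=> e0.
have e1 : 0 < e / d.+1%:R by rewrite divr_gt0.
have h i : exists q : rat, `|x 0 i - ratr q| < e / d.+1%:R.
  have lt2 : x 0 i - e / d.+1%:R < x 0 i + e / d.+1%:R by rewrite ltrD2l gtrN.
  have [q] := rat_in_itvoo lt2.
  by rewrite in_itv/= => /andP[a b]; exists q; rewrite distrC ltr_distl a b.
have [q hq] := choice h; exists (\row_i q i).
apply: le_lt_trans (enorm_le_sum _) _.
apply: (@le_lt_trans _ _ (\sum_(i < d) e / d.+1%:R)).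
  by apply: ler_sum => i _; rewrite !mxE ltW.
rewrite sumr_const card_ord -[ltLHS]mulr_natr -mulrA gtr_pMr// ltr_pdivrMl// mulr1.
by rewrite ltr_nat.
Qed.

(** Stated with the Euclidean norm, since the topology of row vectors is
    defined by the sup norm. *)
Definition econtinuous (f : 'rV[R]_d -> R) := forall x e, 0 < e ->
  exists2 r, 0 < r & forall y, enorm (x - y) < r -> `|f x - f y| < e.

Lemma econtinuous_measurable f : econtinuous f -> measurable_fun setT f.
Proof.
move=> cf; apply: (@measurable_continuous_dense _ _ 'rV[rat]_d
  (fun q => map_mx ratr q) (fun x y => enorm (x - y))) => //.
- move=> y; apply: (measurableT_comp measurable_enorm).
  exact: measurable_rVB.
- by move=> x y; rewrite enormBC.
- move=> x y z; rewrite (_ : x - z = (x - y) + (y - z)) ?enormD//.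
  by rewrite addrA subrK.
- by move=> x e e0; have [q hq] := rV_dense x e0; exists q.
Qed.

Lemma econtinuous2_measurable (f : 'rV[R]_d * 'rV[R]_d -> R) :
  (forall x e, 0 < e -> exists2 r, 0 < r & forall y,
    enorm (x.1 - y.1) < r -> enorm (x.2 - y.2) < r -> `|f x - f y| < e) ->
  measurable_fun setT f.
Proof.
move=> cf; apply: (@measurable_continuous_dense _ _ ('rV[rat]_d * 'rV[rat]_d)%type
  (fun q => (map_mx ratr q.1, map_mx ratr q.2))
  (fun x y => enorm (x.1 - y.1) + enorm (x.2 - y.2))) => //.
- move=> y; apply: measurable_funD; apply: (measurableT_comp measurable_enorm);
    exact: measurable_rVB.
- by move=> x y; rewrite enormBC (enormBC x.2).
- move=> x y z; rewrite addrACA lerD//.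
  + by rewrite (_ : x.1 - z.1 = (x.1 - y.1) + (y.1 - z.1)) ?enormD// addrA subrK.
  + by rewrite (_ : x.2 - z.2 = (x.2 - y.2) + (y.2 - z.2)) ?enormD// addrA subrK.
- move=> x e e0; have e2 : 0 < e / 2 by rewrite divr_gt0.
  have [q hq] := rV_dense x.1 e2; have [p hp] := rV_dense x.2 e2.
  by exists (q, p) => /=; rewrite (splitr e) ltrD.
- move=> x e e0; have [r r0 hr] := cf x e e0; exists r => // y h.
  by apply: hr; apply: le_lt_trans h; rewrite ?lerDl ?lerDr enorm_ge0.
Qed.

End measurable_dense.

(** * The complex modulus and [expi] *)

Section complex_numbers.
Context {R : realType}.
Implicit Types (z w : R[i]) (a b : R).

Lemma normc_norm z : `|z| = (normc z)%:C%C.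
Proof. by case: z. Qed.

Lemma normc_ge0 z : 0 <= normc z.
Proof. by case: z => a b; exact: sqrtr_ge0. Qed.

Lemma normcMl z w : normc (z * w) = normc z * normc w.
Proof. exact: ComplexField.Normc.normcM. Qed.

Lemma normcD z w : normc (z + w) <= normc z + normc w.
Proof. by rewrite -lecR rmorphD /= -!normc_norm ler_normD. Qed.

Lemma normcNE z : normc (- z) = normc z.
Proof. by apply: (@complexI R); rewrite -!normc_norm normrN. Qed.

Lemma normcBC z w : normc (z - w) = normc (w - z).
Proof. by rewrite -normcNE opprB. Qed.

Lemma normc_real a : normc a%:C%C = `|a|.
Proof. by rewrite /= expr0n /= addr0 sqrtr_sqr. Qed.

Lemma normc_0 : normc (0 : R[i]) = 0.
Proof. exact: ComplexField.Normc.normc0. Qed.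

Lemma normc_eq0 z : normc z = 0 -> z = 0.
Proof. exact: ComplexField.Normc.eq0_normc. Qed.

Lemma normc_Re z : `|complex.Re z| <= normc z.
Proof. by case: z => a b /=; rewrite -sqrtr_sqr ler_sqrt ?lerDl ?addr_ge0 ?sqr_ge0. Qed.

Lemma normc_Im z : `|complex.Im z| <= normc z.
Proof. by case: z => a b /=; rewrite -sqrtr_sqr ler_sqrt ?lerDr ?addr_ge0 ?sqr_ge0. Qed.

Lemma normc_le_ReIm z : normc z <= `|complex.Re z| + `|complex.Im z|.
Proof.
rewrite {1}[z]complexE; apply: le_trans (normcD _ _) _.
rewrite normcMl !normc_real (_ : normc 'i%C = 1) ?mul1r//.
by rewrite /= expr0n /= add0r expr1n sqrtr1.
Qed.

Lemma normc_sum (I : Type) (s : seq I) (P : pred I) (F : I -> R[i]) :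
  normc (\sum_(i <- s | P i) F i) <= \sum_(i <- s | P i) normc (F i).
Proof.
elim/big_ind2 : _ => [||i _//]; first by rewrite normc_0.
by move=> x a y b xa yb; apply: le_trans (normcD _ _) _; rewrite lerD.
Qed.

Lemma normcX z n : normc (z ^+ n) = normc z ^+ n.
Proof.
elim: n => [|n ih]; last by rewrite !exprS normcMl ih.
by rewrite !expr0 (normc_real 1) normr1.
Qed.

Lemma expi0 : expi (0 : R) = 1.
Proof. by rewrite /expi cos0 sin0. Qed.

Lemma expiD a b : expi (a + b) = expi a * expi b.
Proof.
rewrite /expi cosD sinD; apply/eqP; rewrite eq_complex /=.
by rewrite eqxx/= addrC eqxx.
Qed.

Lemma normc_expi a : normc (expi a) = 1.
Proof. by rewrite /= cos2Dsin2 sqrtr1. Qed.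

Lemma derivable_lip1 (f df : R -> R) : (forall x : R, is_derive x (1 : R) f (df x)) ->
  (forall x, `|df x| <= 1) -> forall a b, `|f a - f b| <= `|a - b|.
Proof.
move=> fd df1.
have cf : continuous f.
  by move=> x; apply/differentiable_continuous/derivable1_diffP; have [] := fd x.
have h a b : a <= b -> `|f b - f a| <= `|b - a|.
  move=> ab.
  have [c _ ->] := @MVT_segment _ f df a b ab (fun x _ => fd x)
    (continuous_subspaceT cf).
  by rewrite normrM ler_piMl.
move=> a b; have [/h|/ltW/h//] := leP a b.
by rewrite distrC (distrC b).
Qed.

Lemma expi_lip a b : normc (expi a - expi b) <= 2 * `|a - b|.
Proof.
apply: le_trans (normc_le_ReIm _) _; rewrite /= mulrDl mul1r lerD//.
- apply: (@derivable_lip1 _ (fun x => - sin x)) => x; rewrite normrN sin_max//.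
- by apply: (@derivable_lip1 _ cos) => x; exact: cos_max.
Qed.

End complex_numbers.

(** * Integrals of complex functions *)

Section complex_measurable.
Context {R : realType} {disp} {T : measurableType disp}.
Implicit Types (f g : T -> R[i]) (u : T -> R).

Definition cmeasurable f :=
  measurable_fun setT (fun x => complex.Re (f x)) /\
  measurable_fun setT (fun x => complex.Im (f x)).

Lemma cmeasurable_cst c : cmeasurable (fun=> c).
Proof. by split. Qed.

Lemma cmeasurable_real u : measurable_fun setT u -> cmeasurable (fun x => (u x)%:C%C).
Proof. by split. Qed.

Lemma cmeasurableD f g : cmeasurable f -> cmeasurable g ->
  cmeasurable (fun x => f x + g x).
Proof.
move=> [fr fi] [gr gi]; split; under eq_fun do rewrite raddfD; exact: measurable_funD.
Qed.

Lemma cmeasurableM f g : cmeasurable f -> cmeasurable g ->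
  cmeasurable (fun x => f x * g x).
Proof.
move=> [fr fi] [gr gi]; split.
  rewrite (_ : (fun _ => _) = fun x => complex.Re (f x) * complex.Re (g x) -
    complex.Im (f x) * complex.Im (g x)).
    by apply: measurable_funB; apply: measurable_funM.
  by apply/funext => x; case: (f x); case: (g x).
rewrite (_ : (fun _ => _) = fun x => complex.Re (f x) * complex.Im (g x) +
  complex.Im (f x) * complex.Re (g x)).
  by apply: measurable_funD; apply: measurable_funM.
by apply/funext => x; case: (f x); case: (g x).
Qed.

Lemma cmeasurable_sum (I : Type) (s : seq I) (F : I -> T -> R[i]) :
  (forall i, cmeasurable (F i)) -> cmeasurable (fun x => \sum_(i <- s) F i x).
Proof.
move=> mF; elim: s => [|i s ih].
  under eq_fun do rewrite big_nil; exact: cmeasurable_cst.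
by under eq_fun do rewrite big_cons; exact: cmeasurableD.
Qed.

Lemma cmeasurable_expi u : measurable_fun setT u -> cmeasurable (fun x => expi (u x)).
Proof.
by move=> mu; split; apply: (measurableT_comp _ mu); apply: continuous_measurable_fun;
  [exact: continuous_cos|exact: continuous_sin].
Qed.

End complex_measurable.

Lemma cmeasurable_comp (R : realType) d d' (T : measurableType d)
    (T' : measurableType d') (f : T' -> R[i]) (h : T -> T') :
  cmeasurable f -> measurable_fun setT h -> cmeasurable (fun x => f (h x)).
Proof. by move=> [fr fi] mh; split; [apply: (measurableT_comp fr)|apply: (measurableT_comp fi)]. Qed.

Section complex_integrable.
Context {R : realType} {disp} {T : measurableType disp}.
Variable m : {measure set T -> \bar R}.
Implicit Types (f g : T -> R[i]) (u v : T -> R).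

Definition rintegrable u := m.-integrable setT (EFin \o u).

Lemma rintegrable_dom u v : measurable_fun setT u -> (forall x, `|u x| <= v x) ->
  rintegrable v -> rintegrable u.
Proof.
move=> mu uv; apply: le_integrable => //; first exact/measurable_EFinP.
by move=> x _ /=; rewrite lee_fin (le_trans (uv x))// ler_norm.
Qed.

Lemma rintegrableZ u a : rintegrable u -> rintegrable (fun x => a * u x).
Proof.
by move=> iu; have := integrableZl measurableT a iu; apply: eq_integrable.
Qed.

Lemma rintegrableD u v : rintegrable u -> rintegrable v ->
  rintegrable (fun x => u x + v x).
Proof.
by move=> iu iv; have := integrableD measurableT iu iv; apply: eq_integrable.
Qed.

Lemma rintegrableB u v : rintegrable u -> rintegrable v ->
  rintegrable (fun x => u x - v x).
Proof.
by move=> iu iv; have := integrableB measurableT iu iv; apply: eq_integrable.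
Qed.

Definition cintegrable f :=
  rintegrable (fun x => complex.Re (f x)) /\ rintegrable (fun x => complex.Im (f x)).

Lemma cintegrable_dom f u : cmeasurable f -> (forall x, normc (f x) <= u x) ->
  rintegrable u -> cintegrable f.
Proof.
move=> [mr mi] fu iu; split; apply: (rintegrable_dom _ _ iu) => // x.
- exact: le_trans (normc_Re _) _.
- exact: le_trans (normc_Im _) _.
Qed.

Lemma eq_cintegral f g : (forall x, f x = g x) -> cintegral m f = cintegral m g.
Proof. by move=> fg; congr cintegral; exact/funext. Qed.

Lemma cintegrableD f g : cintegrable f -> cintegrable g ->
  cintegrable (fun x => f x + g x).
Proof.
move=> [fr fi] [gr gi]; split; under eq_fun do rewrite raddfD; exact: rintegrableD.
Qed.

Lemma cintegrableZ f c : cintegrable f -> cintegrable (fun x => c * f x).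
Proof.
case: c => a b [fr fi]; split.
  rewrite (_ : (fun _ => _) = fun x => a * complex.Re (f x) - b * complex.Im (f x)).
    by apply: rintegrableB; apply: rintegrableZ.
  by apply/funext => x; case: (f x).
rewrite (_ : (fun _ => _) = fun x => a * complex.Im (f x) + b * complex.Re (f x)).
  by apply: rintegrableD; apply: rintegrableZ.
by apply/funext => x; case: (f x).
Qed.

Lemma cintegralD f g : cintegrable f -> cintegrable g ->
  cintegral m (fun x => f x + g x) = cintegral m f + cintegral m g.
Proof.
move=> [fr fi] [gr gi]; rewrite /cintegral -[RHS]/(Complex _ _).
congr Complex; rewrite -RintegralD//; by under eq_Rintegral do rewrite raddfD.
Qed.

Lemma cintegralZ f c : cintegrable f ->
  cintegral m (fun x => c * f x) = c * cintegral m f.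
Proof.
case: c => a b [fr fi]; rewrite /cintegral -[RHS]/(Complex _ _).
congr Complex.
  rewrite -!RintegralZl// -RintegralB//; try exact: rintegrableZ.
  by apply: eq_Rintegral => x _; case: (f x).
rewrite -!RintegralZl// -RintegralD//; try exact: rintegrableZ.
by apply: eq_Rintegral => x _; case: (f x).
Qed.

Lemma cintegralN f : cintegrable f -> cintegral m (fun x => - f x) = - cintegral m f.
Proof.
by move=> fi; rewrite -mulN1r -cintegralZ//; apply: eq_cintegral => x; rewrite mulN1r.
Qed.

Lemma cintegrableN f : cintegrable f -> cintegrable (fun x => - f x).
Proof.
by move=> /cintegrableZ -/(_ (-1)); under eq_fun do rewrite mulN1r.
Qed.

Lemma cintegralB f g : cintegrable f -> cintegrable g ->
  cintegral m (fun x => f x - g x) = cintegral m f - cintegral m g.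
Proof.
by move=> fi gi; rewrite cintegralD ?cintegralN//; exact: cintegrableN.
Qed.

Lemma cintegrableB f g : cintegrable f -> cintegrable g ->
  cintegrable (fun x => f x - g x).
Proof. by move=> fi gi; apply: cintegrableD => //; exact: cintegrableN. Qed.

Lemma cintegral0 : cintegral m (fun=> 0) = 0.
Proof.
by rewrite /cintegral; under eq_Rintegral do [];
  rewrite /Rintegral integral0.
Qed.

Lemma cintegral_sum (I : Type) (s : seq I) (F : I -> T -> R[i]) :
  (forall i, cintegrable (F i)) ->
  cintegral m (fun x => \sum_(i <- s) F i x) = \sum_(i <- s) cintegral m (F i) /\
  cintegrable (fun x => \sum_(i <- s) F i x).
Proof.
move=> iF; elim: s => [|i s [ih1 ih2]].
  split; first by rewrite big_nil -[RHS]cintegral0; apply: eq_cintegral => x; rewrite big_nil.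
  by split; under eq_fun do rewrite big_nil; exact: integrable0.
split; last by under eq_fun do rewrite big_cons; exact: cintegrableD.
by under eq_fun do rewrite big_cons; rewrite cintegralD// ih1 big_cons.
Qed.

Lemma Rintegral_indicator A (r : R) : measurable A -> m A = r%:E ->
  rintegrable (\1_A) /\ Rintegral m setT (\1_A) = r.
Proof.
move=> mA Ar; split; last by rewrite /Rintegral integral_indic// setIT Ar.
apply/integrableP; split; first by apply/measurable_EFinP; exact: measurable_indic.
rewrite (_ : (fun x => _) = (fun x => (\1_A x)%:E)); last first.
  by apply/funext => x; rewrite /= ger0_norm.
by rewrite integral_indic// setIT Ar ltry.
Qed.

Lemma Rintegral_sum (I : Type) (s : seq I) (F : I -> T -> R) : (forall i, rintegrable (F i)) ->
  \sum_(i <- s) Rintegral m setT (F i) = Rintegral m setT (fun x => \sum_(i <- s) F i x) /\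
  rintegrable (fun x => \sum_(i <- s) F i x).
Proof.
move=> iF; elim: s => [|n s [IH1 IH2]].
  rewrite big_nil; under eq_fun do rewrite big_nil.
  by rewrite Rintegral_cst// mul0r; split => //; exact: integrable0.
split; last by under eq_fun do rewrite big_cons; exact: rintegrableD.
rewrite big_cons IH1 -RintegralD//; last exact: iF.
by apply: eq_Rintegral => x _; rewrite big_cons.
Qed.

Lemma norm_Rintegral_le u v : measurable_fun setT u -> (forall x, `|u x| <= v x) ->
  rintegrable v -> `|Rintegral m setT u| <= Rintegral m setT v.
Proof.
move=> mu uv iv; have iu := rintegrable_dom mu uv iv.
apply: le_trans (le_normr_Rintegral _ _) _ => //.
apply: le_Rintegral => //; apply: (rintegrable_dom _ _ iv) => [|x].
  exact: measurableT_comp.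
by rewrite normr_id.
Qed.

(** The real and imaginary parts are estimated separately, which costs a
    factor two. *)
Lemma normc_cintegral_le f u : cmeasurable f -> (forall x, normc (f x) <= u x) ->
  rintegrable u -> normc (cintegral m f) <= 2 * Rintegral m setT u.
Proof.
move=> [mr mi] fu iu; apply: le_trans (normc_le_ReIm _) _ => /=.
rewrite mulrDl mul1r lerD//; apply: norm_Rintegral_le => // x.
- exact: le_trans (normc_Re _) _.
- exact: le_trans (normc_Im _) _.
Qed.

End complex_integrable.

Section probability_bounds.
Context {R : realType} {disp} {T : measurableType disp}.
Variable m : probability T R.

Lemma rintegrable_cst a : rintegrable m (fun=> a).
Proof. exact: finite_measure_integrable_cst. Qed.

Lemma Rintegral_prob_cst a : Rintegral m setT (fun=> a) = a.
Proof.
by rewrite Rintegral_cst// (_ : _ setT = 1%E) ?mulr1//; exact: probability_setT.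
Qed.

Lemma normc_cintegral_prob (f : T -> R[i]) a : cmeasurable f ->
  (forall x, normc (f x) <= a) -> normc (cintegral m f) <= 2 * a.
Proof.
move=> mf fa; apply: le_trans (normc_cintegral_le mf fa (rintegrable_cst a)) _.
by rewrite Rintegral_prob_cst.
Qed.

Lemma cintegrable_prob (f : T -> R[i]) a : cmeasurable f ->
  (forall x, normc (f x) <= a) -> cintegrable m f.
Proof. by move=> mf fa; apply: cintegrable_dom mf fa (rintegrable_cst a). Qed.

End probability_bounds.

(** Used for translations and linear maps of Lebesgue measure, where [c] is
    the inverse of the determinant, and for orthogonal maps of the measures on
    spheres, where [c = 1]. *)
Section change_of_variables.
Context {R : realType} {disp} {T : measurableType disp}.
Variables (m : {measure set T -> \bar R}) (h : T -> T) (c : R).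
Hypothesis mh : measurable_fun setT h.
Hypothesis c0 : 0 <= c.
Hypothesis mE : forall A, measurable A -> m (h @^-1` A) = (c%:E * m A)%E.

Lemma ge0_integral_map (f : T -> \bar R) : measurable_fun setT f ->
  (forall x, (0 <= f x)%E) ->
  (\int[m]_x f (h x) = c%:E * \int[m]_x f x)%E.
Proof.
move=> mf f0; have := @ge0_integral_pushforward _ _ _ _ _ _ mh m setT f measurableT mf
  (fun x _ => f0 x).
rewrite preimage_setT => <-.
rewrite -(@ge0_integral_mscale _ _ _ m setT measurableT (NngNum c0) f)//.
by apply: eq_measure_integral => A mA _; exact: mE.
Qed.

Lemma rintegrable_map (u : T -> R) : rintegrable m u -> rintegrable m (fun x => u (h x)).
Proof.
move=> /integrableP[mu fin]; apply/integrableP; split.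
  exact: (measurableT_comp mu mh).
rewrite (ge0_integral_map (f := fun x => `|(u x)%:E|%E))//.
  by rewrite lte_mul_pinfty// integral_ge0.
exact: measurableT_comp.
Qed.

Lemma Rintegral_map (u : T -> R) : rintegrable m u ->
  Rintegral m setT (fun x => u (h x)) = c * Rintegral m setT u.
Proof.
move=> iu; have mu := measurable_int _ iu; rewrite /Rintegral.
rewrite (_ : c = fine c%:E)// -fineM//; last exact: integrable_fin_num.
congr fine; rewrite integralE [in RHS]integralE.
have ip := integrable_funepos measurableT iu.
have ing := integrable_funeneg measurableT iu.
rewrite muleBr//; last first.
  by apply: fin_num_adde_defr; exact: integrable_fin_num.
congr (_ - _)%E.
- rewrite -(ge0_integral_map (f := (EFin \o u)^\+%E))//; last exact: measurable_funepos.
  by apply: eq_integral => x _; rewrite !funeposE.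
- rewrite -(ge0_integral_map (f := (EFin \o u)^\-%E))//; last exact: measurable_funeneg.
  by apply: eq_integral => x _; rewrite !funenegE.
Qed.

Lemma cintegral_map (f : T -> R[i]) : cintegrable m f ->
  cintegral m (fun x => f (h x)) = c%:C%C * cintegral m f.
Proof.
move=> [fr fi]; rewrite /cintegral (Rintegral_map (u := fun x => complex.Re (f x)))//.
rewrite (Rintegral_map (u := fun x => complex.Im (f x)))//.
by apply/eqP; rewrite eq_complex /= !mul0r subr0 addr0 !eqxx.
Qed.

End change_of_variables.

(** Every double integral of complex functions below is dominated by a product
    of two integrable functions of one variable. *)
Section complex_fubini.
Context {R : realType} {d1 d2} {T1 : measurableType d1} {T2 : measurableType d2}.
Variables (m1 : {sigma_finite_measure set T1 -> \bar R}).
Variables (m2 : {sigma_finite_measure set T2 -> \bar R}).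

Variables (u : T1 -> R) (v : T2 -> R).
Hypotheses (iu : rintegrable m1 u) (iv : rintegrable m2 v).
Implicit Types F : T1 * T2 -> R.

Lemma rintegrable_prod F : measurable_fun setT F ->
  (forall x y, `|F (x, y)| <= u x * v y) ->
  (m1 \x m2)%E.-integrable setT (EFin \o F).
Proof.
move=> mF Fuv; apply/integrable12ltyP; first exact/measurable_EFinP.
have /integrableP[mu fu] := iu; have /integrableP[mv fv] := iv.
apply: (@le_lt_trans _ _ (\int[m1]_x (`|(u x)%:E| * \int[m2]_y `|(v y)%:E|)))%E.
  apply: ge0_le_integral => //.
  - by move=> x _; exact: integral_ge0.
  - apply: (measurable_fun_fubini_tonelli_F (fun z => `|(F z)%:E|%E)) => //.
    by apply: measurableT_comp => //; exact/measurable_EFinP.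
  - by apply: emeasurable_funM => //; exact: measurableT_comp.
  move=> x _; rewrite -ge0_integralZl//; last exact: measurableT_comp.
  apply: ge0_le_integral => //.
  - apply: measurableT_comp => //; apply/measurable_EFinP.
    by apply: (measurableT_comp mF); exact: pair1_measurable.
  - by apply: emeasurable_funM => //; exact: measurableT_comp.
  by move=> y _; rewrite -abseM lee_fin (le_trans (Fuv _ _))// ler_norm.
rewrite ge0_integralZr//; last 2 first.
  exact: measurableT_comp.
  exact: integral_ge0.
rewrite lte_mul_pinfty//; first exact: integral_ge0.
by rewrite ge0_fin_numE// integral_ge0.
Qed.

Lemma rintegrable_section1 F x : measurable_fun setT F ->
  (forall x y, `|F (x, y)| <= u x * v y) -> rintegrable m2 (fun y => F (x, y)).
Proof.
move=> mF Fuv; apply: rintegrable_dom (rintegrableZ (u x) iv) => //.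
by apply: (measurableT_comp mF); exact: pair1_measurable.
Qed.

Lemma rintegrable_section2 F y : measurable_fun setT F ->
  (forall x y, `|F (x, y)| <= u x * v y) -> rintegrable m1 (fun x => F (x, y)).
Proof.
move=> mF Fuv; apply: rintegrable_dom (rintegrableZ (v y) iu) => [|x].
  by apply: (measurableT_comp mF); exact: pair2_measurable.
by rewrite mulrC.
Qed.

Lemma rintegrable_fubini1 F : measurable_fun setT F ->
  (forall x y, `|F (x, y)| <= u x * v y) ->
  rintegrable m1 (fun x => Rintegral m2 setT (fun y => F (x, y))).
Proof.
move=> mF Fuv; have := integrable_fubini_F (rintegrable_prod mF Fuv).
apply: eq_integrable => // x _ /=; rewrite fineK//.
by apply: integrable_fin_num => //; exact: rintegrable_section1.
Qed.

Lemma Rintegral_fubini F : measurable_fun setT F ->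
  (forall x y, `|F (x, y)| <= u x * v y) ->
  Rintegral m1 setT (fun x => Rintegral m2 setT (fun y => F (x, y))) =
  Rintegral m2 setT (fun y => Rintegral m1 setT (fun x => F (x, y))).
Proof.
move=> mF Fuv; congr fine; transitivity (\int[m1]_x \int[m2]_y (F (x, y))%:E)%E.
  apply: eq_integral => x _; rewrite fineK//.
  by apply: integrable_fin_num => //; exact: rintegrable_section1.
rewrite (Fubini (rintegrable_prod mF Fuv)).
apply: eq_integral => y _; rewrite fineK//.
by apply: integrable_fin_num => //; exact: rintegrable_section2.
Qed.

Lemma cintegrable_fubini1 (F : T1 * T2 -> R[i]) : cmeasurable F ->
  (forall x y, normc (F (x, y)) <= u x * v y) ->
  cintegrable m1 (fun x => cintegral m2 (fun y => F (x, y))).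
Proof.
move=> [mr mi] Fuv; split.
- by apply: (rintegrable_fubini1 mr) => x y; exact: le_trans (normc_Re _) (Fuv _ _).
- by apply: (rintegrable_fubini1 mi) => x y; exact: le_trans (normc_Im _) (Fuv _ _).
Qed.

Lemma cintegral_fubini (F : T1 * T2 -> R[i]) : cmeasurable F ->
  (forall x y, normc (F (x, y)) <= u x * v y) ->
  cintegral m1 (fun x => cintegral m2 (fun y => F (x, y))) =
  cintegral m2 (fun y => cintegral m1 (fun x => F (x, y))).
Proof.
move=> [mr mi] Fuv; rewrite /cintegral /=; congr Complex.
- by apply: (Rintegral_fubini mr) => x y; exact: le_trans (normc_Re _) (Fuv _ _).
- by apply: (Rintegral_fubini mi) => x y; exact: le_trans (normc_Im _) (Fuv _ _).
Qed.

End complex_fubini.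

(** * Lebesgue measure on row vectors *)

Section lebesgue_translation.
Context {R : realType}.

Lemma lebesgue_measure_translate (a : R) (A : set R) : measurable A ->
  lebesgue_measure ((fun x => x + a) @^-1` A) = lebesgue_measure A.
Proof.
have mt : measurable_fun setT (fun x : measurableTypeR R => x + a : measurableTypeR R).
  exact: measurable_funD.
move=> mA; apply/esym.
have := @lebesgue_measure_unique R (pushforward lebesgue_measure
  (fun x : measurableTypeR R => x + a : measurableTypeR R)).
apply => // _ [[x y] _ <-] /=; rewrite /pushforward /=.
rewrite (_ : _ @^-1` _ = `]x - a, y - a]%classic); last first.
  by apply/seteqP; split => z /=; rewrite !in_itv/= ltrBlDr lerBrDr.
rewrite !lebesgue_measure_itv /= !lte_fin ltrD2r; case: ifP => // _.
by rewrite -!EFinB opprB addrA subrK.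
Qed.

Lemma consrV0 d (p : R * 'rV[R]_d) : consrV p 0 ord0 = p.1.
Proof.
rewrite (_ : ord0 = lshift d (0 : 'I_1)); last exact: val_inj.
by etransitivity; [exact: row_mxEl|rewrite mxE eqxx].
Qed.

Lemma consrVS d (p : R * 'rV[R]_d) i : consrV p 0 (lift ord0 i) = p.2 0 i.
Proof.
rewrite (_ : lift ord0 i = rshift 1 i); last exact: val_inj.
exact: row_mxEr.
Qed.

Lemma rV_succP d (x : 'rV[R]_d.+1) : exists a v, x = consrV (a, v).
Proof.
exists (x 0 ord0), (\row_i x 0 (lift ord0 i)); apply/rowP => j.
by case: (unliftP ord0 j) => [i|] ->; rewrite ?consrVS ?consrV0 ?mxE.
Qed.

Lemma consrVD d a b (v w : 'rV[R]_d) :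
  consrV (a, v) + consrV (b, w) = consrV (a + b, v + w).
Proof.
apply/rowP => j; rewrite mxE.
by case: (unliftP ord0 j) => [i|] ->; rewrite ?consrVS ?consrV0 ?mxE.
Qed.

Lemma dotp_consrV d a b (v w : 'rV[R]_d) :
  dotp (consrV (a, v)) (consrV (b, w)) = a * b + dotp v w.
Proof.
rewrite /dotp big_ord_recl !consrV0; congr (_ + _).
by apply: eq_bigr => i _; rewrite !consrVS.
Qed.

Lemma consrVM d a (v : 'rV[R]_d) (b : 'M[R]_1) (u : 'M[R]_(1, d))
    (l : 'M[R]_(d, 1)) (D : 'M[R]_d) :
  (consrV (a, v) : 'rV[R]_(1 + d)) *m block_mx b u l D =
  consrV ((a * b 0 0 + (v *m l) 0 0), a *: u + v *m D).
Proof.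
rewrite /consrV /= mul_row_block; congr row_mx; last by rewrite mul_scalar_mx.
by rewrite [LHS]mx11_scalar !mxE big_ord1 mxE eqxx mulr1n.
Qed.

Local Notation lam d := (lebesgue_rV R d).

Lemma ge0_integral_lebesgue_succ d (f : 'rV[R]_d.+1 -> \bar R) :
  measurable_fun setT f -> (forall x, (0 <= f x)%E) ->
  (\int[lam d.+1]_x f x =
   \int[lebesgue_measure]_a \int[lam d]_v f (consrV (a, v)))%E.
Proof.
move=> mf f0.
rewrite -(fubini_tonelli1 (fun p => f (consrV p)))//; last first.
  exact: (measurableT_comp mf measurable_consrV).
have := ge0_integral_pushforward (@measurable_consrV R d)
  (lebesgue_measure \x lam d)%E measurableT mf (fun x _ => f0 x).
rewrite preimage_setT => <-; apply: eq_measure_integral => //.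
exact: measurable_consrV.
Qed.

Lemma lebesgue_rV_prod d (I : set R) (E' : set 'rV[R]_d) (E : set 'rV[R]_d.+1) :
  measurable I -> measurable E' -> consrV @^-1` E = I `*` E' ->
  lam d.+1 E = (lebesgue_measure I * lam d E')%E.
Proof.
move=> mI mE' h.
have := product_measure1E lebesgue_measure (lam d) mI mE'.
by rewrite -h => <-.
Qed.

Lemma measurable_translate d (a : 'rV[R]_d) : measurable_fun setT (fun x : 'rV[R]_d => x + a).
Proof. exact: measurable_rVD. Qed.

Lemma integral_indic_preimage d (h : 'rV[R]_d -> 'rV[R]_d) A :
  measurable_fun setT h -> measurable A ->
  (\int[lam d]_x (\1_A (h x))%:E = lam d (h @^-1` A))%E.
Proof.
move=> mh mA; have mB : measurable (h @^-1` A).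
  by rewrite -[X in measurable X]setTI; exact: mh.
by rewrite -[in RHS](setIT (h @^-1` A)) -integral_indic.
Qed.

Lemma lebesgue_translate d (a : 'rV[R]_d) A : measurable A ->
  lam d ((fun x => x + a) @^-1` A) = lam d A.
Proof.
elim: d a A => [|d IH] a A mA.
  congr (lam 0 _); apply/seteqP; split => x /=;
    by rewrite (_ : x + a = x)//; apply/rowP => -[].
have [s [w ->]] := rV_succP a.
have mI : measurable_fun setT (fun x : 'rV[R]_d.+1 => (\1_A x)%:E : \bar R).
  by apply/measurable_EFinP; exact: measurable_indic.
rewrite -integral_indic_preimage//; last exact: measurable_translate.
rewrite ge0_integral_lebesgue_succ; last 2 first.
  by apply: (measurableT_comp mI); exact: measurable_translate.
  by move=> x; rewrite lee_fin.
pose g (t : R) : \bar R := (\int[lam d]_v (\1_A (consrV (t, v)))%:E)%E.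
transitivity (\int[lebesgue_measure]_t g (t + s)%R)%E.
  apply: eq_integral => t _; rewrite /g.
  under eq_integral do rewrite consrVD.
  have := @ge0_integral_map R _ _ (lam d) (fun v => v + w) 1 (measurable_translate w) ler01
    _ (fun v => (\1_A (consrV (t + s, v)))%:E).
  rewrite mul1e; apply => [B mB||x]; first by rewrite mul1e; exact: IH.
  - apply: (measurableT_comp mI); apply: (measurableT_comp (measurable_consrV)).
    exact: pair1_measurable.
  - by rewrite lee_fin.
have := @ge0_integral_map R _ _ (@lebesgue_measure R) (fun t => t + s) 1 _ ler01
  _ g.
rewrite mul1e => ->//.
- rewrite -[in RHS](setIT A) -integral_indic// ge0_integral_lebesgue_succ//.
- exact: measurable_funD.
- by move=> B mB; rewrite mul1e; exact: lebesgue_measure_translate.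
- apply: (measurable_fun_fubini_tonelli_F (fun p => (\1_A (consrV p))%:E)) => [|p].
    exact: (measurableT_comp mI measurable_consrV).
  by rewrite lee_fin.
- by move=> t; apply: integral_ge0 => v _; rewrite lee_fin.
Qed.

End lebesgue_translation.

(** * Lebesgue measure and linear maps *)

Section lebesgue_linear.
Context {R : realType}.
Local Notation lam d := (lebesgue_rV R d).

Definition box d (I : set R) : set 'rV[R]_d := [set x | forall i, I (x 0 i)].
Arguments box : clear implicits.

Lemma measurable_box (d : nat) (I : set R) : measurable I -> measurable (box d I).
Proof.
move=> mI; rewrite (_ : box d I = \bigcap_(i in [set: 'I_d]) ((fun x => x 0 i) @^-1` I)).
  apply: fin_bigcap_measurable => // i _.
  by rewrite -[X in measurable X]setTI; exact: measurable_rV_coord.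
by apply/seteqP; split => [x h i _|x h i]; [exact: h|exact: (h i)].
Qed.

Arguments measurable_box : clear implicits.
Arguments measurable_box d {I}.

Lemma consrV_box d (I : set R) : consrV @^-1` (box d.+1 I) = I `*` box d I.
Proof.
apply/seteqP; split => [p h|p [h1 h2] j].
  split => [|i]; first by have := h ord0; rewrite consrV0.
  by have := h (lift ord0 i); rewrite consrVS.
by case: (unliftP ord0 j) => [i|] ->; rewrite ?consrVS ?consrV0.
Qed.

Lemma lebesgue_box d (I : set R) (r : R) : measurable I ->
  lebesgue_measure I = r%:E -> lam d (box d I) = (r ^+ d)%:E.
Proof.
move=> mI Ir; elim: d => [|d IH].
  by rewrite /= diracE mem_set // => -[].
by rewrite (lebesgue_rV_prod mI (measurable_box _ mI) (consrV_box _ _)) Ir IH -EFinM -exprS.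
Qed.

(** Closed, so that it is symmetric around the origin. *)
Definition ccube d : set 'rV[R]_d := box d `[- 2^-1, 2^-1].
Arguments ccube : clear implicits.

Lemma measurable_ccube d : measurable (ccube d).
Proof. exact: measurable_box. Qed.

Lemma lebesgue_ccube d : lam d (ccube d) = 1%E.
Proof.
rewrite (@lebesgue_box d _ 1) ?expr1n//.
rewrite lebesgue_measure_itv /= lte_fin ifT -?EFinB; last by lra.
by congr EFin; lra.
Qed.

Lemma ccubeN d x : ccube d (- x) = ccube d x.
Proof.
apply/propext; split => h i; have := h i; rewrite /= !in_itv /= mxE.
  by move=> /andP[]; lra.
by move=> /andP[a b]; apply/andP; split; lra.
Qed.

Definition vol d (B : 'M[R]_d) := lam d ((fun x => x *m B) @^-1` ccube d).

Lemma measurable_preimage_mulmx d (B : 'M[R]_d) A : measurable A ->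
  measurable ((fun x : 'rV[R]_d => x *m B) @^-1` A).
Proof. by move=> mA; rewrite -[X in measurable X]setTI; exact: measurable_rVM. Qed.

(** Integrating the indicator of the pairs [(x, y)] with [x B + y] in [A] and
    [y] in the unit cube in both orders compares the measures of [A] and of its
    preimage: Lebesgue measure is the only translation invariant measure up to
    a factor. *)
Lemma lebesgue_mulmx_vol d (B : 'M[R]_d) A : B \in unitmx -> measurable A ->
  lam d ((fun x => x *m B) @^-1` A) = (vol B * lam d A)%E.
Proof.
move=> uB mA.
have mC : measurable (ccube d) by exact: measurable_ccube.
pose F (p : 'rV[R]_d * 'rV[R]_d) : \bar R := (\1_A (p.1 *m B + p.2) * \1_(ccube d) p.2)%:E.
have mind (E : set 'rV[R]_d) (h : 'rV[R]_d * 'rV[R]_d -> 'rV[R]_d) : measurable E ->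
    measurable_fun setT h -> measurable_fun setT (fun p => \1_E (h p) : R).
  by move=> mE mh; apply: (measurableT_comp _ mh); exact: measurable_indic.
have mxB : measurable_fun setT (fun p : 'rV[R]_d * 'rV[R]_d => p.1 *m B).
  exact: (measurableT_comp (measurable_rVM B) measurable_fst).
have mF : measurable_fun setT F.
  apply/measurable_EFinP; apply: measurable_funM; apply: mind => //.
  by apply: measurable_rVD => //; exact: measurable_snd.
have F0 p : (0 <= F p)%E by rewrite lee_fin mulr_ge0.
pose G (p : 'rV[R]_d * 'rV[R]_d) : \bar R := (\1_A p.2 * \1_(ccube d) (p.2 - p.1 *m B))%:E.
have mG : measurable_fun setT G.
  apply/measurable_EFinP; apply: measurable_funM; apply: mind => //.
  by apply: measurable_rVB => //; exact: measurable_snd.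
have G0 p : (0 <= G p)%E by rewrite lee_fin mulr_ge0.
have trans y E : measurable E -> lam d ((fun x => x *m B + y) @^-1` E) =
    lam d ((fun x => x *m B) @^-1` E).
  move=> mE; rewrite -(lebesgue_translate (y *m invmx B) (measurable_preimage_mulmx B mE)).
  congr (lam d _); apply/seteqP; split => x /=;
    by rewrite mulmxDl -mulmxA mulVmx// mulmx1.
have intF : (\int[lam d]_y \int[lam d]_x F (x, y) =
    lam d ((fun x => x *m B) @^-1` A))%E.
  transitivity (\int[lam d]_y (lam d ((fun x => x *m B) @^-1` A) * (\1_(ccube d) y)%:E))%E.
    apply: eq_integral => y _; rewrite /F /=.
    under eq_integral do rewrite EFinM muleC.
    rewrite ge0_integralZl//; last first.
      apply/measurable_EFinP; apply: (measurableT_comp (measurable_indic mA)).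
      by apply: measurable_rVD => //; exact: measurable_rVM.
    rewrite integral_indic_preimage//; last first.
      by apply: measurable_rVD => //; exact: measurable_rVM.
    by rewrite trans// muleC.
  rewrite ge0_integralZl//; last by apply/measurable_EFinP; exact: measurable_indic.
  by rewrite integral_indic// setIT [X in (_ * X)%E](lebesgue_ccube d) mule1.
have intG : (\int[lam d]_y \int[lam d]_x G (x, y) = vol B * lam d A)%E.
  transitivity (\int[lam d]_y (vol B * (\1_A y)%:E))%E.
    apply: eq_integral => y _; rewrite /G /=.
    under eq_integral do rewrite EFinM.
    rewrite ge0_integralZl//; last first.
      apply/measurable_EFinP; apply: (measurableT_comp (measurable_indic mC)).
      by apply: measurable_rVB => //; exact: measurable_rVM.
    rewrite integral_indic_preimage//; last first.
      by apply: measurable_rVB => //; exact: measurable_rVM.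
    rewrite muleC; congr (_ * _)%E; rewrite /vol -(trans (- y) _ mC).
    congr (lam d _); apply/seteqP; split => x /=; rewrite -(ccubeN (y - _)) opprB//.
  rewrite ge0_integralZl//; last by apply/measurable_EFinP; exact: measurable_indic.
  by rewrite integral_indic// setIT.
have FG x y : F (x, y) = G (x, y + x *m B) by rewrite /F /G /= addrK addrC.
have mGx x : measurable_fun setT (fun y => G (x, y)).
  by apply: (measurableT_comp mG); exact: pair1_measurable.
clearbody F G.
transitivity (\int[lam d]_y \int[lam d]_x F (x, y))%E; first exact/esym.
transitivity (\int[lam d]_y \int[lam d]_x G (x, y))%E; last exact: intG.
have fF := @fubini_tonelli _ _ _ _ _ (lam d) (lam d) F mF F0.
have fG := @fubini_tonelli _ _ _ _ _ (lam d) (lam d) G mG G0.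
etransitivity; first exact: (esym fF).
etransitivity; last exact: fG.
apply: eq_integral => x _.
have tr E : measurable E -> lam d ((fun y => y + x *m B) @^-1` E) = (1%:E * lam d E)%E.
  by move=> mE; rewrite mul1e; exact: lebesgue_translate.
have mapG := ge0_integral_map (measurable_translate _) ler01 tr (mGx x) (fun y => G0 (x, y)).
rewrite mul1e in mapG; rewrite -mapG.
by apply: eq_integral => y _; rewrite FG.
Qed.

Lemma volM d (A B : 'M[R]_d) : A \in unitmx -> vol (A *m B) = (vol A * vol B)%E.
Proof.
move=> uA; have mB := measurable_preimage_mulmx B (measurable_ccube (d := d)).
rewrite -[RHS](lebesgue_mulmx_vol uA mB) /vol.
by congr (lam d _); apply/seteqP; split => x /=; rewrite mulmxA.
Qed.

Lemma vol1 d : vol (1%:M : 'M[R]_d) = 1%E.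
Proof.
rewrite /vol -(lebesgue_ccube d); congr (lam d _).
by apply/seteqP; split => x /=; rewrite mulmx1.
Qed.

Lemma vol_fin d (B : 'M[R]_d) : B \in unitmx ->
  exists2 r : R, 0 < r & vol B = r%:E.
Proof.
move=> uB; have := volM (invmx B) uB; rewrite mulmxV// vol1.
move=> h; have r0 : (0 <= vol B)%E by exact: measure_ge0.
have s0 : (0 <= vol (invmx B))%E by exact: measure_ge0.
have rn0 : vol B != 0%E by apply/eqP => e; move: h; rewrite e mul0e => /eqP; rewrite onee_eq0.
have sn0 : vol (invmx B) != 0%E.
  by apply/eqP => e; move: h; rewrite e mule0 => /eqP; rewrite onee_eq0.
have rf : vol B \is a fin_num.
  rewrite ge0_fin_numE// ltey; apply/eqP => e; move: h; rewrite e gt0_mulye//.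
  by rewrite lt0e sn0.
exists (fine (vol B)); last by rewrite fineK.
by apply: fine_gt0; rewrite lt0e rn0 r0 /= -ge0_fin_numE.
Qed.

Lemma vol_idem d (B : 'M[R]_d) : B \in unitmx -> vol B = (vol B * vol B)%E -> vol B = 1%E.
Proof.
move=> uB; have [r r0 ->] := vol_fin uB; rewrite -EFinM => -[] /eqP.
by rewrite -{1}(mulr1 r) (inj_eq (mulfI (lt0r_neq0 r0))) => /eqP <-.
Qed.

Lemma vol_sqr1 d (B : 'M[R]_d) : B \in unitmx -> B *m B = 1%:M -> vol B = 1%E.
Proof.
move=> uB /(congr1 (@vol d)); rewrite volM// vol1; have [r r0 ->] := vol_fin uB.
rewrite -EFinM => -[] rr; congr EFin; apply/eqP; rewrite -subr_eq0.
have : (r - 1) * (r + 1) == 0 by rewrite -subr_sqr expr2 rr expr1n subrr.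
by rewrite mulf_eq0 => /orP[//|]; rewrite gt_eqF// addr_gt0.
Qed.

(** Conjugation by a dilation of one coordinate squares a shear, so the volume
    of a shear is its own square. *)
Lemma vol_shear_upper n (u : 'M[R]_(1, n)) :
  vol (block_mx 1%:M u 0 1%:M : 'M[R]_(1 + n)) = 1%E.
Proof.
pose U (u : 'M[R]_(1, n)) := block_mx 1%:M u 0 1%:M : 'M[R]_(1 + n).
pose E : 'M[R]_(1 + n) := block_mx 2%:M 0 0 1%:M.
have uU v : U v \in unitmx by rewrite unitmxE det_ublock !det1 mul1r unitr1.
have uE : E \in unitmx.
  by rewrite unitmxE det_ublock det1 mulr1 det_mx11 mxE eqxx unitfE pnatr_eq0.
have UD v w : U v *m U w = U (v + w).
  by rewrite mulmx_block !mulmx0 !mul0mx !mulmx1 !mul1mx !addr0 add0r addrC.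
rewrite -/(U u); apply: vol_idem => //.
have half : u = 2^-1 *: u + 2^-1 *: u by rewrite -scalerDl (_ : 2^-1 + 2^-1 = 1) ?scale1r//; lra.
have : vol (U u *m E) = vol (E *m U (2^-1 *: u)).
  congr vol; rewrite !mulmx_block !mulmx0 !mul0mx !mulmx1 !mul1mx !addr0 !add0r.
  by rewrite mul_scalar_mx scalerA divff ?scale1r.
rewrite (volM _ (uU u)) (volM _ uE) [LHS]muleC; have [e e0 ->] := vol_fin uE.
have -> : vol (U u) = (vol (U (2^-1 *: u)) * vol (U (2^-1 *: u)))%E.
  by rewrite -(volM _ (uU _)) UD -half.
have [r r0 ->] := vol_fin (uU (2^-1 *: u)).
rewrite -!EFinM => -[] /(mulfI (lt0r_neq0 e0)) rr.
by rewrite !rr.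
Qed.

Lemma vol_shear_lower n (l : 'M[R]_(n, 1)) :
  vol (block_mx 1%:M 0 l 1%:M : 'M[R]_(1 + n)) = 1%E.
Proof.
pose U (u : 'M[R]_(n, 1)) := block_mx 1%:M 0 u 1%:M : 'M[R]_(1 + n).
pose E : 'M[R]_(1 + n) := block_mx 2%:M 0 0 1%:M.
have uU v : U v \in unitmx by rewrite unitmxE det_lblock !det1 mul1r unitr1.
have uE : E \in unitmx.
  by rewrite unitmxE det_ublock det1 mulr1 det_mx11 mxE eqxx unitfE pnatr_eq0.
have UD v w : U v *m U w = U (v + w).
  by rewrite mulmx_block !mulmx0 !mul0mx !mulmx1 !mul1mx !addr0 add0r.
rewrite -/(U l); apply: vol_idem => //.
have half : l = 2^-1 *: l + 2^-1 *: l by rewrite -scalerDl (_ : 2^-1 + 2^-1 = 1) ?scale1r//; lra.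
have : vol (U (2^-1 *: l) *m E) = vol (E *m U l).
  congr vol; rewrite !mulmx_block !mulmx0 !mul0mx !mulmx1 !mul1mx !addr0 !add0r.
  by rewrite mul_mx_scalar scalerA divff ?scale1r.
rewrite (volM _ (uU _)) (volM _ uE) [LHS]muleC; have [e e0 ->] := vol_fin uE.
have -> : vol (U l) = (vol (U (2^-1 *: l)) * vol (U (2^-1 *: l)))%E.
  by rewrite -(volM _ (uU _)) UD -half.
have [r r0 ->] := vol_fin (uU (2^-1 *: l)).
rewrite -!EFinM => -[] /(mulfI (lt0r_neq0 e0)) rr.
by rewrite -!rr.
Qed.

Lemma vol_diag n (a : R) (S : 'M[R]_n) : a != 0 ->
  vol (block_mx a%:M 0 0 S : 'M[R]_(1 + n)) = (`|a|^-1%:E * vol S)%E.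
Proof.
move=> a0; have an : 0 < `|a| by rewrite normr_gt0.
have mS := measurable_preimage_mulmx S (measurable_ccube (d := n)).
have mI : measurable [set t : R | `[- 2^-1, 2^-1]%classic (t * a)].
  rewrite -[X in measurable X]setTI.
  by apply: (measurable_funM (f := id) (g := cst a)) => //; exact: measurable_itv.
have lI : lebesgue_measure [set t : R | `[- 2^-1, 2^-1]%classic (t * a)] = `|a|^-1%:E.
  transitivity (lebesgue_measure (`[- (2^-1 / `|a|), 2^-1 / `|a|]%classic : set R)).
    congr lebesgue_measure.
    apply/seteqP; split => t /=; rewrite !in_itv /= -!ler_norml normrM.
      by rewrite ler_pdivlMr.
    by rewrite -ler_pdivlMr.
  rewrite lebesgue_measure_itv /= lte_fin ifT -?EFinB.
    by congr EFin; field; rewrite lt0r_neq0.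
  by rewrite gtrN// divr_gt0.
rewrite -lI; apply: (lebesgue_rV_prod mI mS).
have E p : (consrV p : 'rV[R]_(1 + n)) *m block_mx a%:M 0 0 S = consrV (p.1 * a, p.2 *m S).
  case: p => t v; rewrite consrVM mulmx0 scaler0 add0r !mxE /= ?eqxx ?mulr1n.
  by rewrite addr0.
apply/funext => p.
transitivity ((consrV @^-1` ccube n.+1) (p.1 * a, p.2 *m S)); first by rewrite /= -E.
by rewrite /ccube consrV_box.
Qed.

Lemma vol_tperm n (i j : 'I_n) : vol (tperm_mx i j : 'M[R]_n) = 1%E.
Proof.
by apply: vol_sqr1; rewrite ?unitmx_perm// -perm_mxM perm.tperm2 perm_mx1.
Qed.

(** Induction on the dimension: a permutation of two columns makes the corner
    entry invertible, and then the matrix is a product of two shears and a block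
    diagonal matrix. *)
Lemma vol_det d (B : 'M[R]_d) : B \in unitmx -> vol B = (`|\det B|^-1)%:E.
Proof.
elim: d B => [|d IH] B uB.
  have -> : B = 1%:M by apply/matrixP => -[].
  by rewrite vol1 det1 normr1 invr1.
suff main (M : 'M[R]_d.+1) : M \in unitmx -> M ord0 ord0 != 0 ->
    vol M = (`|\det M|^-1)%:E.
  have [j Bj] : exists j, B ord0 j != 0.
    apply/existsP; rewrite -negb_forall; apply/negP => /forallP h.
    have : row ord0 B = 0 by apply/rowP => j; rewrite !mxE; exact/eqP.
    move/(congr1 (mulmx^~ (invmx B))); rewrite -row_mul mulmxV// mul0mx => /rowP/(_ ord0).
    by rewrite !mxE eqxx => /eqP; rewrite oner_eq0.
  pose P := tperm_mx ord0 j : 'M[R]_d.+1.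
  have uP : P \in unitmx by rewrite unitmx_perm.
  have := main (B *m P); rewrite unitmx_mul uB uP => /(_ isT).
  rewrite -xcolE mxE perm.tpermL => /(_ Bj).
  rewrite xcolE (volM _ uB) vol_tperm mule1 => ->.
  by rewrite det_mulmx det_perm normrM normr_sign mulr1.
move: M; rewrite -[d.+1]/(1 + d)%N => M uM M00.
set a := M ord0 ord0.
pose u := ursubmx M; pose l := dlsubmx M.
pose S := drsubmx M - a^-1 *: (l *m u).
have ME : M = block_mx 1%:M 0 (a^-1 *: l) 1%:M *m block_mx a%:M 0 0 S *m
    block_mx 1%:M (a^-1 *: u) 0 1%:M.
  rewrite -[LHS]submxK !mulmx_block !mulmx0 !mul0mx !mulmx1 !mul1mx !addr0 !add0r.
  congr block_mx.
  - by rewrite [LHS]mx11_scalar !mxE; congr (M _ _)%:M; exact: val_inj.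
  - by rewrite mul_scalar_mx scalerA divff ?scale1r.
  - by rewrite mul_mx_scalar scalerA divff ?scale1r.
  - rewrite mul_mx_scalar scalerA divff// scale1r -scalemxAr.
    by rewrite /S addrC subrK.
have dM : \det M = a * \det S.
  by rewrite ME !det_mulmx det_lblock !det_ublock !det1 det_scalar1 !mul1r !mulr1.
have uS : S \in unitmx.
  by move: uM; rewrite !unitmxE dM !unitfE mulf_eq0 negb_or => /andP[].
have uL : (block_mx 1%:M 0 (a^-1 *: l) 1%:M : 'M[R]_(1 + d)) \in unitmx.
  by rewrite unitmxE det_lblock !det1 mul1r unitr1.
have uD : (block_mx a%:M 0 0 S : 'M[R]_(1 + d)) \in unitmx.
  by rewrite unitmxE det_ublock det_scalar1 -dM -unitmxE.
have uLD : block_mx 1%:M 0 (a^-1 *: l) 1%:M *m block_mx a%:M 0 0 S \in unitmx.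
  by rewrite unitmx_mul uL.
rewrite [in LHS]ME (volM _ uLD) (volM _ uL) vol_shear_lower vol_shear_upper mule1 mul1e.
by rewrite vol_diag// IH// -EFinM dM normrM invfM.
Qed.

Lemma lebesgue_mulmx d (B : 'M[R]_d) A : B \in unitmx -> measurable A ->
  lam d ((fun x => x *m B) @^-1` A) = ((`|\det B|^-1)%:E * lam d A)%E.
Proof. by move=> uB mA; rewrite lebesgue_mulmx_vol// vol_det. Qed.

End lebesgue_linear.

Arguments box {R} d I _.
Arguments ccube {R} d _.

Section lebesgue_invariance.
Context {R : realType} {d : nat}.
Local Notation lam := (lebesgue_rV R d).
Implicit Types (a : 'rV[R]_d) (u : 'rV[R]_d -> R) (f : 'rV[R]_d -> R[i]).

Lemma lebesgue_translate1 a A : measurable A ->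
  lam ((fun x => x + a) @^-1` A) = (1%:E * lam A)%E.
Proof. by move=> mA; rewrite mul1e; exact: lebesgue_translate. Qed.

Lemma det_orthogonal (Q : 'M[R]_d) : Q *m Q^T = 1%:M ->
  Q \in unitmx /\ `|\det Q| = 1.
Proof.
move=> QQ; have h : \det Q * \det Q = 1 by rewrite -{2}det_tr -det_mulmx QQ det1.
split; first by rewrite unitmxE unitfE; apply: contra_eq_neq h => ->; rewrite mul0r eq_sym oner_neq0.
by apply/eqP; rewrite -(@pexpr_eq1 _ _ 2)// expr2 -normrM h normr1.
Qed.

Lemma rintegrable_translate u a : rintegrable lam u ->
  rintegrable lam (fun x => u (x + a)).
Proof.
exact: (rintegrable_map (measurable_translate a) ler01 (lebesgue_translate1 a)).
Qed.

Lemma Rintegral_translate u a : rintegrable lam u ->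
  Rintegral lam setT (fun x => u (x + a)) = Rintegral lam setT u.
Proof.
move=> iu; rewrite -[RHS]mul1r.
exact: (Rintegral_map (measurable_translate a) ler01 (lebesgue_translate1 a)).
Qed.

Lemma cintegral_translate f a : cintegrable lam f ->
  cintegral lam (fun x => f (x + a)) = cintegral lam f.
Proof.
move=> iu; rewrite -[RHS]mul1r.
exact: (cintegral_map (measurable_translate a) ler01 (lebesgue_translate1 a)).
Qed.

Lemma cintegral_mulmx f (B : 'M[R]_d) : B \in unitmx -> cintegrable lam f ->
  cintegral lam (fun x => f (x *m B)) = (`|\det B|^-1)%:C%C * cintegral lam f.
Proof.
move=> uB; have c0 : 0 <= `|\det B|^-1 by rewrite invr_ge0.
by apply: (cintegral_map (measurable_rVM B) c0) => A mA; exact: lebesgue_mulmx.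
Qed.

End lebesgue_invariance.

(** * A radial integrable weight *)

Section weight.
Context {R : realType}.

(** Decay is measured by multiples of this function: it is radial, comparable
    to its translates, integrable, and summable over lattices. *)
Definition weight {d} (x : 'rV[R]_d) : R := (1 + enorm x ^+ 2)^-1 ^+ d.

Local Notation lam d := (lebesgue_rV R d).

Lemma weight_den_gt0 d (x : 'rV[R]_d) : 0 < 1 + enorm x ^+ 2.
Proof. by rewrite ltr_pwDl// sqr_ge0. Qed.

Lemma weight_gt0 d (x : 'rV[R]_d) : 0 < weight x.
Proof. by rewrite exprn_gt0// invr_gt0 weight_den_gt0. Qed.

Lemma weight_ge0 d (x : 'rV[R]_d) : 0 <= weight x.
Proof. exact/ltW/weight_gt0. Qed.

Lemma weight_le1 d (x : 'rV[R]_d) : weight x <= 1.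
Proof.
rewrite /weight exprn_ile1// ?invr_ge0 ?(ltW (weight_den_gt0 x))//.
by rewrite invf_le1 ?weight_den_gt0// lerDl sqr_ge0.
Qed.

Lemma weightN d (x : 'rV[R]_d) : weight (- x) = weight x.
Proof. by rewrite /weight enormN. Qed.

Lemma measurable_weight d : measurable_fun setT (fun x : 'rV[R]_d => weight x).
Proof.
rewrite (_ : (fun _ => _) = (fun t : R => (oneDsqr t)^-1 ^+ d) \o (@enorm R d))//.
apply: measurableT_comp (@measurable_enorm R d).
by apply: measurable_funX; apply: continuous_measurable_fun; exact: continuous_oneDsqrV.
Qed.

Lemma weight_le d (x y : 'rV[R]_d) c : 0 <= c ->
  1 + enorm x ^+ 2 <= c * (1 + enorm y ^+ 2) -> weight y <= c ^+ d * weight x.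
Proof.
move=> c0 h; rewrite /weight -exprMn; apply: lerXn2r.
- by rewrite nnegrE invr_ge0 ltW// weight_den_gt0.
- by rewrite nnegrE mulr_ge0// invr_ge0 ltW// weight_den_gt0.
by rewrite ler_pdivlMr ?weight_den_gt0// mulrC ler_pdivrMr ?weight_den_gt0.
Qed.

Lemma weight_near d (x y : 'rV[R]_d) r : enorm (x - y) <= r ->
  weight y <= (2 * (1 + r ^+ 2)) ^+ d * weight x.
Proof.
move=> h; have r0 : 0 <= r := le_trans (enorm_ge0 _) h.
apply: weight_le; first by rewrite mulr_ge0// addr_ge0// sqr_ge0.
have : enorm x <= r + enorm y.
  by rewrite -lerBlDr; apply: le_trans h; exact: le_trans (ler_norm _) (enorm_distl _ _).
have := enorm_ge0 x; have := enorm_ge0 y.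
move: (enorm x) (enorm y) => s t t0 s0 st.
have : s ^+ 2 <= (r + t) ^+ 2 by rewrite lerXn2r// ?nnegrE// addr_ge0.
have : 0 <= (r - t) ^+ 2 by exact: sqr_ge0.
have : 0 <= r ^+ 2 * t ^+ 2 by rewrite mulr_ge0// sqr_ge0.
rewrite !expr2; nra.
Qed.

Lemma weight_mulmx d (B : 'M[R]_d) :
  exists2 c, 0 < c & forall x, weight x <= c * weight (x *m B).
Proof.
have [c c0 h] := enorm_mulmx B; exists ((1 + c ^+ 2) ^+ d).
  by rewrite exprn_gt0// ltr_pwDl// sqr_ge0.
move=> x; apply: weight_le; first by rewrite addr_ge0// sqr_ge0.
have : enorm (x *m B) ^+ 2 <= (c * enorm x) ^+ 2.
  by rewrite lerXn2r// ?nnegrE ?enorm_ge0// mulr_ge0 ?enorm_ge0// ltW.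
rewrite exprMn; have := sqr_ge0 c; have := sqr_ge0 (enorm x); nra.
Qed.

Lemma weight_consrV d a (v : 'rV[R]_d) :
  weight (consrV (a, v)) <= (oneDsqr a)^-1 * weight v.
Proof.
rewrite /weight enorm_sqr dotp_consrV -expr2 -enorm_sqr exprS.
have h0 : 0 <= enorm v ^+ 2 by exact: sqr_ge0.
have a0 : 0 <= a ^+ 2 by exact: sqr_ge0.
apply: ler_pM; rewrite ?exprn_ge0 ?invr_ge0 ?addr_ge0//.
  by rewrite lef_pV2 ?posrE /oneDsqr ?ltr_pwDl ?addr_ge0// lerD2l lerDl.
apply: lerXn2r; rewrite ?nnegrE ?invr_ge0 ?addr_ge0//.
by rewrite lef_pV2 ?posrE ?ltr_pwDl ?addr_ge0// lerD2l lerDr.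
Qed.

Lemma integral_oneDsqr_lty :
  (\int[@lebesgue_measure R]_x ((oneDsqr x)^-1)%:E < +oo)%E.
Proof.
rewrite (@ge0_symfun_integralT _ (fun x => (oneDsqr x)^-1)).
- rewrite (_ : [set x : R | 0 <= x] = `[0, +oo[%classic); last first.
    by apply/seteqP; split => x/=; rewrite in_itv/= andbT.
  by rewrite integral0y_oneDsqr -EFinM ltry.
- by move=> x; rewrite invr_ge0 addr_ge0// sqr_ge0.
- exact: continuous_oneDsqrV.
- by move=> x /=; rewrite /oneDsqr sqrrN.
Qed.

Lemma rintegrable_weight d : rintegrable (lam d) weight.
Proof.
apply/integrableP; split; first by apply/measurable_EFinP; exact: measurable_weight.
suff : (\int[lam d]_x (weight x)%:E < +oo)%E.
  apply: le_lt_trans; rewrite le_eqVlt; apply/orP; left; apply/eqP.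
  by apply: eq_integral => x _ /=; rewrite ger0_norm// weight_ge0.
elim: d => [|d IH].
  rewrite (_ : (fun x => _) = cst 1%E); last first.
    by apply/funext => x; rewrite /weight expr0.
  rewrite integral_cst// mul1e /=.
  by rewrite diracT ltry.
have mw n : measurable_fun setT (fun x : 'rV[R]_n => (weight x)%:E).
  by apply/measurable_EFinP; exact: measurable_weight.
have m1 : measurable_fun setT (fun a : R => ((oneDsqr a)^-1)%:E).
  by apply/measurable_EFinP; apply: continuous_measurable_fun; exact: continuous_oneDsqrV.
rewrite ge0_integral_lebesgue_succ//; last by move=> x; rewrite lee_fin weight_ge0.
have o0 (a : R) : (0 <= ((oneDsqr a)^-1)%:E)%E.
  by rewrite lee_fin invr_ge0 addr_ge0// sqr_ge0.
apply: (@le_lt_trans _ _ (\int[lebesgue_measure]_(a in [set: R])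
   (((oneDsqr a)^-1)%:E * \int[lam d]_v (weight v)%:E)))%E.
  apply: ge0_le_integral => //.
  - by move=> a _; apply: integral_ge0 => v _; rewrite lee_fin weight_ge0.
  - apply: (measurable_fun_fubini_tonelli_F (fun p => (weight (consrV p))%:E)) => [|p].
      exact: (measurableT_comp (mw d.+1) measurable_consrV).
    by rewrite lee_fin weight_ge0.
  - by apply: emeasurable_funM.
  move=> a _; rewrite -ge0_integralZl//; last 2 first.
  - exact: mw.
  - by move=> x _; rewrite lee_fin weight_ge0.
  apply: ge0_le_integral => //.
  - by move=> x _; rewrite lee_fin weight_ge0.
  - apply: (measurableT_comp (mw d.+1)).
    by apply: (measurableT_comp measurable_consrV); exact: pair1_measurable.
  - by apply: emeasurable_funM => //; exact: mw.
  - by move=> v _; rewrite -EFinM lee_fin weight_consrV.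
rewrite ge0_integralZr//; last first.
  by apply: integral_ge0 => v _; rewrite lee_fin weight_ge0.
rewrite lte_mul_pinfty//.
- by apply: integral_ge0 => a _; exact: o0.
- rewrite ge0_fin_numE; first exact: integral_oneDsqr_lty.
  by apply: integral_ge0 => a _; exact: o0.
Qed.

Lemma weight_bound_ge0 d (f : 'rV[R]_d -> R[i]) C :
  (forall x, normc (f x) <= C * weight x) -> 0 <= C.
Proof.
by move=> fC; have := le_trans (normc_ge0 _) (fC 0); rewrite pmulr_lge0// weight_gt0.
Qed.

Definition weight_mass d : R := Rintegral (lam d) setT weight.

Lemma weight_mass_ge0 d : 0 <= weight_mass d.
Proof. by apply: Rintegral_ge0 => x _; exact: weight_ge0. Qed.

End weight.

(** * Unordered sums *)

Section unordered_sums.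
Local Open Scope fset_scope.
Local Open Scope ring_scope.
Context {R : realType}.

Lemma big_fset_subset (V : nmodType) (I : choiceType) (A B : {fset I}) (F : I -> V) :
  (A `<=` B)%fset ->
  \sum_(i <- B) F i = \sum_(i <- A) F i + \sum_(i <- (B `\` A)%fset) F i.
Proof.
move=> AB; rewrite (big_fsetID _ (mem A)); congr (_ + _); apply: eq_fbigl => i.
  by rewrite !inE /= andbC; case: (boolP (i \in A)) => //= /(fsubsetP AB).
by rewrite !inE /= andbC.
Qed.

Lemma big_fset_disjointU (V : nmodType) (I : choiceType) (A B : {fset I}) (F : I -> V) :
  [disjoint A & B]%fset ->
  \sum_(i <- (A `|` B)%fset) F i = \sum_(i <- A) F i + \sum_(i <- B) F i.
Proof.
move=> AB; rewrite (@big_fset_subset _ _ A) ?fsubsetUl//; congr (_ + _).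
apply: eq_fbigl => i; rewrite !inE; have /fdisjointP/(_ i) := AB.
by case: (i \in A) => //= h; rewrite (negbTE (h isT)).
Qed.

Section hasum.
Context {I : choiceType}.
Implicit Types (F G : I -> R[i]) (b : I -> R) (s t : R[i]) (A : {fset I}).

(** The limit along the filter of finite subsets of [I], in elementary form. *)
Definition hasum F s := forall e : R, 0 < e -> exists A0 : {fset I},
  forall A, (A0 `<=` A)%fset -> normc (\sum_(i <- A) F i - s) < e.

Definition sum_le b (M : R) :=
  (forall i, 0 <= b i) /\ forall A, \sum_(i <- A) b i <= M.

Lemma eq_hasum F G s : F =1 G -> hasum F s -> hasum G s.
Proof. by move=> /funext ->. Qed.

Lemma hasum_unique F s t : hasum F s -> hasum F t -> s = t.
Proof.
move=> Fs Ft; apply/eqP; rewrite -subr_eq0; apply/negPn/negP => st.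
have e0 : 0 < normc (s - t).
  by rewrite lt_def normc_ge0 andbT; apply: contra st => /eqP/normc_eq0/eqP.
have e2 : 0 < normc (s - t) / 2 by rewrite divr_gt0.
have [A hA] := Fs _ e2; have [B hB] := Ft _ e2.
have h1 := hA (A `|` B)%fset (fsubsetUl _ _).
have h2 := hB (A `|` B)%fset (fsubsetUr _ _).
move: h1 h2; set S := \sum_(i <- _) _; rewrite (normcBC S s) => h1 h2.
have := normcD (s - S) (S - t); rewrite addrA subrK => h3.
by have := le_lt_trans h3 (ltrD h1 h2); rewrite -splitr ltxx.
Qed.

Lemma hasumZ F s c : hasum F s -> hasum (fun i => c * F i) (c * s).
Proof.
move=> Fs e e0; have c0 : 0 < normc c + 1 by rewrite ltr_wpDl ?normc_ge0.
have [A hA] := Fs (e / (normc c + 1)) (divr_gt0 e0 c0); exists A => B /hA h.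
rewrite -mulr_sumr -mulrBr normcMl.
apply: (@le_lt_trans _ _ ((normc c + 1) * normc (\sum_(i <- B) F i - s))).
  by rewrite ler_wpM2r ?normc_ge0// lerDl.
by rewrite mulrC -ltr_pdivlMr.
Qed.

Lemma hasumD F G s t : hasum F s -> hasum G t -> hasum (fun i => F i + G i) (s + t).
Proof.
move=> Fs Gt e e0; have e2 : 0 < e / 2 by rewrite divr_gt0.
have [A hA] := Fs _ e2; have [B hB] := Gt _ e2; exists (A `|` B)%fset => C.
rewrite fsubUset => /andP[/hA h1 /hB h2].
rewrite big_split opprD addrACA; apply: le_lt_trans (normcD _ _) _.
by rewrite (splitr e) ltrD.
Qed.

Lemma sum_le_ge0 b M : sum_le b M -> 0 <= M.
Proof. by move=> [_ /(_ fset0)]; rewrite big_seq_fset0. Qed.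

Lemma sum_leZ b M c : 0 <= c -> sum_le b M -> sum_le (fun i => c * b i) (c * M).
Proof.
move=> c0 [b0 bM]; split => [i|A]; first by rewrite mulr_ge0.
by rewrite -mulr_sumr ler_wpM2l.
Qed.

Lemma le_sum_le b b' M : (forall i, 0 <= b' i <= b i) -> sum_le b M -> sum_le b' M.
Proof.
move=> bb [b0 bM]; split => [i|A]; first by have /andP[] := bb i.
by apply: le_trans (bM A); apply: ler_sum => i _; have /andP[] := bb i.
Qed.

Lemma sum_le_sup b M : sum_le b M -> exists s : R, forall e, 0 < e ->
  exists A0, forall A, (A0 `<=` A)%fset -> `|\sum_(i <- A) b i - s| < e.
Proof.
move=> [b0 bM]; pose E := [set \sum_(i <- A) b i | A in [set: {fset I}]].
have E0 : E !=set0 by exists (\sum_(i <- fset0) b i), fset0.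
have hE : has_sup E by split=> //; exists M => _ [A _ <-]; exact: bM.
exists (sup E) => e e0.
have [_ [A0 _ <-] hA0] := sup_adherent e0 hE.
exists A0 => A AA; rewrite ler0_norm; last first.
  by rewrite subr_le0; apply: ub_le_sup; [case: hE|exists A].
rewrite opprB ltrBlDr -ltrBlDl; apply: lt_le_trans hA0 _.
by rewrite (big_fset_subset b AA) lerDl sumr_ge0.
Qed.

Lemma sum_le_tail b M e : sum_le b M -> 0 < e ->
  exists A0, forall A, [disjoint A0 & A]%fset -> \sum_(i <- A) b i < e.
Proof.
move=> bM e0; have [s hs] := sum_le_sup bM.
have e2 : 0 < e / 2 by rewrite divr_gt0.
have [A0 hA] := hs _ e2; exists A0 => A dA.
have := hA _ (fsubsetUl A0 A); rewrite big_fset_disjointU//.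
have := hA _ (fsubset_refl A0); rewrite !ltr_norml => /andP[h1 h2] /andP[h3 h4].
lra.
Qed.

(** Both [u + b] and [b] are nonnegative with bounded sums. *)
Lemma real_dominated_hasum (u b : I -> R) M : sum_le b M -> (forall i, `|u i| <= b i) ->
  exists s : R, forall e, 0 < e ->
  exists A0, forall A, (A0 `<=` A)%fset -> `|\sum_(i <- A) u i - s| < e.
Proof.
move=> bM ub; have M0 := sum_le_ge0 bM.
have pM : sum_le (fun i => u i + b i) (2 * M).
  split => [i|A]; first by have := ub i; rewrite ler_norml => /andP[]; lra.
  rewrite big_split /= mulrDl mul1r lerD ?(bM.2)//; apply: le_trans (bM.2 A).
  by apply: ler_sum => i _; apply: le_trans (ub i); exact: ler_norm.
have [s hs] := sum_le_sup pM; have [t ht] := sum_le_sup bM.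
exists (s - t) => e e0; have e2 : 0 < e / 2 by rewrite divr_gt0.
have [A hA] := hs _ e2; have [B hB] := ht _ e2; exists (A `|` B)%fset => C.
rewrite fsubUset => /andP[/hA h1 /hB h2].
move: h1; rewrite big_split /=; move: h2; rewrite !ltr_norml => /andP[h1 h2] /andP[h3 h4].
by apply/andP; split; lra.
Qed.

Lemma dominated_hasum F b M : sum_le b M -> (forall i, normc (F i) <= b i) ->
  exists s, hasum F s.
Proof.
move=> bM Fb.
have [s hs] := real_dominated_hasum (u := fun i => complex.Re (F i)) bM
  (fun i => le_trans (normc_Re _) (Fb i)).
have [t ht] := real_dominated_hasum (u := fun i => complex.Im (F i)) bM
  (fun i => le_trans (normc_Im _) (Fb i)).
exists (s +i* t)%C => e e0; have e2 : 0 < e / 2 by rewrite divr_gt0.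
have [A hA] := hs _ e2; have [B hB] := ht _ e2; exists (A `|` B)%fset => C.
rewrite fsubUset => /andP[/hA h1 /hB h2].
apply: le_lt_trans (normc_le_ReIm _) _; rewrite (splitr e) !raddfB !raddf_sum.
by rewrite ltrD.
Qed.

Lemma hasum_norm_le F b M s : sum_le b M -> (forall i, normc (F i) <= b i) ->
  hasum F s -> normc s <= M.
Proof.
move=> bM Fb Fs; apply/ler_addgt0Pr => e e0; have [A hA] := Fs _ e0.
have := hA _ (fsubset_refl A); rewrite normcBC => h.
rewrite -(subrK (\sum_(i <- A) F i) s) addrC; apply: le_trans (normcD _ _) _.
rewrite lerD ?(ltW h)//; apply: le_trans (bM.2 A); apply: le_trans (normc_sum _ _ _) _.
exact: ler_sum.
Qed.

Lemma fset_sum_limit (G : nat -> I -> R[i]) F A :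
  (forall i e, 0 < e -> exists N, forall n, (N <= n)%N -> normc (G n i - F i) < e) ->
  forall e, 0 < e -> exists N, forall n, (N <= n)%N ->
  normc (\sum_(i <- A) G n i - \sum_(i <- A) F i) < e.
Proof.
move=> GF; elim: (A : seq I) => [|i s IH] e e0.
  by exists 0%N => n _; rewrite !big_nil subrr normc_0.
have e2 : 0 < e / 2 by rewrite divr_gt0.
have [N1 h1] := IH _ e2; have [N2 h2] := GF i _ e2; exists (maxn N1 N2) => n.
rewrite geq_max => /andP[/h1 {}h1 /h2 {}h2].
rewrite !big_cons opprD addrACA (splitr e).
by apply: le_lt_trans (normcD _ _) _; rewrite ltrD.
Qed.

(** Tannery's theorem: outside a finite set the sums are uniformly small. *)
Lemma hasum_limit (G : nat -> I -> R[i]) (t : nat -> R[i]) F b M s :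
  sum_le b M -> (forall n i, normc (G n i) <= b i) -> (forall i, normc (F i) <= b i) ->
  (forall i e, 0 < e -> exists N, forall n, (N <= n)%N -> normc (G n i - F i) < e) ->
  hasum F s -> (forall n, hasum (G n) (t n)) ->
  forall e, 0 < e -> exists N, forall n, (N <= n)%N -> normc (t n - s) < e.
Proof.
move=> bM Gb Fb GF Fs Gt e e0.
have e4 : 0 < e / 4 by rewrite divr_gt0.
have [A0 hA0] := sum_le_tail bM e4.
have tail (H : I -> R[i]) r : (forall i, normc (H i) <= b i) -> hasum H r ->
    normc (\sum_(i <- A0) H i - r) <= e / 4.
  move=> Hb Hr; apply/ler_addgt0Pr => x x0; have [A hA] := Hr _ x0.
  have := hA _ (fsubsetUr A0 A).
  rewrite (big_fset_subset H (fsubsetUl A0 A)) => h.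
  set T := \sum_(i <- ((A0 `|` A) `\` A0)%fset) H i in h.
  have hT : normc T <= e / 4.
    apply: le_trans (normc_sum _ _ _) _; apply: (@le_trans _ _ (\sum_(i <- ((A0 `|` A) `\` A0)%fset) b i)).
      exact: ler_sum.
    by apply/ltW/hA0; apply/fdisjointP => i; rewrite !inE => ->.
  rewrite (_ : _ - r = (\sum_(i <- A0) H i + T - r) - T); last by ring.
  by apply: le_trans (normcD _ _) _; rewrite normcNE addrC lerD// ltW.
have [N hN] := fset_sum_limit A0 GF e4; exists N => n /hN h.
have h1 := tail _ _ (Gb n) (Gt n); have h2 := tail _ _ Fb Fs.
rewrite (_ : t n - s = - (\sum_(i <- A0) G n i - t n) +
  ((\sum_(i <- A0) G n i - \sum_(i <- A0) F i) + (\sum_(i <- A0) F i - s))); last by ring.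
apply: le_lt_trans (normcD _ _) _; rewrite normcNE.
have := normcD (\sum_(i <- A0) G n i - \sum_(i <- A0) F i) (\sum_(i <- A0) F i - s).
lra.
Qed.

End hasum.

Lemma hasum_bij (I J : choiceType) (h : I -> J) (g : J -> I) (F : J -> R[i]) s :
  cancel h g -> cancel g h -> hasum F s -> hasum (fun i => F (h i)) s.
Proof.
move=> hg gh Fs e e0; have [A hA] := Fs _ e0; exists (g @` A)%fset => B AB.
have -> : \sum_(i <- B) F (h i) = \sum_(j <- (h @` B)%fset) F j.
  by rewrite big_imfset//= => x y _ _ /(can_inj hg).
apply: hA; apply/fsubsetP => j jA; apply/imfsetP; exists (g j) => //.
by apply: (fsubsetP AB); apply/imfsetP; exists j.
Qed.

Lemma sum_le_inj (I J : choiceType) (h : I -> J) (b : J -> R) M :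
  injective h -> sum_le b M -> sum_le (fun i => b (h i)) M.
Proof.
move=> hi [b0 bM]; split => // A.
have -> : \sum_(i <- A) b (h i) = \sum_(j <- (h @` A)%fset) b j.
  by rewrite big_imfset//= => x y _ _ /hi.
exact: bM.
Qed.

(** A partial sum of packets is the sum of [F] over a finite union of fibres,
    and an index of [A0] that such a union misses contributes zero. *)
Lemma hasum_fibres (I J : choiceType) (h : I -> J) (fib : J -> {fset I})
    (F : I -> R[i]) s :
  (forall i j, h i != j -> i \notin fib j) ->
  (forall i, F i != 0 -> i \in fib (h i)) ->
  hasum F s -> hasum (fun j => \sum_(i <- fib j) F i) s.
Proof.
move=> fibN fibP Fs e e0; have [A0 hA0] := Fs _ e0; exists (h @` A0)%fset => B AB.
pose C : {fset I} := [fset i in A0 | i \notin fib (h i)]%fset.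
pose U (B : {fset J}) : {fset I} := (\bigcup_(j <- B) fib j)%fset.
have inU D i : (i \in U D) = (h i \in D) && (i \in fib (h i)).
  apply/bigfcupP/andP => [[j /andP[jD _] ij]|[hD ih]].
    have hj : h i = j by apply/eqP; apply: contraLR ij; exact: fibN.
    by rewrite hj.
  by exists (h i); rewrite ?hD.
have sumU : forall k D, #|` D| = k -> \sum_(j <- D) \sum_(i <- fib j) F i = \sum_(i <- U D) F i.
  elim=> [|k IH] D.
    by move/eqP; rewrite cardfs_eq0 => /eqP ->; rewrite /U big_seq_fset0 big_nil big_seq_fset0.
  move=> Dk; have [j jD] : exists j, j \in D.
    by apply/fset0Pn; rewrite -cardfs_gt0 Dk.
  rewrite (big_fsetD1 j jD) /= IH; last by move: Dk; rewrite (cardfsD1 j) jD => -[].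
  rewrite -big_fset_disjointU.
    apply: eq_fbigl => i; rewrite in_fsetU !inU !inE.
    have [hj|ij] := eqVneq (h i) j; first by rewrite hj jD ?eqxx /= orbF.
    by rewrite (negbTE (fibN _ _ ij)).
  apply/fdisjointP => i ij; rewrite inU !inE.
  by have [->|/fibN] := eqVneq (h i) j; rewrite // ij.
rewrite (sumU _ _ erefl).
have -> : \sum_(i <- U B) F i = \sum_(i <- (U B `|` C)%fset) F i.
  apply: big_fset_incl; first exact: fsubsetUl.
  move=> i; rewrite in_fsetU => /orP[->//|]; rewrite !inE /= => /andP[_ iN] _.
  by apply/eqP; apply: contraNT iN; exact: fibP.
apply: hA0; apply/fsubsetP => i iA; rewrite in_fsetU inU !inE /= iA /=.
by case: (boolP (i \in fib (h i))) => _; rewrite ?orbT ?andbT// (fsubsetP AB)// in_imfset.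
Qed.

End unordered_sums.

(** Sums over different subsets keep the same index type when the summand is
    cut off outside the subset. *)
Definition onset {R : realType} {T : choiceType} (A : set T) (F : T -> R[i]) (x : T) : R[i] :=
  if x \in A then F x else 0.

Lemma onset_in {R : realType} {T : choiceType} (A : set T) (F : T -> R[i]) x :
  A x -> onset A F x = F x.
Proof. by move=> Ax; rewrite /onset mem_set. Qed.

Lemma onset_out {R : realType} {T : choiceType} (A : set T) (F : T -> R[i]) x :
  ~ A x -> onset A F x = 0.
Proof. by move=> Ax; rewrite /onset memNset. Qed.

(** * The integer lattice and its tiling by cubes *)

Section integer_lattice.
Context {R : realType} {d : nat}.
Local Notation lam := (lebesgue_rV R d).
Implicit Types (x y n : 'rV[R]_d) (A : {fset 'rV[R]_d}).

Definition Zd : set 'rV[R]_d := [set x | forall i, x 0 i \is a Num.int].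

Lemma Zd0 : Zd 0. Proof. by move=> i; rewrite mxE. Qed.

Lemma ZdN x : Zd x -> Zd (- x).
Proof. by move=> h i; rewrite mxE rpredN. Qed.

Lemma ZdD x y : Zd x -> Zd y -> Zd (x + y).
Proof. by move=> hx hy i; rewrite mxE rpredD. Qed.

Lemma dotp_int x y : Zd x -> Zd y -> dotp x y \is a Num.int.
Proof. by move=> hx hy; apply: rpred_sum => i _; rewrite rpredM. Qed.

Definition hcube : set 'rV[R]_d := box d `[- 2^-1, 2^-1[.

Lemma measurable_hcube : measurable hcube.
Proof. exact: measurable_box. Qed.

Lemma lebesgue_hcube : lam hcube = 1%E.
Proof.
rewrite (@lebesgue_box _ d _ 1) ?expr1n//.
rewrite lebesgue_measure_itv /= lte_fin ifT -?EFinB; last by lra.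
by congr EFin; lra.
Qed.

Lemma hcube_norm x : hcube x -> enorm x <= d%:R.
Proof.
move=> h; apply: le_trans (enorm_le_sum _) _.
rewrite -[d in leRHS]card_ord -sumr_const; apply: ler_sum => i _.
have := h i; rewrite /= in_itv /= => /andP[h1 h2].
by rewrite ler_norml; apply/andP; split; lra.
Qed.

Lemma indic_le1 (T : Type) (A : set T) (t : T) : \1_A t <= 1 :> R.
Proof. by rewrite indicE; case: (t \in A). Qed.

(** Rounding half up, to match the half-open cubes. *)
Definition nearest x : 'rV[R]_d := \row_i (Num.floor (x 0 i + 2^-1))%:~R.

Lemma Zd_nearest x : Zd (nearest x).
Proof. by move=> i; rewrite mxE intr_int. Qed.

Lemma nearestE x n : Zd n -> hcube (x - n) <-> n = nearest x.
Proof.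
move=> Zn; split=> [h|->].
  apply/rowP => i; rewrite mxE.
  have /intrP[m nm] := Zn i; rewrite nm; congr intmul.
  have := h i; rewrite /= in_itv /= !mxE nm => /andP[h1 h2].
  apply/esym/floor_def; rewrite intrD; apply/andP; split; lra.
move=> i; rewrite /= in_itv /= !mxE.
have := floor_itv (x 0 i + 2^-1); rewrite intrD => /andP[h1 h2].
by apply/andP; split; lra.
Qed.

Lemma indic_hcube x n : Zd n -> \1_hcube (x - n) = (n == nearest x)%:R :> R.
Proof.
move=> Zn; rewrite indicE; congr ((nat_of_bool _)%:R); apply/idP/eqP => [/set_mem|h].
  by rewrite nearestE.
by apply/mem_set; rewrite nearestE.
Qed.

Lemma measurable_indic_hcube n : measurable_fun setT (fun x => \1_hcube (x - n) : R).
Proof.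
apply: (measurableT_comp (measurable_indic measurable_hcube)).
exact: measurable_rVB.
Qed.

Lemma rintegrable_indic_hcube : rintegrable lam (\1_hcube).
Proof. exact: (Rintegral_indicator measurable_hcube lebesgue_hcube).1. Qed.

Lemma Rintegral_indic_hcube : Rintegral lam setT \1_hcube = 1.
Proof. exact: (Rintegral_indicator measurable_hcube lebesgue_hcube).2. Qed.

(** Bound for the variation of [weight] over a unit cube. *)
Definition cubeK : R := (2 * (1 + d%:R ^+ 2)) ^+ d.

Lemma cubeK_gt0 : 0 < cubeK.
Proof. by rewrite exprn_gt0// mulr_gt0// ltr_pwDl// sqr_ge0. Qed.

Lemma weight_hcube x n : hcube (x - n) -> weight x <= cubeK * weight n.
Proof. by move=> h; apply: weight_near; rewrite enormBC; exact: hcube_norm. Qed.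

Lemma weight_hcubeC x n : hcube (x - n) -> weight n <= cubeK * weight x.
Proof. by move=> h; apply: weight_near; exact: hcube_norm. Qed.

Lemma sum_indic_hcube_le1 A x :
  \sum_(n <- A) (\1_Zd n * \1_hcube (x - n)) <= 1 :> R.
Proof.
have E n : \1_Zd n * \1_hcube (x - n) = (n == nearest x)%:R :> R.
  rewrite [\1_Zd n]indicE; case: (boolP (n \in Zd)) => [/set_mem Zn|nZ].
    by rewrite mul1r indic_hcube.
  rewrite mul0r; case: eqP => // e; move: nZ; rewrite e => /negP; case.
  by apply/mem_set; exact: Zd_nearest.
under eq_bigr do rewrite E.
have [xA|xA] := boolP (nearest x \in A).
  rewrite (big_fsetD1 _ xA) /= eqxx big1_fset ?addr0// => n.
  by rewrite !inE => /andP[/negbTE ->].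
by rewrite big1_fset// => n nA _; case: eqP nA xA => // -> ->.
Qed.

(** The cubes around distinct integer points do not overlap, so the sum of the
    weight over integer points is controlled by its integral. *)
Lemma sum_le_weight_Zd : sum_le (weight \_ Zd) (cubeK * weight_mass d : R).
Proof.
split=> [i|A]; first by rewrite patchE; case: ifP => // _; exact: weight_ge0.
pose F n x : R := weight x * (\1_Zd n * \1_hcube (x - n)).
have mF n : measurable_fun setT (F n).
  apply: measurable_funM; first exact: measurable_weight.
  by apply: measurable_funM => //; exact: measurable_indic_hcube.
have F0 n x : 0 <= F n x.
  by rewrite !mulr_ge0 ?weight_ge0.
have Fle n x : F n x <= weight x.
  by rewrite ler_piMr ?weight_ge0// mulr_ile1 ?indic_le1.
have iF n : rintegrable lam (F n).
  apply: rintegrable_dom (mF n) _ (rintegrable_weight d) => x.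
  by rewrite ger0_norm.
have lower n : (weight \_ Zd) n <= cubeK * Rintegral lam setT (F n).
  rewrite patchE; case: ifPn => [/set_mem Zn|_]; last first.
    apply: mulr_ge0; first exact/ltW/cubeK_gt0.
    by apply: Rintegral_ge0 => x _; exact: F0.
  have iT : rintegrable lam (fun x => \1_hcube (x - n)).
    exact: (rintegrable_translate (u := \1_hcube) (- n) rintegrable_indic_hcube).
  rewrite -[leLHS]mulr1 -Rintegral_indic_hcube.
  rewrite -(Rintegral_translate (- n) rintegrable_indic_hcube).
  rewrite -!RintegralZl//; last exact: iF.
  apply: le_Rintegral => //; [exact: (rintegrableZ _ iT)|exact: (rintegrableZ _ (iF n))|].
  move=> x _; rewrite /F [\1_Zd n]indicE mem_set// mul1r.
  rewrite indicE; case: (boolP (_ \in hcube)) => [/set_mem h|_]; last by rewrite !mulr0.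
  by rewrite !mulr1; exact: weight_hcubeC.
apply: (@le_trans _ _ (\sum_(n <- A) cubeK * Rintegral lam setT (F n))).
  by apply: ler_sum => n _; exact: lower.
rewrite -mulr_sumr ler_wpM2l ?(ltW cubeK_gt0)//.
have [sE iS] := Rintegral_sum A iF.
rewrite sE; apply: le_Rintegral => //; [exact: rintegrable_weight|].
move=> x _; rewrite -mulr_sumr -[leRHS]mulr1 ler_wpM2l ?weight_ge0//.
exact: sum_indic_hcube_le1.
Qed.

(** Each cube contributes at most [b n] times the mass of [phi] on it. *)
Lemma integral_le_sum (phi b F : 'rV[R]_d -> R) M :
  sum_le (b \_ Zd) M -> measurable_fun setT phi -> (forall x, 0 <= phi x) ->
  (forall n, Zd n -> (\int[lam]_x (\1_hcube (x - n) * phi x)%:E = 1)%E) ->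
  measurable_fun setT F -> (forall x, 0 <= F x <= b (nearest x) * phi x) ->
  (\int[lam]_x (F x)%:E <= M%:E)%E.
Proof.
move=> [b0 bM] mphi phi0 cube1 mF Fb.
pose pt k : option 'rV[R]_d := omap (map_mx intr) (pickle_inv k : option 'rV[int]_d).
pose f k x : R := if pt k is Some n then b n * (\1_hcube (x - n) * phi x) else 0.
have ptZ k n : pt k = Some n -> Zd n.
  rewrite /pt; case: pickle_inv => //= z [<-] i; by rewrite mxE intr_int.
have b0' n : Zd n -> 0 <= b n.
  by move=> Zn; have := b0 n; rewrite patchE ifT//; exact/mem_set.
have f0 k x : 0 <= f k x.
  rewrite /f; case E : (pt k) => [n|//].
  by rewrite mulr_ge0 ?(b0' _ (ptZ _ _ E))// mulr_ge0.
have mh n : measurable_fun setT (fun x => \1_hcube (x - n) * phi x).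
  by apply: measurable_funM => //; exact: measurable_indic_hcube.
have mf k : measurable_fun setT (f k).
  by rewrite /f; case: (pt k) => [n|//]; exact: measurable_funM.
apply: (@le_trans _ _ (\int[lam]_x (\sum_(0 <= k <oo) (f k x)%:E)))%E.
  apply: ge0_le_integral => //.
  - by move=> x _; rewrite lee_fin; have /andP[] := Fb x.
  - exact/measurable_EFinP.
  - apply: ge0_emeasurable_sum => //.
      by move=> k x _ _; rewrite lee_fin.
    by move=> k _; exact/measurable_EFinP.
  move=> x _; have Zx := Zd_nearest x.
  pose z : 'rV[int]_d := \row_i Num.floor (x 0 i + 2^-1).
  have E : pt (choice.pickle z) = Some (nearest x).
    rewrite /pt pickleK_inv /=; congr Some; apply/rowP => i; by rewrite !mxE.
  apply: (@le_trans _ _ (f (choice.pickle z) x)%:E).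
    rewrite lee_fin /f E (indic_hcube x (Zd_nearest x)) eqxx mul1r.
    by have /andP[] := Fb x.
  rewrite (nneseriesD1 (n := choice.pickle z))//; last by move=> k _; rewrite lee_fin.
  by rewrite leeDl// nneseries_ge0// => k _ _; rewrite lee_fin.
rewrite integral_nneseries//; last 2 first.
- by move=> k; exact/measurable_EFinP.
- by move=> k x _; rewrite lee_fin.
have fE k : (\int[lam]_x (f k x)%:E = (if pt k is Some n then b n else 0)%:E)%E.
  rewrite /f; case E : (pt k) => [n|]; last by rewrite integral0.
  under eq_integral do rewrite EFinM.
  rewrite ge0_integralZl//; last 3 first.
  - exact/measurable_EFinP.
  - by move=> x _; rewrite lee_fin mulr_ge0.
  - by rewrite lee_fin (b0' _ (ptZ _ _ E)).
  by rewrite cube1 ?mule1//; exact: ptZ E.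
under eq_eseriesr do rewrite fE.
apply: lime_le.
  by apply: is_cvg_nneseries => k _ _; rewrite lee_fin; case E : (pt k) => [n|//]; rewrite (b0' _ (ptZ _ _ E)).
apply: nearW => K; rewrite sumEFin lee_fin.
have ptI k l n : pt k = Some n -> pt l = Some n -> k = l.
  rewrite /pt; have := @pickle_invK 'rV[int]_d k; have := @pickle_invK 'rV[int]_d l.
  case: (pickle_inv k) => //= z; case: (pickle_inv l) => //= w <- <- [<-] [wz].
  congr choice.pickle; apply/rowP => i; have := congr1 (fun u : 'rV[R]_d => u 0 i) wz.
  by rewrite !mxE => /intr_inj ->.
suff [A [AK ->]] : exists A : {fset 'rV[R]_d},
    (forall n, n \in A -> exists2 k, (k < K)%N & pt k = Some n) /\
    \sum_(0 <= k < K) (if pt k is Some n then b n else 0) = \sum_(n <- A) (b \_ Zd) n.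
  exact: bM.
elim: K => [|K [A [AK IH]]].
  by exists fset0; split => //; rewrite big_nil big_seq_fset0.
rewrite big_nat_recr//= IH; case E : (pt K) => [n|]; last first.
  exists A; split=> [n /AK[k kK kn]|]; last by rewrite addr0.
  by exists k => //; exact: ltnW.
have nA : n \notin A.
  by apply/negP => /AK[k kK /ptI/(_ E) kE]; rewrite kE ltnn in kK.
exists (n |` A)%fset; split => [m|].
  rewrite in_fset1U => /orP[/eqP ->|/AK[k kK km]]; first by exists K.
  by exists k => //; exact: ltnW.
by rewrite big_fsetU1//= addrC patchE ifT//; apply/mem_set; exact: ptZ E.
Qed.

End integer_lattice.

Arguments cubeK : clear implicits.

(** * Characters of the torus and trigonometric polynomials *)

Section characters.
Context {R : realType} {d : nat}.
Local Notation lam := (lebesgue_rV R d).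
Implicit Types (x y n k : 'rV[R]_d).

Definition char k x : R[i] := expi (2 * pi * dotp k x).

Lemma charD k x y : char k (x + y) = char k x * char k y.
Proof. by rewrite /char dotpDr mulrDr expiD. Qed.

Lemma charDl k n x : char (k + n) x = char k x * char n x.
Proof. by rewrite /char dotpDl mulrDr expiD. Qed.

Lemma char0l x : char 0 x = 1.
Proof. by rewrite /char dotp0l mulr0 expi0. Qed.

Lemma char0r k : char k 0 = 1.
Proof. by rewrite /char dotp0r mulr0 expi0. Qed.

Lemma normc_char k x : normc (char k x) = 1.
Proof. exact: normc_expi. Qed.

Lemma cmeasurable_char k : cmeasurable (char k).
Proof.
apply: cmeasurable_expi; apply: measurable_funM => //.
rewrite (_ : dotp k = fun x => dotp x k); first exact: measurable_dotp.
by apply/funext => x; exact: dotpC.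
Qed.

Lemma expi_2pi_nat (m : nat) : expi (2 * pi * m%:R) = 1 :> R[i].
Proof.
elim: m => [|m IH]; first by rewrite mulr0 expi0.
rewrite -[m.+1%:R]natr1 mulrDr expiD IH mul1r mulr1 mulr_natl.
by rewrite /expi cos2pi sin2pi.
Qed.

Lemma expi_2pi_int (a : R) : a \is a Num.int -> expi (2 * pi * a) = 1 :> R[i].
Proof.
move=> /intrP[[m|m] ->]; first exact: expi_2pi_nat.
have := expi_2pi_nat m.+1; rewrite NegzE mulrNz mulrN => h.
by rewrite -[LHS]mulr1 -{1}h -expiD addNr expi0.
Qed.

Lemma char_int k n : Zd k -> Zd n -> char k n = 1.
Proof. by move=> Zk Zn; apply/expi_2pi_int/dotp_int. Qed.

Lemma expi_pi : expi (pi : R) = -1.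
Proof. by rewrite /expi cospi sinpi; apply/eqP; rewrite eq_complex /= oppr0 !eqxx. Qed.

Lemma expi_Npi : expi (- pi : R) = -1.
Proof. by rewrite -expi_pi /expi cosN sinN sinpi oppr0. Qed.

Lemma cintegrable_cut (f : 'rV[R]_d -> R[i]) (chi : 'rV[R]_d -> R) a M :
  cmeasurable f -> (forall x, normc (f x) <= M) ->
  rintegrable lam (fun x => \1_hcube (x - a)) -> measurable_fun setT chi ->
  (forall x, 0 <= chi x <= \1_hcube (x - a)) ->
  cintegrable lam (fun x => (chi x)%:C%C * f x).
Proof.
move=> mf fM ih mchi chih.
apply: (cintegrable_dom (u := fun x => M * \1_hcube (x - a))).
- by apply: cmeasurableM => //; exact: cmeasurable_real.
- move=> x; have /andP[c0 c1] := chih x.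
  by rewrite normcMl normc_real ger0_norm// mulrC ler_pM ?normc_ge0.
- exact: rintegrableZ.
Qed.

Lemma rintegrable_hcube a : rintegrable lam (fun x => \1_hcube (x - a)).
Proof. exact: (rintegrable_translate (u := \1_hcube) (- a) rintegrable_indic_hcube). Qed.

(** A half-open interval moved by [t] loses a piece of length [t] at one end
    and gains a piece at the other end, one period away. *)
Lemma slide_half_open (s t : R) : 0 < t -> t <= 2^-1 ->
  (- 2^-1 <= s - t < 2^-1)%R%:R + (- 2^-1 <= s < - 2^-1 + t)%R%:R =
  (- 2^-1 <= s < 2^-1)%R%:R + (- 2^-1 <= s - 1 < - 2^-1 + t)%R%:R :> R.
Proof.
move=> t0 t2.
have [h1|h1] := leP (- 2^-1) (s - t); have [h4|h4] := ltP s (- 2^-1 + t);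
  (try by exfalso; lra);
have [h3|h3] := leP (- 2^-1) s; (try by exfalso; lra);
have [h2|h2] := ltP (s - t) (2^-1); (try by exfalso; lra);
have [h5|h5] := ltP s (2^-1); (try by exfalso; lra);
have [h6|h6] := leP (- 2^-1) (s - 1); (try by exfalso; lra);
have [h7|h7] := ltP (s - 1) (- 2^-1 + t); (try by exfalso; lra);
by rewrite /= ?addr0 ?add0r.
Qed.

(** Sliding the cube by half a period of the character in one coordinate both
    changes the sign of the integral and, by periodicity, leaves it unchanged. *)
Lemma cintegral_char k : Zd k ->
  cintegral lam (fun x => (\1_hcube x)%:C%C * char k x) = (k == 0)%:R.
Proof.
move=> Zk; have [->|k0] := eqVneq k 0.
  under eq_cintegral do rewrite char0l mulr1.
  apply/eqP; rewrite eq_complex /= Rintegral_indic_hcube eqxx /=.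
  by rewrite Rintegral_cst// mul0r.
have [j kj] : exists j, k 0 j != 0.
  apply/existsP; rewrite -negb_forall; apply: contra k0 => /forallP h.
  by apply/eqP/rowP => j; rewrite mxE; exact/eqP.
pose e : 'rV[R]_d := delta_mx 0 j.
have dke : dotp k e = k 0 j := dotp_delta k j.
have kj1 : 1 <= `|k 0 j| by rewrite norm_intr_ge1.
have kjp : 0 < `|k 0 j| by rewrite (lt_le_trans ltr01).
pose t : R := (2 * `|k 0 j|)^-1.
have t0 : 0 < t by rewrite invr_gt0 mulr_gt0.
have t2 : t <= 2^-1.
  by rewrite lef_pV2 ?posrE ?mulr_gt0// ler_peMr.
have chart : char k (t *: e) = -1.
  rewrite /char dotpZr dke /t.
  have [kjge|kjlt] := leP 0 (k 0 j).
    rewrite ger0_norm// (_ : _ * _ = pi) ?expi_pi//.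
    by rewrite ger0_norm// in kjp; field; rewrite lt0r_neq0.
  rewrite ltr0_norm// (_ : _ * _ = - pi) ?expi_Npi//.
  by rewrite ltr0_norm// in kjp; field; rewrite lt_eqF.
have Ze : Zd e by move=> i; rewrite mxE natr_int.
pose P : set 'rV[R]_d := hcube `&` [set x | x 0 j < - 2^-1 + t].
have mP : measurable P.
  apply: measurableI; first exact: measurable_hcube.
  rewrite [X in measurable X](_ : _ = (fun x : 'rV[R]_d => x 0 j) @^-1` `]-oo, - 2^-1 + t[).
    by rewrite -[X in measurable X]setTI; exact: measurable_rV_coord.
  by apply/seteqP; split => x; rewrite /= in_itv.
have split x : \1_hcube (x - t *: e) + \1_P x = \1_hcube x + \1_P (x - e) :> R.
  pose A : set 'rV[R]_d := [set x | forall i, i != j -> - 2^-1 <= x 0 i < 2^-1].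
  have hA (y : 'rV[R]_d) : hcube y <-> A y /\ - 2^-1 <= y 0 j < 2^-1.
    split=> [h|[Ay yj] i].
      split=> [i _|]; [have := h i|have := h j]; by rewrite /= in_itv.
    by rewrite /= in_itv /=; have [->//|/Ay] := eqVneq i j.
  have At a : A (x - a *: e) <-> A x.
    by split=> h i ij; have := h i ij; rewrite !mxE (negbTE ij) /= mulr0 subr0.
  have A1 : A (x - e) <-> A x by rewrite -(scale1r e).
  rewrite !indicE.
  have inE' (B : set 'rV[R]_d) (b : bool) y : (B y <-> b) -> (y \in B) = b.
    by move=> Bb; apply/idP/idP => [/set_mem/Bb//|/Bb]; exact: mem_set.
  have [Ax|Ax] := pselect (A x).
    rewrite (inE' hcube (- 2^-1 <= x 0 j - t < 2^-1) (x - t *: e)); last first.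
      rewrite hA At !mxE eqxx /= eqxx mulr1; by split => [[]|].
    rewrite (inE' P (- 2^-1 <= x 0 j < - 2^-1 + t) x); last first.
      rewrite /P /= hA; split=> [[[_ /andP[-> _]] ->]//|/andP[a b]].
      by rewrite a b /=; split => //; split => //; apply: lt_le_trans b _; lra.
    rewrite (inE' hcube (- 2^-1 <= x 0 j < 2^-1) x); last by rewrite hA; split => [[]|].
    rewrite (inE' P (- 2^-1 <= x 0 j - 1 < - 2^-1 + t) (x - e)); last first.
      rewrite /P /= hA A1 !mxE eqxx /= eqxx; split=> [[[_ /andP[-> _]] ->]//|/andP[a b]].
      by rewrite a b /=; split => //; split => //; apply: lt_le_trans b _; lra.
    exact: slide_half_open.
  rewrite (inE' hcube false); last by rewrite hA At; split => // -[].
  rewrite (inE' hcube false x); last by rewrite hA; split => // -[].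
  rewrite (inE' P false x); last by rewrite /P /= hA; split => // -[[]].
  by rewrite (inE' P false); last by rewrite /P /= hA A1; split => // -[[]].
have mchar := cmeasurable_char k.
have char1 x : normc (char k x) <= 1 by rewrite normc_char.
have ind a (B : set 'rV[R]_d) : measurable B -> B `<=` hcube ->
    cintegrable lam (fun x => (\1_B (x - a))%:C%C * char k x).
  move=> mB Bh; apply: (@cintegrable_cut _ _ a 1) => //; first exact: rintegrable_hcube.
    apply: (measurableT_comp (measurable_indic mB)); exact: measurable_rVB.
  move=> x; rewrite !indicE ler0n ler_nat /=.
  by case: (boolP (x - a \in B)) => [/set_mem/Bh/mem_set ->|].
have shift a (B : set 'rV[R]_d) : measurable B -> B `<=` hcube ->
    cintegral lam (fun x => (\1_B (x - a))%:C%C * char k x) =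
    char k a * cintegral lam (fun x => (\1_B x)%:C%C * char k x).
  move=> mB Bh; rewrite -(cintegral_translate a (ind a B mB Bh)).
  rewrite -cintegralZ.
    by apply: eq_cintegral => x; rewrite addrK charD; ring.
  by have := ind 0 B mB Bh; under eq_fun do rewrite subr0.
set c := cintegral lam _.
have hh : hcube `<=` (hcube : set 'rV[R]_d) by [].
have Ph : P `<=` hcube by move=> x [].
have := ind 0 _ mP Ph; under eq_fun do rewrite subr0. move=> iP.
have := ind 0 _ measurable_hcube hh; under eq_fun do rewrite subr0. move=> ih.
have eqI : - c + cintegral lam (fun x => (\1_P x)%:C%C * char k x) =
           c + cintegral lam (fun x => (\1_P x)%:C%C * char k x).
  rewrite -mulN1r -chart -shift//; last exact: measurable_hcube.
  rewrite -[X in _ = _ + X]mul1r -(char_int Zk Ze) -shift// -!cintegralD//.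
  - apply: eq_cintegral => x; rewrite -!mulrDl; congr (_ * _).
    by have := congr1 (fun r : R => r%:C%C) (split x); rewrite !rmorphD.
  - exact: ind.
  - by apply: ind => //; exact: measurable_hcube.
move: eqI => /addIr/eqP; rewrite -subr_eq0 -opprD oppr_eq0 -mulr2n mulrn_eq0 /=.
by move/eqP.
Qed.

End characters.

Section trigonometric_polynomials.
Context {R : realType} {d : nat}.
Local Notation lam := (lebesgue_rV R d).
Implicit Types (x y n k : 'rV[R]_d) (f g : 'rV[R]_d -> R[i]).

Definition trigpoly f := exists (J : finType) (a : J -> R[i]) (k : J -> 'rV[R]_d),
  (forall j, Zd (k j)) /\ forall x, f x = \sum_j a j * char (k j) x.

Lemma trigpoly_char k c : Zd k -> trigpoly (fun x => c * char k x).
Proof.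
move=> Zk; exists unit, (fun=> c), (fun=> k); split => // x.
by rewrite (big_pred1 tt)// => -[].
Qed.

Lemma trigpolyD f g : trigpoly f -> trigpoly g -> trigpoly (fun x => f x + g x).
Proof.
move=> [J [a [k [Zk fE]]]] [L [b [l [Zl gE]]]].
exists (J + L)%type, (fun i => match i with inl j => a j | inr j => b j end),
  (fun i => match i with inl j => k j | inr j => l j end); split=> [[]//|x].
by rewrite big_sumType fE gE.
Qed.

Lemma trigpolyM f g : trigpoly f -> trigpoly g -> trigpoly (fun x => f x * g x).
Proof.
move=> [J [a [k [Zk fE]]]] [L [b [l [Zl gE]]]].
exists (J * L)%type, (fun p => a p.1 * b p.2), (fun p => k p.1 + l p.2).
split=> [p|x]; first exact: ZdD.
rewrite fE gE big_distrlr /= pair_bigA; apply: eq_bigr => p _ /=.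
by rewrite charDl; ring.
Qed.

Lemma trigpoly_cst c : trigpoly (fun=> c).
Proof.
have := trigpoly_char c Zd0; congr trigpoly; apply/funext => x.
by rewrite char0l mulr1.
Qed.

Lemma trigpoly_prod (I : Type) (s : seq I) (F : I -> 'rV[R]_d -> R[i]) :
  (forall i, trigpoly (F i)) -> trigpoly (fun x => \prod_(i <- s) F i x).
Proof.
move=> tF; elim: s => [|i s IH].
  by under eq_fun do rewrite big_nil; exact: trigpoly_cst.
by under eq_fun do rewrite big_cons; exact: trigpolyM.
Qed.

Lemma trigpolyX f N : trigpoly f -> trigpoly (fun x => f x ^+ N).
Proof.
move=> tf; elim: N => [|N IH].
  by under eq_fun do rewrite expr0; exact: trigpoly_cst.
by under eq_fun do rewrite exprS; exact: trigpolyM.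
Qed.

Lemma trigpoly_cos2 (i : 'I_d) :
  trigpoly (fun x => (cos (pi * x 0 i) ^+ 2)%:C%C).
Proof.
have Ze : Zd (delta_mx 0 i : 'rV[R]_d) by move=> j; rewrite mxE natr_int.
have dx x : dotp (delta_mx 0 i) x = x 0 i by rewrite dotpC dotp_delta.
have := trigpolyD (trigpoly_cst (2^-1)%:C%C)
  (trigpolyD (trigpoly_char (4^-1)%:C%C Ze) (trigpoly_char (4^-1)%:C%C (ZdN Ze))).
congr trigpoly; apply/funext => x; rewrite /char dotpNl dx mulrN /expi cosN sinN.
have -> : 2 * pi * x 0 i = pi * x 0 i + pi * x 0 i by ring.
rewrite cosD sinD; have := cos2Dsin2 (pi * x 0 i).
move: (cos _) (sin _) => c s cs; apply/eqP; rewrite eq_complex /=.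
apply/andP; split; apply/eqP; rewrite !mul0r ?subr0 ?add0r ?addr0; last by ring.
by rewrite -!expr2; move: cs; rewrite !expr2 => cs; lra.
Qed.

Section consequences.
Variable f : 'rV[R]_d -> R[i].
Hypothesis tf : trigpoly f.

Lemma cmeasurable_trigpoly : cmeasurable f.
Proof.
have [J [a [k [_ fE]]]] := tf; rewrite (_ : f = fun x => \sum_j a j * char (k j) x).
  apply: cmeasurable_sum => j; apply: cmeasurableM; first exact: cmeasurable_cst.
  exact: cmeasurable_char.
exact/funext.
Qed.

Lemma trigpoly_bounded : exists M, forall x, normc (f x) <= M.
Proof.
have [J [a [k [_ fE]]]] := tf; exists (\sum_j normc (a j)) => x; rewrite fE.
apply: le_trans (normc_sum _ _ _) _; apply: ler_sum => j _.
by rewrite normcMl normc_char mulr1.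
Qed.

Lemma trigpoly_periodic x n : Zd n -> f (x + n) = f x.
Proof.
have [J [a [k [Zk fE]]]] := tf => Zn; rewrite !fE; apply: eq_bigr => j _.
by rewrite charD (char_int (Zk j) Zn) mulr1.
Qed.

End consequences.

End trigonometric_polynomials.

(** * A positive trigonometric approximate identity *)

Section approximate_identity.
Context {R : realType} {d : nat}.
Local Notation lam := (lebesgue_rV R d).
Implicit Types (x y n k : 'rV[R]_d).

(** Equal to one at the integer points and smaller elsewhere. *)
Definition bump x : R := \prod_(i < d) cos (pi * x 0 i) ^+ 2.

Lemma bump_ge0 x : 0 <= bump x.
Proof. by apply: prodr_ge0 => i _; exact: sqr_ge0. Qed.

Lemma cos2_le1 (t : R) : cos t ^+ 2 <= 1.
Proof. by rewrite -(cos2Dsin2 t) lerDl sqr_ge0. Qed.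

Lemma prod_le1 (I : Type) (s : seq I) (P : pred I) (F : I -> R) :
  (forall i, 0 <= F i <= 1) -> \prod_(i <- s | P i) F i <= 1.
Proof.
move=> F01; suff /andP[//] : 0 <= \prod_(i <- s | P i) F i <= 1.
elim/big_ind : _ => [|x y /andP[x0 x1] /andP[y0 y1]|//]; first by rewrite ler01 lexx.
by rewrite mulr_ge0//= mulr_ile1.
Qed.

Lemma bump_le_coord x i : bump x <= cos (pi * x 0 i) ^+ 2.
Proof.
rewrite /bump (bigD1 i)//= ler_piMr ?sqr_ge0//.
by apply: prod_le1 => j; rewrite sqr_ge0 cos2_le1.
Qed.

Lemma bump_le1 x : bump x <= 1.
Proof. by apply: prod_le1 => j; rewrite sqr_ge0 cos2_le1. Qed.

Lemma trigpoly_bump N : trigpoly (fun x => (bump x ^+ N)%:C%C).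
Proof.
under eq_fun do rewrite rmorphXn /= rmorph_prod.
by apply: trigpolyX; apply: trigpoly_prod => i; exact: trigpoly_cos2.
Qed.

Lemma measurable_bump N : measurable_fun setT (fun x => bump x ^+ N).
Proof. exact: (cmeasurable_trigpoly (trigpoly_bump N)).1. Qed.

Lemma bernoulli_le (a : R) (m : nat) : 0 <= a <= 1 -> 1 - m%:R * a <= (1 - a) ^+ m.
Proof.
move=> /andP[a0 a1]; elim: m => [|m IH]; first by rewrite mul0r subr0 expr0.
rewrite exprS; apply: (@le_trans _ _ ((1 - a) * (1 - m%:R * a))); last first.
  by rewrite ler_wpM2l// subr_ge0.
rewrite -[m.+1%:R]natr1; have : 0 <= m%:R * a * a by rewrite !mulr_ge0.
nra.
Qed.

(** In the cube, a point that is not close to the origin has a coordinate that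
    is bounded away from zero, and [bump] is at most the factor of this
    coordinate. The second bound is continuity at the origin. *)
Lemma bump_gap (delta : R) : 0 < delta -> exists rho r : R,
  [/\ 0 <= rho < 1, 0 < r, r <= 2^-1,
      forall x, hcube x -> delta <= enorm x -> bump x <= rho &
      forall x, box d `[- r, r] x -> (1 + rho) / 2 <= bump x].
Proof.
move=> delta0; pose eta := Num.min (delta / d.+1%:R) 2^-1.
have eta0 : 0 < eta by rewrite lt_min divr_gt0//= invr_gt0.
have eta2 : eta <= 2^-1 by rewrite ge_min lexx orbT.
have pi0 := pi_gt0 R.
pose rho := cos (pi * eta) ^+ 2.
have rho1 : rho < 1.
  rewrite /rho -(cos2Dsin2 (pi * eta)) ltrDl exprn_gt0// sin_gt0_pi//.
  have h1 : 0 < pi * eta by rewrite mulr_gt0.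
  have h2 : pi * eta <= pi * 2^-1 by rewrite ler_pM2l.
  by apply/andP; split; lra.
have rho0 : 0 <= rho by exact: sqr_ge0.
have den0 : 0 < 4 * d.+1%:R * pi :> R by rewrite mulr_gt0 ?mulr_gt0 ?ltr0n.
pose r := Num.min ((1 - rho) / (4 * d.+1%:R * pi)) (4^-1).
have r0 : 0 < r by rewrite lt_min divr_gt0 ?subr_gt0//= invr_gt0.
have r4 : r <= 4^-1 by rewrite ge_min lexx orbT.
have rr : r * (4 * d.+1%:R * pi) <= 1 - rho.
  by rewrite -ler_pdivlMr// ge_min lexx.
exists rho, r; split => //.
- by rewrite rho0 rho1.
- by apply: le_trans r4 _; lra.
- move=> x hx dx.
  have [i hi] : exists i, eta <= `|x 0 i|.
    have [/existsP//|/existsPn h] := boolP [exists i, eta <= `|x 0 i|].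
    exfalso; suff : enorm x < delta by rewrite ltNge dx.
    apply: le_lt_trans (enorm_le_sum _) _.
    apply: (@le_lt_trans _ _ (\sum_(i < d) delta / d.+1%:R)).
      apply: ler_sum => i _; apply/ltW; apply: lt_le_trans (_ : eta <= _).
        by have := h i; rewrite -ltNge.
      by rewrite ge_min lexx.
    rewrite sumr_const card_ord -[ltLHS]mulr_natr -mulrA gtr_pMr// ltr_pdivrMl// mulr1.
    by rewrite ltr_nat.
  apply: le_trans (bump_le_coord x i) _.
  have xi2 : `|x 0 i| <= 2^-1.
    by have := hx i; rewrite /= in_itv /= ler_norml => /andP[-> /ltW ->].
  rewrite (_ : cos _ = cos (pi * `|x 0 i|)); last first.
    by have [_|//] := ler0P (x 0 i); rewrite mulrN cosN.
  have cge (t : R) : 0 <= t -> t <= 2^-1 -> 0 <= cos (pi * t).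
    move=> t0 t2; apply: cos_ge0_pihalf.
    have h1 : 0 <= pi * t by rewrite mulr_ge0 ?(ltW pi0) ?(ltW eta0).
    have h2 : pi * t <= pi * 2^-1 by rewrite ler_pM2l.
    by apply/andP; split; lra.
  apply: lerXn2r; first by rewrite nnegrE cge.
    by rewrite nnegrE; exact: (cge _ (ltW eta0) eta2).
  rewrite leNgt ltr_cos ?in_itv /=; last 2 first.
  - have h1 : 0 <= pi * `|x 0 i| by rewrite mulr_ge0 ?(ltW pi0) ?(ltW eta0).
    have h2 : pi * `|x 0 i| <= pi * 2^-1 by rewrite ler_pM2l.
    by apply/andP; split; lra.
  - have h1 : 0 <= pi * eta by rewrite mulr_ge0 ?(ltW pi0) ?(ltW eta0).
    have h2 : pi * eta <= pi * 2^-1 by rewrite ler_pM2l.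
    by apply/andP; split; lra.
  by rewrite -leNgt ler_pM2l.
move=> x hx.
have pr0 : 0 <= pi * r by rewrite mulr_ge0 ?ltW.
have d0 : 0 <= d%:R :> R by [].
have prd : 4 * ((pi * r) * d%:R) + 4 * (pi * r) <= 1 - rho.
  by move: rr; rewrite -[d.+1%:R]natr1; apply: le_trans; rewrite le_eqVlt; apply/orP; left; apply/eqP; ring.
have prd0 : 0 <= (pi * r) * d%:R by rewrite mulr_ge0.
have pr1 : pi * r <= 1 by lra.
apply: (@le_trans _ _ (\prod_(i < d) (1 - pi * r) ^+ 2)).
  rewrite prodr_const card_ord -exprM.
  apply: le_trans (bernoulli_le _ _); last by rewrite pr0.
  by rewrite natrM; lra.
apply: ler_prod => i _; rewrite sqr_ge0 /=.
have xir : `|x 0 i| <= r by have := hx i; rewrite /= in_itv /= ler_norml.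
have lip : `|cos (pi * x 0 i) - cos 0| <= `|pi * x 0 i - 0|.
  by apply: (@derivable_lip1 _ cos (fun t => - sin t)) => t; rewrite normrN sin_max.
move: lip; rewrite cos0 subr0 normrM (gtr0_norm pi0) ler_norml => /andP[lip _].
have : 1 - pi * r <= cos (pi * x 0 i).
  by have : pi * `|x 0 i| <= pi * r by [rewrite ler_pM2l]; lra.
by move=> h; rewrite lerXn2r// nnegrE ?(le_trans _ h)// subr_ge0.
Qed.

(** Normalised powers of [bump]. Away from the integer points the powers are
    at most [rho ^+ N], while their integral over the cube is at least a
    constant times [((1 + rho) / 2) ^+ N]. *)
Lemma approximate_identity : exists phi : nat -> 'rV[R]_d -> R,
  [/\ forall N, trigpoly (fun x => (phi N x)%:C%C), forall N x, 0 <= phi N x,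
      forall N, Rintegral lam setT (fun x => \1_hcube x * phi N x) = 1 &
      forall delta e, 0 < delta -> 0 < e -> exists N0, forall N, (N0 <= N)%N ->
        forall x, hcube x -> delta <= enorm x -> phi N x <= e].
Proof.
pose Z N := Rintegral lam setT (fun x => \1_hcube x * bump x ^+ N).
have iZ N : rintegrable lam (fun x => \1_hcube x * bump x ^+ N).
  apply: (rintegrable_dom (v := \1_hcube)) rintegrable_indic_hcube.
    apply: measurable_funM; last exact: measurable_bump.
    by apply: measurable_indic; exact: measurable_hcube.
  move=> x; rewrite ger0_norm ?mulr_ge0 ?exprn_ge0 ?bump_ge0//.
  by rewrite ler_piMr// exprn_ile1// ?bump_ge0 ?bump_le1.
have lower rho r : 0 < r -> r <= 2^-1 -> 0 <= rho ->
    (forall x, box d `[- r, r] x -> rho <= bump x) ->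
    forall N, (r ^+ d) * rho ^+ N <= Z N.
  move=> r0 r2 rho0 hr N.
  have mB : measurable (box d `[- (r / 2), r / 2]) by exact: measurable_box.
  have lB : lam (box d `[- (r / 2), r / 2]) = (r ^+ d)%:E.
    apply: lebesgue_box => //; rewrite lebesgue_measure_itv /= lte_fin ifT -?EFinB.
      by congr EFin; lra.
    by rewrite gtrN// divr_gt0.
  have [iB <-] := Rintegral_indicator mB lB.
  rewrite mulrC -RintegralZl//; apply: le_Rintegral => //; [exact: (rintegrableZ _ iB)|exact: iZ|].
  move=> x _; rewrite !indicE; case: (boolP (x \in box d _)) => [/set_mem xB|_]; last first.
    by rewrite mulr0 mulr_ge0// exprn_ge0// bump_ge0.
  have xh : hcube x.
    move=> i; have := xB i; rewrite /= !in_itv /= => /andP[a b].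
    by apply/andP; split; lra.
  rewrite mem_set//= mulr1 mul1r lerXn2r ?nnegrE ?bump_ge0//; apply: hr => i.
  have := xB i; rewrite /= !in_itv /= => /andP[a b].
  by apply/andP; split; lra.
have Z0 N : 0 < Z N.
  have [rho [r [/andP[rho0 rho1] r0 r2 _ hr]]] := bump_gap (ltr01 : 0 < 1 :> R).
  have rr : 0 < (1 + rho) / 2 by rewrite divr_gt0// ltr_pwDl.
  apply: lt_le_trans (lower _ _ r0 r2 (ltW rr) hr N).
  by rewrite mulr_gt0// exprn_gt0.
exists (fun N x => (Z N)^-1 * bump x ^+ N); split.
- move=> N; under eq_fun do rewrite rmorphM.
  by apply: trigpolyM; [exact: trigpoly_cst|exact: trigpoly_bump].
- by move=> N x; rewrite mulr_ge0// ?exprn_ge0 ?bump_ge0// invr_ge0 ltW.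
- move=> N; under eq_Rintegral do rewrite mulrCA.
  rewrite RintegralZl//; last exact: iZ.
  by apply: mulVf; exact: lt0r_neq0 (Z0 N).
move=> delta e delta0 e0.
have [rho [r [/andP[rho0 rho1] r0 r2 far near]]] := bump_gap delta0.
have rr : 0 < (1 + rho) / 2 by rewrite divr_gt0// ltr_pwDl.
pose q := rho / ((1 + rho) / 2).
have q0 : 0 <= q by rewrite divr_ge0// ltW.
have q1 : q < 1 by rewrite ltr_pdivrMr// mul1r; lra.
have rd : 0 < r ^+ d by rewrite exprn_gt0.
have : (GRing.exp q : R^nat) @ \oo --> (0 : R) by apply: cvg_expr; rewrite ger0_norm.
move=> /cvgrPdist_lt/(_ (e * r ^+ d)) [|N0 _ hN0]; first by rewrite mulr_gt0.
exists N0 => N /hN0 /=; rewrite sub0r normrN ger0_norm ?exprn_ge0// => hN x hx dx.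
apply: (@le_trans _ _ ((r ^+ d * ((1 + rho) / 2) ^+ N)^-1 * rho ^+ N)).
  apply: ler_pM; rewrite ?exprn_ge0 ?bump_ge0 ?invr_ge0 ?(ltW (Z0 N))//.
    rewrite lef_pV2 ?posrE ?mulr_gt0 ?exprn_gt0//.
    exact: (lower _ _ r0 r2 (ltW rr) near N).
  by rewrite lerXn2r ?nnegrE ?bump_ge0// far.
have -> : (r ^+ d * ((1 + rho) / 2) ^+ N)^-1 * rho ^+ N = q ^+ N / r ^+ d.
  rewrite /q [in RHS]expr_div_n invfM [RHS]mulrC -mulrA; congr (_ * _); exact: mulrC.
by rewrite ler_pdivrMr// ltW.
Qed.

End approximate_identity.

(** * Poisson summation over the integer lattice *)

Section poisson.
Context {R : realType} {d : nat}.
Local Notation lam := (lebesgue_rV R d).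
Implicit Types (x y n k : 'rV[R]_d) (f g u : 'rV[R]_d -> R[i]).

Definition ccontinuous f := forall x e, 0 < e ->
  exists2 r, 0 < r & forall y, enorm (x - y) < r -> normc (f x - f y) < e.

Lemma ccontinuous_measurable f : ccontinuous f -> cmeasurable f.
Proof.
by move=> cf; split; apply: econtinuous_measurable => x e e0;
  have [r r0 hr] := cf x e e0; exists r => // y /hr; apply: le_lt_trans;
  rewrite -raddfB; [exact: normc_Re|exact: normc_Im].
Qed.

Lemma fourier_char f k : fourier f k = cintegral lam (fun x => char (- k) x * f x).
Proof. by apply: eq_cintegral => x; rewrite /char dotpNl mulrN. Qed.

Section kernel.
Variable phi : nat -> 'rV[R]_d -> R.
Hypothesis phi_tp : forall N, trigpoly (fun x => (phi N x)%:C%C).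
Hypothesis phi_ge0 : forall N x, 0 <= phi N x.
Hypothesis phi_mass : forall N, Rintegral lam setT (fun x => \1_hcube x * phi N x) = 1.
Hypothesis phi_conc : forall delta e, 0 < delta -> 0 < e ->
  exists N0, forall N, (N0 <= N)%N ->
  forall x, hcube x -> delta <= enorm x -> phi N x <= e.

Lemma measurable_phi N : measurable_fun setT (phi N).
Proof. exact: (cmeasurable_trigpoly (phi_tp N)).1. Qed.

Lemma phi_bounded N : exists M, forall x, phi N x <= M.
Proof.
have [M hM] := trigpoly_bounded (phi_tp N); exists M => x.
by apply: le_trans (hM x); rewrite normc_real ler_norm.
Qed.

Lemma phi_periodic N x n : Zd n -> phi N (x + n) = phi N x.
Proof.
by move=> Zn; have := trigpoly_periodic (phi_tp N) x Zn => -[].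
Qed.

(** The kernel on one period. *)
Definition cphi N x : R := \1_hcube x * phi N x.

Lemma measurable_cphi N : measurable_fun setT (cphi N).
Proof.
apply: measurable_funM; last exact: measurable_phi.
by apply: measurable_indic; exact: measurable_hcube.
Qed.

Lemma cphi_ge0 N x : 0 <= cphi N x.
Proof. by rewrite mulr_ge0. Qed.

Lemma rintegrable_cphi N : rintegrable lam (cphi N).
Proof.
have [M hM] := phi_bounded N.
apply: (rintegrable_dom (v := fun x => M * \1_hcube x)); first exact: measurable_cphi.
  by move=> x; rewrite ger0_norm ?cphi_ge0// /cphi mulrC ler_wpM2r.
exact/rintegrableZ/rintegrable_indic_hcube.
Qed.

Lemma cphi_mass N : Rintegral lam setT (cphi N) = 1. Proof. exact: phi_mass. Qed.

Lemma cphi_approx u M : cmeasurable u -> (forall x, normc (u x) <= M) ->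
  (forall e, 0 < e -> exists2 r, 0 < r & forall x, enorm x < r -> normc (u x - u 0) < e) ->
  forall e, 0 < e -> exists N0, forall N, (N0 <= N)%N ->
  normc (cintegral lam (fun x => (cphi N x)%:C%C * u x) - u 0) < e.
Proof.
move=> mu uM uc e e0.
have M0 : 0 <= M by apply: le_trans (uM 0); exact: normc_ge0.
have e5 : 0 < e / 5 by rewrite divr_gt0.
have [r r0 hr] := uc _ e5.
have M1 : 0 < 10 * (M + 1) by rewrite mulr_gt0// ltr_wpDl.
have [N0 hN0] := phi_conc r0 (divr_gt0 e0 M1).
exists N0 => N /hN0 hN.
have mc : cmeasurable (fun x => (cphi N x)%:C%C) by apply: cmeasurable_real; exact: measurable_cphi.
have icu v (M' : R) : cmeasurable v -> (forall x, normc (v x) <= M') ->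
    cintegrable lam (fun x => (cphi N x)%:C%C * v x).
  move=> mv vM; apply: cintegrable_dom (rintegrableZ M' (rintegrable_cphi N)).
    exact: cmeasurableM.
  by move=> x; rewrite normcMl normc_real ger0_norm ?cphi_ge0// mulrC ler_wpM2r ?cphi_ge0.
have u0E : u 0 = cintegral lam (fun x => (cphi N x)%:C%C * u 0).
  under eq_cintegral do rewrite mulrC.
  rewrite cintegralZ; last by have := icu (fun=> 1) (normc 1) (cmeasurable_cst _)
    (fun=> lexx _); under eq_fun do rewrite mulr1.
  rewrite [X in _ = _ * X](_ : _ = 1) ?mulr1//.
  apply/eqP; rewrite eq_complex /= cphi_mass eqxx /=.
  by rewrite Rintegral_cst// mul0r.
rewrite [X in normc (_ - X)]u0E -cintegralB; last 2 first.
- exact: icu mu uM.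
- by apply: (icu _ (normc (u 0))) => //; exact: cmeasurable_cst.
have iv : rintegrable lam (fun x => e / 5 * cphi N x + 2 * M * (e / (10 * (M + 1))) * \1_hcube x).
  by apply: rintegrableD; apply: rintegrableZ; [exact: rintegrable_cphi|exact: rintegrable_indic_hcube].
(* The difference is at most [e / 5] near the origin, and the kernel is at most
   [e / (10 * (M + 1))] on the rest of the cube. *)
apply: (@le_lt_trans _ _ (2 * Rintegral lam setT
    (fun x => e / 5 * cphi N x + 2 * M * (e / (10 * (M + 1))) * \1_hcube x))).
  apply: normc_cintegral_le => //.
    rewrite (_ : (fun x => _) = fun x => (cphi N x)%:C%C * (u x - u 0)); last first.
      by apply/funext => x; rewrite mulrBr.
    apply: cmeasurableM => //; apply: cmeasurableD => //; exact: cmeasurable_cst.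
  move=> x; rewrite -mulrBr normcMl normc_real ger0_norm ?cphi_ge0//.
  have [xr|xr] := ltP (enorm x) r.
    apply: ler_wpDr; first by apply: mulr_ge0 => //; apply: mulr_ge0; [exact: mulr_ge0|exact/ltW/divr_gt0].
    by rewrite mulrC ler_wpM2r ?cphi_ge0//; exact/ltW/hr.
  apply: ler_wpDl; first by rewrite mulr_ge0 ?cphi_ge0 ?(ltW e5).
  rewrite /cphi indicE; case: (boolP (x \in hcube)) => [/set_mem xh|_]; last by rewrite !mul0r mulr0.
  rewrite mul1r mulr1 mulrC; apply: ler_pM; rewrite ?normc_ge0//; last exact: hN.
  by apply: le_trans (normcD _ _) _; rewrite normcNE mulrDl mul1r lerD.
rewrite RintegralD//; last 2 first.
- exact/rintegrableZ/rintegrable_cphi.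
- exact/rintegrableZ/rintegrable_indic_hcube.
rewrite !RintegralZl//; last 2 first.
- exact: rintegrable_indic_hcube.
- exact: rintegrable_cphi.
rewrite cphi_mass Rintegral_indic_hcube !mulr1.
have : 2 * M * (e / (10 * (M + 1))) <= e / 5.
  rewrite mulrA ler_pdivrMr// (_ : e / 5 * (10 * (M + 1)) = 2 * M * e + 2 * e); last by field.
  by rewrite lerDl mulr_ge0// ltW.
lra.
Qed.

(** Periodicity carries the normalisation on the unit cube to its integer
    translates. *)
Lemma phi_cube N n : Zd n -> (\int[lam]_x (\1_hcube (x - n) * phi N x)%:E = 1)%E.
Proof.
move=> Zn.
have i1 := rintegrable_translate (- n) (rintegrable_cphi N).
have e1 := Rintegral_translate (- n) (rintegrable_cphi N).
rewrite cphi_mass in e1; rewrite -[RHS]/(1%:E) -e1 /Rintegral fineK; last first.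
  exact: integrable_fin_num.
by apply: eq_integral => x _; rewrite /cphi phi_periodic//; exact: ZdN.
Qed.

Section main.
Variable g : 'rV[R]_d -> R[i].
Variables C C' : R.
Hypothesis gc : ccontinuous g.
Hypothesis gC : forall x, normc (g x) <= C * weight x.
Hypothesis hatC : forall k, normc (fourier g k) <= C' * weight k.

Let C0 : 0 <= C := weight_bound_ge0 gC.
Let C'0 : 0 <= C' := weight_bound_ge0 hatC.

Let mg : cmeasurable g := ccontinuous_measurable gc.

Lemma patch_le (F : 'rV[R]_d -> R[i]) c : 0 <= c -> (forall x, normc (F x) <= c * weight x) ->
  forall x, normc (onset Zd F x) <= c * (weight \_ Zd) x.
Proof.
by move=> c0 FC x; rewrite /onset patchE; case: ifP => // _; rewrite normc_0 mulr0.
Qed.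

Definition pairing N := cintegral lam (fun x => (phi N x)%:C%C * g x).

Lemma cintegrable_char_g k : cintegrable lam (fun x => char k x * g x).
Proof.
apply: cintegrable_dom (rintegrableZ C (rintegrable_weight d)).
  by apply: cmeasurableM => //; exact: cmeasurable_char.
by move=> x; rewrite normcMl normc_char mul1r.
Qed.

(** The Fourier coefficients of the kernel. *)
Definition coeff N k := cintegral lam (fun x => (cphi N x)%:C%C * char (- k) x).

Lemma coeff_le N k : normc (coeff N k) <= 2.
Proof.
have := @normc_cintegral_le R _ _ lam (fun x => (cphi N x)%:C%C * char (- k) x) (cphi N).
rewrite cphi_mass mulr1; apply.
- apply: cmeasurableM; last exact: cmeasurable_char.
  by apply: cmeasurable_real; exact: measurable_cphi.
- by move=> x; rewrite normcMl normc_char mulr1 normc_real ger0_norm// cphi_ge0.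
- exact: rintegrable_cphi.
Qed.

Lemma char_continuous k e : 0 < e ->
  exists2 r, 0 < r & forall x y, enorm (x - y) < r -> normc (char k x - char k y) < e.
Proof.
move=> e0; pose c : R := 4 * pi * (enorm k + 1).
have c0 : 0 < c by rewrite !mulr_gt0 ?pi_gt0// ltr_wpDl ?enorm_ge0.
exists (e / c); first exact: divr_gt0.
move=> x y; rewrite ltr_pdivlMr// => h.
apply: le_lt_trans (expi_lip _ _) _; apply: le_lt_trans h.
rewrite -mulrBr -dotpNr -dotpDr normrM ger0_norm ?mulr_ge0 ?pi_ge0// /c.
have := norm_dotp_le k (x - y); have := enorm_ge0 (x - y); have := enorm_ge0 k.
have := pi_gt0 R; move: `|dotp _ _| (enorm _) (enorm k) pi => a b c' p p0 c'0 b0 h.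
have : p * a <= p * (c' * b) by rewrite ler_pM2l.
have : 0 <= p * b by rewrite mulr_ge0// ltW.
nra.
Qed.

Lemma coeff_cvg k e : 0 < e ->
  exists N0, forall N, (N0 <= N)%N -> normc (coeff N k - 1) < e.
Proof.
have := @cphi_approx (char (- k)) 1 (cmeasurable_char _).
rewrite char0r; apply => [x|{}e e0]; first by rewrite normc_char.
have [r r0 hr] := char_continuous (- k) e0; exists r => // x xr.
by rewrite -(char0r (- k)); apply: hr; rewrite subr0.
Qed.

(** The kernel is a trigonometric polynomial, so only finitely many
    coefficients are nonzero. *)
Lemma pairing_coeff N :
  hasum (onset Zd (fun k => coeff N k * fourier g (- k))) (pairing N).
Proof.
have [J [a [k [Zk phiE]]]] := phi_tp N.
have coeffE n : Zd n -> coeff N n = \sum_(j | k j == n) a j.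
  move=> Zn; rewrite /coeff.
  have ich j : cintegrable lam (fun x => a j * ((\1_hcube x)%:C%C * char (k j - n) x)).
    apply: cintegrableZ; apply: (cintegrable_dom (u := \1_hcube)).
    - apply: cmeasurableM; last exact: cmeasurable_char.
      by apply: cmeasurable_real; apply: measurable_indic; exact: measurable_hcube.
    - by move=> x; rewrite normcMl normc_char mulr1 normc_real ger0_norm.
    - exact: rintegrable_indic_hcube.
  transitivity (cintegral lam (fun x => \sum_j a j * ((\1_hcube x)%:C%C * char (k j - n) x))).
    apply: eq_cintegral => x; rewrite /cphi rmorphM /= phiE mulr_sumr mulr_suml.
    by apply: eq_bigr => j _; rewrite charDl; ring.
  rewrite (cintegral_sum _ ich).1 [RHS]big_mkcond; apply: eq_bigr => j _.
  rewrite cintegralZ; last first.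
    apply: (cintegrable_dom (u := \1_hcube)).
    - apply: cmeasurableM; last exact: cmeasurable_char.
      by apply: cmeasurable_real; apply: measurable_indic; exact: measurable_hcube.
    - by move=> x; rewrite normcMl normc_char mulr1 normc_real ger0_norm.
    - exact: rintegrable_indic_hcube.
  rewrite cintegral_char ?subr_eq0; last by apply: ZdD => //; exact: ZdN.
  by case: eqP; rewrite ?mulr1 ?mulr0.
pose K : {fset 'rV[R]_d} := [fset k j | j : J]%fset.
move=> e e0; exists K => A KA.
suff -> : \sum_(i <- A) onset Zd (fun k => coeff N k * fourier g (- k)) i = pairing N.
  by rewrite subrr normc_0.
transitivity (\sum_(n <- A) \sum_(j | k j == n) a j * fourier g (- k j)).
  apply: eq_bigr => n _; rewrite /onset; case: ifPn => [/set_mem Zn|nZ].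
    by rewrite coeffE// mulr_suml; apply: eq_bigr => j /eqP ->.
  rewrite big1// => j /eqP e1; move: nZ; rewrite -e1 => /negP; case.
  exact/mem_set.
under eq_bigr do rewrite big_mkcond.
rewrite exchange_big /=.
transitivity (\sum_j a j * fourier g (- k j)).
  apply: eq_bigr => j _.
  have kA : k j \in A by apply: (fsubsetP KA); apply/imfsetP; exists j.
  rewrite (big_fsetD1 _ kA) /= eqxx big1_fset ?addr0// => n.
  by rewrite !inE eq_sym => /andP[/negbTE ->].
have ich j : cintegrable lam (fun x => a j * (char (k j) x * g x)).
  by apply: cintegrableZ; exact: cintegrable_char_g.
transitivity (cintegral lam (fun x => \sum_j a j * (char (k j) x * g x))).
  rewrite (cintegral_sum _ ich).1; apply: eq_bigr => j _.
  rewrite cintegralZ; last exact: cintegrable_char_g.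
  by rewrite fourier_char opprK.
apply: eq_cintegral => x; rewrite phiE mulr_suml.
by apply: eq_bigr => j _; rewrite mulrA.
Qed.

(** On finitely many cubes the kernel concentrates at the centre; on the
    others [integral_le_sum] bounds the integral by a tail of the sum of
    [weight]. *)
Lemma pairing_cvg s : hasum (onset Zd g) s -> forall e, 0 < e ->
  exists N0, forall N, (N0 <= N)%N -> normc (pairing N - s) < e.
Proof.
move=> gs e e0.
have e4 : 0 < e / 4 by rewrite divr_gt0.
have K0 : 0 < 8 * (C * cubeK R d + 1).
  by rewrite mulr_gt0// ltr_wpDl// mulr_ge0// ltW// cubeK_gt0.
pose e1 := e / (8 * (C * cubeK R d + 1)).
have e10 : 0 < e1 by exact: divr_gt0.
have [A0 hA0] := sum_le_tail (@sum_le_weight_Zd R d) e10.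
have [A1 hA1] := gs _ e4.
pose A : {fset 'rV[R]_d} := (A0 `|` A1)%fset.
pose b n : R := if n \in A then 0 else cubeK R d * weight n.
have bsum : sum_le (b \_ Zd) (cubeK R d * e1).
  split=> [n|B].
    rewrite patchE; case: ifP => // _; rewrite /b; case: ifP => // _.
    by rewrite mulr_ge0 ?weight_ge0// ltW// cubeK_gt0.
  rewrite (big_fsetID _ (mem A)) /= big1_fset ?add0r; last first.
    move=> n; rewrite !inE /= => /andP[_ nA] _.
    by rewrite patchE /b; case: ifP => // _; rewrite !inE nA.
  apply: (@le_trans _ _ (\sum_(i <- [fset x | x in B & x \notin A]%fset)
      cubeK R d * (weight \_ Zd) i)).
    apply: ler_sum => n _; rewrite !patchE /b; case: ifP => _; last by rewrite mulr0.
    by case: ifP => // _; rewrite mulr_ge0 ?weight_ge0// ltW// cubeK_gt0.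
  rewrite -mulr_sumr ler_wpM2l ?(ltW cubeK_gt0)//; apply/ltW/hA0.
  apply/fdisjointP => n nA0.
  by rewrite !inE /= ?inE nA0 /= ?andbF.
pose part N n x : R := \1_Zd n * (\1_hcube (x - n) * phi N x).
pose chi x : R := \sum_(n <- A) \1_Zd n * \1_hcube (x - n).
have mpart N n : measurable_fun setT (part N n).
  apply: measurable_funM => //; apply: measurable_funM; last exact: measurable_phi.
  exact: measurable_indic_hcube.
have mchi : measurable_fun setT chi.
  apply: measurable_sum => n; apply: measurable_funM => //.
  exact: measurable_indic_hcube.
have chi1 x : 0 <= 1 - chi x <= 1.
  rewrite subr_ge0 sum_indic_hcube_le1 lerBlDr lerDl /=.
  by apply: sumr_ge0 => n _; apply: mulr_ge0.
have part_le N n x : normc ((part N n x)%:C%C * g x) <= normc ((phi N x)%:C%C * g x).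
  rewrite !normcMl !normc_real ler_wpM2r ?normc_ge0// !ger0_norm ?mulr_ge0//.
  by rewrite /part mulrA ler_piMl// mulr_ile1// indic_le1.
have bnd N : exists2 v, rintegrable lam v & forall x, normc ((phi N x)%:C%C * g x) <= v x.
  have [M hM] := phi_bounded N; exists (fun x => M * C * weight x).
    exact/rintegrableZ/rintegrable_weight.
  move=> x; rewrite normcMl normc_real ger0_norm// -mulrA.
  by rewrite ler_pM ?normc_ge0.
have ipart N n : cintegrable lam (fun x => (part N n x)%:C%C * g x).
  have [v iv hv] := bnd N; apply: cintegrable_dom iv.
    by apply: cmeasurableM => //; exact: cmeasurable_real.
  by move=> x; apply: le_trans (part_le _ _ _) (hv x).
have mrest N : cmeasurable (fun x => (phi N x * (1 - chi x))%:C%C * g x).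
  apply: cmeasurableM => //; apply: cmeasurable_real; apply: measurable_funM.
    exact: measurable_phi.
  exact: measurable_funB.
have irest N : cintegrable lam (fun x => (phi N x * (1 - chi x))%:C%C * g x).
  have [v iv hv] := bnd N; apply: cintegrable_dom iv => // x.
  apply: le_trans (hv x); have /andP[c0 c1] := chi1 x.
  rewrite !normcMl !normc_real ler_wpM2r ?normc_ge0// !ger0_norm ?mulr_ge0//.
  by rewrite ler_piMr.
have decomp N : pairing N = \sum_(n <- A) cintegral lam (fun x => (part N n x)%:C%C * g x)
    + cintegral lam (fun x => (phi N x * (1 - chi x))%:C%C * g x).
  rewrite -(cintegral_sum A (ipart N)).1 -cintegralD//; last first.
    exact: (cintegral_sum A (ipart N)).2.
  apply: eq_cintegral => x; rewrite -mulr_suml -mulrDl; congr (_ * _).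
  rewrite -rmorph_sum -rmorphD /=; congr (_%:C%C).
  rewrite /part (eq_bigr (fun n => \1_Zd n * \1_hcube (x - n) * phi N x)).
    by rewrite -mulr_suml -/(chi x); ring.
  by move=> n _; rewrite mulrA.
have rest_le N : normc (cintegral lam (fun x => (phi N x * (1 - chi x))%:C%C * g x)) <= e / 4.
  pose F x := weight x * (1 - chi x) * phi N x.
  have mF : measurable_fun setT F.
    apply: measurable_funM; last exact: measurable_phi.
    by apply: measurable_funM; [exact: measurable_weight|exact: measurable_funB].
  have F0 x : 0 <= F x.
    by have /andP[c0 _] := chi1 x; rewrite !mulr_ge0 ?weight_ge0.
  have Fb x : 0 <= F x <= b (nearest x) * phi N x.
    rewrite F0 /= /F ler_wpM2r// /b; have Zx := Zd_nearest x.
    have hx : hcube (x - nearest x) by apply/nearestE.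
    case: ifPn => [xA|xA].
      rewrite (_ : chi x = 1) ?subrr ?mulr0//.
      rewrite /chi (big_fsetD1 _ xA) /= !indicE !mem_set// mulr1 big1_fset ?addr0//.
      move=> n; rewrite !inE => /andP[nx _] _.
      have [Zn|Zn] := pselect (Zd n); first by rewrite indic_hcube// (negbTE nx) mulr0.
      by rewrite [\1_Zd n]indicE memNset// mul0r.
    have /andP[_ c1] := chi1 x; rewrite -[leRHS]mulr1 ler_pM ?weight_ge0//.
      by have /andP[] := chi1 x.
    exact: weight_hcube.
  have intF := integral_le_sum bsum (measurable_phi N) (phi_ge0 N) (phi_cube N) mF Fb.
  have iF : rintegrable lam F.
    apply/integrableP; split; first exact/measurable_EFinP.
    apply: le_lt_trans (ltry (cubeK R d * e1)); apply: le_trans intF.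
    rewrite le_eqVlt; apply/orP; left; apply/eqP; apply: eq_integral => x _ /=.
    by rewrite ger0_norm.
  have RF : Rintegral lam setT F <= cubeK R d * e1.
    rewrite -lee_fin /Rintegral fineK//.
    exact: integrable_fin_num.
  apply: le_trans (normc_cintegral_le (u := fun x => C * F x) (mrest N) _ _) _.
  - move=> x; rewrite normcMl normc_real ger0_norm; last first.
      by have /andP[c0 _] := chi1 x; rewrite mulr_ge0.
    have := gC x; have /andP[c0 _] := chi1 x; have := phi_ge0 N x => p0 gx.
    rewrite /F (_ : C * _ = phi N x * (1 - chi x) * (C * weight x)); last by ring.
    by rewrite ler_wpM2l// mulr_ge0.
  - exact: rintegrableZ.
  rewrite RintegralZl//.
  apply: (@le_trans _ _ (2 * (C * (cubeK R d * e1)))).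
    by rewrite ler_wpM2l// ler_wpM2l.
  rewrite (_ : 2 * (C * _) = 2 * (C * cubeK R d) * e /
    (8 * (C * cubeK R d + 1))); last by rewrite /e1 !mulrA.
  rewrite ler_pdivrMr//.
  rewrite (_ : e / 4 * _ = 2 * (C * cubeK R d) * e + 2 * e); last by field.
  by rewrite lerDl mulr_ge0// ltW.
have part_cvg n (a : R) : 0 < a -> exists N0, forall N, (N0 <= N)%N ->
    normc (cintegral lam (fun x => (part N n x)%:C%C * g x) - onset Zd g n) < a.
  move=> a0; have [Zn|Zn] := pselect (Zd n); last first.
    have z0 : \1_Zd n = 0 :> R by rewrite indicE memNset.
    exists 0%N => N _; rewrite onset_out//.
    under eq_cintegral do rewrite /part z0 !mul0r.
    by rewrite cintegral0 subrr normc_0.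
  have C1 y : normc (g (y + n)) <= C.
    by apply: le_trans (gC _) _; rewrite ler_piMr// weight_le1.
  have mgn : cmeasurable (fun y => g (y + n)).
    exact: (cmeasurable_comp mg (measurable_translate n)).
  have cg e' : 0 < e' -> exists2 r, 0 < r & forall y, enorm y < r ->
      normc (g (y + n) - g (0 + n)) < e'.
    move=> e'0; have [r r0 hr] := gc n e'0; exists r => // y yr.
    by rewrite normcBC add0r; apply: hr; rewrite opprD addrCA subrr addr0 enormN.
  have [N0 hN0] := @cphi_approx (fun y => g (y + n)) C mgn C1 cg a a0.
  exists N0 => N /hN0; rewrite add0r onset_in//.
  rewrite -(cintegral_translate n (ipart N n)).
  congr (normc (_ - _) < _); apply: eq_cintegral => y.
  have z1 : \1_Zd n = 1 :> R by rewrite indicE mem_set.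
  by rewrite /part z1 mul1r addrK phi_periodic.
have [N0 hN0] := fset_sum_limit A part_cvg e4; exists N0 => N /hN0 h.
have h1 := hA1 A (fsubsetUr _ _); have h2 := rest_le N.
rewrite decomp; set S := \sum_(n <- A) _ in h *; set T := \sum_(i <- A) _ in h h1.
set Q := cintegral _ _ in h2 *.
rewrite (_ : S + Q - s = (S - T) + ((T - s) + Q)); last by ring.
apply: le_lt_trans (normcD _ _) _.
have := normcD (T - s) Q; lra.
Qed.

End main.
End kernel.

(** Both sums are limits of the integrals of [g] against the approximate
    identity: its Fourier coefficients tend to one, and it concentrates at the
    integer points. *)
Lemma poisson_Zd g C C' : ccontinuous g ->
  (forall x, normc (g x) <= C * weight x) ->
  (forall k, normc (fourier g k) <= C' * weight k) ->
  exists2 s, hasum (onset Zd g) s & hasum (onset Zd (fourier g)) s.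
Proof.
move=> gc gC hatC.
have C0 := weight_bound_ge0 gC; have C'0 := weight_bound_ge0 hatC.
have hatCN k : normc (fourier g (- k)) <= C' * weight k.
  by apply: le_trans (hatC _) _; rewrite weightN.
have [phi [ptp p0 pmass pconc]] := @approximate_identity R d.
have [s hs] := dominated_hasum (sum_leZ C0 (@sum_le_weight_Zd R d)) (patch_le C0 gC).
have [t ht] := dominated_hasum (sum_leZ C'0 (@sum_le_weight_Zd R d)) (patch_le C'0 hatCN).
have C2 : 0 <= 2 * C' by rewrite mulr_ge0.
have lim2 := @hasum_limit R _ (fun N => onset Zd (fun k => coeff phi N k * fourier g (- k)))
  (pairing phi g) (onset Zd (fun k => fourier g (- k))) _ _ t
  (sum_leZ C2 (@sum_le_weight_Zd R d)) _ _ _ ht _.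
have st : s = t.
  apply/eqP; rewrite -subr_eq0; apply/negPn/negP => st.
  have e0 : 0 < normc (s - t) / 2.
    rewrite divr_gt0// lt_def normc_ge0 andbT; apply: contra st => /eqP/normc_eq0/eqP//.
  have [N1 h1] := pairing_cvg ptp p0 pmass pconc gc gC hs e0.
  have [||||N2 h2] := lim2 _ _ _ _ _ e0.
  - move=> N; apply: patch_le => // k; rewrite normcMl -mulrA.
    by rewrite ler_pM ?normc_ge0//; exact: coeff_le.
  - apply: patch_le => // k; apply: le_trans (hatCN k) _.
    by rewrite ler_wpM2r ?weight_ge0// ler_peMl// ler1n.
  - move=> k e e1; have [Zk|Zk] := pselect (Zd k); last first.
      by exists 0%N => N _; rewrite !onset_out// subrr normc_0.
    have f0 : 0 < normc (fourier g (- k)) + 1 by rewrite ltr_wpDl ?normc_ge0.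
    have [N0 hN0] := coeff_cvg ptp p0 pmass pconc k (divr_gt0 e1 f0).
    exists N0 => N /hN0 h; rewrite !onset_in//.
    rewrite -{2}(mul1r (fourier g (- k))) -mulrBl normcMl.
    apply: (@le_lt_trans _ _ (normc (coeff phi N k - 1) * (normc (fourier g (- k)) + 1))).
      by rewrite ler_wpM2l ?normc_ge0// lerDl.
    by rewrite -ltr_pdivlMr.
  - by move=> N; apply: pairing_coeff.
  have := h1 (maxn N1 N2) (leq_maxl _ _); have := h2 (maxn N1 N2) (leq_maxr _ _).
  set P := pairing _ _ _ => a b; have := normcD (s - P) (P - t).
  rewrite addrA subrK (normcBC s P); move: e0; lra.
exists s => //; rewrite st.
have := hasum_bij (h := -%R) (g := -%R) (@opprK _) (@opprK _) ht.
apply: eq_hasum => k; rewrite /onset opprK.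
by congr (if _ then _ else _); apply/idP/idP => /set_mem/ZdN; rewrite ?opprK => /mem_set.
Qed.

End poisson.

(** * Schwartz functions *)

Section weight_from_monomials.
Context {R : realType}.

Lemma exprD_le (s t : R) n : 0 <= s -> 0 <= t ->
  (s + t) ^+ n <= 2 ^+ n * (s ^+ n + t ^+ n).
Proof.
move=> s0 t0; wlog st : s t s0 t0 / s <= t.
  move=> h; have [/h|/ltW/h] := leP s t; first exact.
  by rewrite addrC (addrC (s ^+ n)); apply.
apply: (@le_trans _ _ ((2 * t) ^+ n)).
  by apply: lerXn2r; rewrite ?nnegrE ?addr_ge0 ?mulr_ge0//; lra.
by rewrite exprMn ler_wpM2l ?exprn_ge0// lerDr exprn_ge0.
Qed.

Lemma expr_sum_le (I : Type) (s : seq I) n : exists2 K : R, 1 <= K &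
  forall F : I -> R, (forall i, 0 <= F i) ->
  (1 + \sum_(i <- s) F i) ^+ n <= K * (1 + \sum_(i <- s) F i ^+ n).
Proof.
elim: s => [|i s [K K1 IH]].
  by exists 1 => // F _; rewrite !big_nil addr0 expr1n mul1r.
exists (2 ^+ n * K).
  apply: (le_trans K1); rewrite ler_peMl ?exprn_ege1 ?ler1n//.
  exact: le_trans ler01 K1.
move=> F F0; rewrite !big_cons addrCA [in leRHS]addrCA.
have S0 : 0 <= \sum_(j <- s) F j by rewrite sumr_ge0.
have Sn0 : 0 <= \sum_(j <- s) F j ^+ n by rewrite sumr_ge0// => j _; rewrite exprn_ge0.
apply: le_trans (exprD_le _ _ _) _ => //; first by rewrite addr_ge0.
rewrite -mulrA ler_wpM2l ?exprn_ge0// mulrDr lerD//; last exact: IH.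
by rewrite ler_peMl// exprn_ge0.
Qed.

(** The [d]-th power of [1 + enorm x ^+ 2] is at most a constant times one
    plus the sum of the powers [x 0 j ^+ d.*2]. *)
Lemma weight_from_monomials d : exists2 K : R, 0 < K &
  forall (x : 'rV[R]_d) (z delta : R), 0 <= z -> z <= delta ->
  (forall j, `|x 0 j| ^+ d.*2 * z <= delta) -> z <= K * delta * weight x.
Proof.
have [K K1 hK] := expr_sum_le (index_enum 'I_d) d.
have K0 : 0 < K by apply: lt_le_trans K1.
exists (K * d.+1%:R); first by rewrite mulr_gt0.
move=> x z delta z0 zd xd.
have wx := weight_den_gt0 x.
rewrite /weight exprVn ler_pdivlMr ?exprn_gt0//.
have -> : enorm x ^+ 2 = \sum_(j < d) x 0 j ^+ 2.
  by rewrite enorm_sqr; apply: eq_bigr => j _; rewrite expr2.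
apply: (@le_trans _ _ (z * (K * (1 + \sum_(j < d) (x 0 j ^+ 2) ^+ d)))).
  by rewrite ler_wpM2l// hK// => j; exact: sqr_ge0.
rewrite mulrCA -mulrA ler_wpM2l ?(ltW K0)// mulrDr mulr1 mulr_sumr -natr1 mulrDl mul1r addrC.
rewrite lerD//; apply: (@le_trans _ _ (\sum_(j < d) delta)).
  apply: ler_sum => j _; apply: le_trans (xd j).
  by rewrite mulrC ler_wpM2r// -exprM mul2n -normrX ler_norm.
by rewrite sumr_const card_ord -[leLHS]mulr_natl.
Qed.

End weight_from_monomials.

Section schwartz_functions.
Context {R : realType} {d : nat}.
Local Notation lam := (lebesgue_rV R d).
Implicit Types (f g : 'rV[R]_d -> R[i]) (x y k v : 'rV[R]_d) (s : seq 'I_d).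

Lemma partials_cat s1 s2 f : partials (s1 ++ s2) f = partials s1 (partials s2 f).
Proof. by rewrite /partials foldr_cat. Qed.

Lemma schwartz_partials s f : schwartz f -> schwartz (partials s f).
Proof.
move=> [sf bf]; split=> [t x|a t]; first by rewrite -partials_cat; exact: sf.
by have := bf a (t ++ s); rewrite /schwartz_seminorm partials_cat.
Qed.

Lemma schwartz_seminorm_ub a s f (c : R) : (schwartz_seminorm a s f <= c%:E)%E ->
  forall x, `|monomial a x| * normc (partials s f x) <= c.
Proof.
move=> h x; rewrite -normc_real -normcMl -lee_fin; apply: le_trans h.
by apply: ereal_sup_ubound; exists x.
Qed.

Lemma schwartz_seminorm_bound a s f : schwartz f ->
  exists c, forall x, `|monomial a x| * normc (partials s f x) <= c.
Proof.
move=> [_ /(_ a s) h]; case E : (schwartz_seminorm a s f) => [c| |].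
- by exists c => x; apply: schwartz_seminorm_ub; rewrite E.
- by move: h; rewrite E.
- exists 0 => x; apply: schwartz_seminorm_ub; rewrite E; exact: leNye.
Qed.

Definition mono0 : 'I_d -> nat := fun=> 0%N.
Definition mono1 (j : 'I_d) : 'I_d -> nat := fun i => if i == j then d.*2 else 0%N.

Lemma monomial0 x : monomial mono0 x = 1.
Proof. by rewrite /monomial big1. Qed.

Lemma monomial1 j x : monomial (mono1 j) x = x 0 j ^+ d.*2.
Proof.
rewrite /monomial (bigD1 j)//= /mono1 eqxx big1 ?mulr1// => i /negbTE ->.
by rewrite expr0.
Qed.

Lemma mono0_deg : (\sum_(i < d) mono0 i = 0)%N.
Proof. by rewrite big1. Qed.

Lemma mono1_deg j : (\sum_(i < d) mono1 j i = d.*2)%N.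
Proof. by rewrite (bigD1 j)//= /mono1 eqxx big1 ?addn0// => i /negbTE ->. Qed.

(** The pointwise form of the smallness of all seminorms of order at most [N]. *)
Definition order_le (N : nat) (delta : R) f := forall a s,
  (\sum_(i < d) a i <= N)%N -> (size s <= N)%N ->
  forall x, `|monomial a x| * normc (partials s f x) <= delta.

Lemma order_le_decay : exists2 K : R, 0 < K & forall f s delta,
  order_le (d.*2 + d.*2) delta f -> (size s <= d.*2)%N ->
  forall x, normc (partials s f x) <= K * delta * weight x.
Proof.
have [K K0 hK] := @weight_from_monomials R d; exists K => // f s delta fN sN x.
apply: hK; first exact: normc_ge0.
  have := fN mono0 s _ _ x; rewrite monomial0 normr1 mul1r mono0_deg; apply => //.
  by rewrite (leq_trans sN)// leq_addr.
move=> j; have := fN (mono1 j) s _ _ x; rewrite monomial1 normrX mono1_deg; apply.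
  exact: leq_addr.
by rewrite (leq_trans sN)// leq_addr.
Qed.

Lemma schwartz_decay f : schwartz f ->
  exists2 C, 0 <= C & forall x, normc (f x) <= C * weight x.
Proof.
move=> sf; have [K K0 hK] := @weight_from_monomials R d.
have [c0 h0] := schwartz_seminorm_bound mono0 [::] sf.
have hc j : exists c, forall x, `|monomial (mono1 j) x| * normc (f x) <= c.
  exact: (schwartz_seminorm_bound _ [::] sf).
have [c h] := choice hc.
pose M : R := `|c0| + \sum_j `|c j|.
have M0 : 0 <= M by rewrite addr_ge0// sumr_ge0.
exists (K * M); first by rewrite mulr_ge0// ltW.
move=> x; apply: hK; first exact: normc_ge0.
  have := h0 x; rewrite monomial0 normr1 mul1r => /le_trans; apply.
  by rewrite (le_trans (ler_norm _))// lerDl sumr_ge0.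
move=> j; have := h j x; rewrite monomial1 normrX => /le_trans; apply.
rewrite (le_trans (ler_norm _))// /M (bigD1 j)//= addrCA lerDl addr_ge0//.
exact: sumr_ge0.
Qed.

Lemma is_derive_line (u : 'rV[R]_d -> R) x v : (forall z, differentiable u z) ->
  forall t : R, is_derive t (1 : R) (fun t => u (x + t *: v)) ('D_v u (x + t *: v)).
Proof.
move=> du t; have duv := @diff_derivable _ _ _ u (x + t *: v) v (du _).
have E : (fun h : R => h^-1 *: (((fun t => u (x + t *: v)) \o shift t) (h *: (1 : R)) -
    u (x + t *: v))) =
    (fun h : R => h^-1 *: ((u \o shift (x + t *: v)) (h *: v) - u (x + t *: v))).
  apply/funext => h /=; congr (_ *: (u _ - _)).
  by rewrite [h *: 1]mulr1 scalerDl addrCA.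
by split; rewrite /derivable /derive E.
Qed.

Lemma line_MVT (u : 'rV[R]_d -> R) x v : (forall z, differentiable u z) ->
  exists2 t : R, 0 <= t <= 1 & u (x + v) - u x = 'D_v u (x + t *: v).
Proof.
move=> du; have der := is_derive_line x v du.
have cont : {within `[0, 1], continuous (fun t : R => u (x + t *: v))}.
  apply: continuous_subspaceT => t.
  by apply/differentiable_continuous/derivable1_diffP; have [] := der t.
have [t] := @MVT_segment R _ _ 0 1 ler01 (fun t _ => der t) cont.
rewrite in_itv /= scale1r scale0r addr0 subr0 mulr1 => t01 ->.
by exists t.
Qed.

Lemma derive_dir (u : 'rV[R]_d -> R) v z : differentiable u z ->
  'D_v u z = \sum_(i < d) v 0 i * 'D_'e_i u z.
Proof.
move=> du; rewrite deriveE// [v in LHS]row_sum_delta linear_sum; apply: eq_bigr => i _.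
by rewrite linearZ /= deriveE.
Qed.

Definition cdifferentiable f := forall z,
  differentiable (fun y => complex.Re (f y)) z /\ differentiable (fun y => complex.Im (f y)) z.

Lemma schwartz_differentiable f : schwartz f -> cdifferentiable f.
Proof. by move=> [sf _] z; exact: (sf [::]). Qed.

Lemma weight_segment x v (t : R) : 0 <= t <= 1 -> enorm v <= 1 ->
  weight (x + t *: v) <= 4 ^+ d * weight x.
Proof.
move=> /andP[t0 t1] v1.
have h : enorm (x - (x + t *: v)) <= 1.
  rewrite opprD addrA subrr sub0r enormN enormZ ger0_norm//.
  by rewrite -[1]mulr1 ler_pM// enorm_ge0.
apply: le_trans (weight_near h) _; rewrite expr1n.
by rewrite (_ : 2 * (1 + 1) = 4)//; ring.
Qed.

Lemma real_lipschitz_decay (u : 'rV[R]_d -> R) C : 0 <= C ->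
  (forall z, differentiable u z) ->
  (forall i z, `|'D_'e_i u z| <= C * weight z) ->
  forall x v, enorm v <= 1 -> `|u (x + v) - u x| <= d%:R * C * 4 ^+ d * enorm v * weight x.
Proof.
move=> C0 du uC x v v1; have [t t01 ->] := line_MVT x v du.
rewrite derive_dir//; apply: le_trans (ler_norm_sum _ _ _) _.
apply: (@le_trans _ _ (\sum_(i < d) enorm v * (C * (4 ^+ d * weight x)))).
  apply: ler_sum => i _; rewrite normrM ler_pM ?coord_le_enorm//.
  by apply: le_trans (uC _ _) _; rewrite ler_wpM2l// weight_segment.
rewrite sumr_const card_ord -[leLHS]mulr_natl.
by rewrite le_eqVlt; apply/orP; left; apply/eqP; ring.
Qed.

(** The gradient decays like [weight], which varies by a bounded factor over
    distances at most one. *)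
Lemma schwartz_lipschitz f : schwartz f -> exists2 L, 0 <= L &
  forall x v, enorm v <= 1 -> normc (f (x + v) - f x) <= L * enorm v * weight x.
Proof.
move=> sf; have df := schwartz_differentiable sf.
have hC i : exists C, 0 <= C /\ forall x, normc (partial i f x) <= C * weight x.
  by have [C C0 h] := schwartz_decay (schwartz_partials [:: i] sf); exists C.
have [c hc] := choice hC; pose C := \sum_i c i.
have C0 : 0 <= C by apply: sumr_ge0 => i _; have [] := hc i.
have cC i : c i <= C.
  by rewrite /C (bigD1 i)//= lerDl sumr_ge0// => j _; have [] := hc j.
have hRe i z : `|'D_'e_i (fun y => complex.Re (f y)) z| <= C * weight z.
  have [_ /(_ z) h] := hc i; apply: le_trans (normc_Re (partial i f z)) _.
  by apply: le_trans h _; rewrite ler_wpM2r ?weight_ge0.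
have hIm i z : `|'D_'e_i (fun y => complex.Im (f y)) z| <= C * weight z.
  have [_ /(_ z) h] := hc i; apply: le_trans (normc_Im (partial i f z)) _.
  by apply: le_trans h _; rewrite ler_wpM2r ?weight_ge0.
exists (2 * (d%:R * C * 4 ^+ d)); first by rewrite !mulr_ge0.
move=> x v v1; apply: le_trans (normc_le_ReIm _) _.
have h1 := real_lipschitz_decay C0 (fun z => (df z).1) hRe x v1.
have h2 := real_lipschitz_decay C0 (fun z => (df z).2) hIm x v1.
rewrite !raddfB (_ : 2 * _ * _ * _ = d%:R * C * 4 ^+ d * enorm v * weight x +
  d%:R * C * 4 ^+ d * enorm v * weight x); last by ring.
exact: lerD.
Qed.

Lemma schwartz_continuous f : schwartz f -> ccontinuous f.
Proof.
move=> sf x e e0; have [L L0 hL] := schwartz_lipschitz sf.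
exists (Num.min 1 (e / (L + 1))).
  by rewrite lt_min ltr01 divr_gt0// ltr_wpDl.
move=> y; rewrite lt_min => /andP[h1 h2].
have L1 : 0 < L + 1 by rewrite ltr_wpDl.
have := hL x (y - x); rewrite [x + (y - x)]addrC subrK enormBC => /(_ (ltW h1)) h.
rewrite normcBC; apply: le_lt_trans h _.
apply: (@le_lt_trans _ _ ((L + 1) * enorm (x - y))).
  rewrite -[leRHS]mulr1 ler_pM ?weight_ge0 ?weight_le1//.
    by rewrite mulr_ge0// enorm_ge0.
  by rewrite ler_wpM2r ?enorm_ge0// lerDl.
by rewrite mulrC -ltr_pdivlMr.
Qed.

Lemma schwartz_cmeasurable f : schwartz f -> cmeasurable f.
Proof. by move=> sf; exact/ccontinuous_measurable/schwartz_continuous. Qed.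

Lemma partial_sub f g i x : cdifferentiable f -> cdifferentiable g ->
  partial i (fun x => f x - g x) x = partial i f x - partial i g x.
Proof.
move=> df dg; rewrite /partial; apply/eqP; rewrite eq_complex /=.
have [fr fi] := df x; have [gr gi] := dg x.
apply/andP; split; apply/eqP.
- rewrite (_ : (fun y => _) = (fun y => complex.Re (f y)) - (fun y => complex.Re (g y))).
    by apply: deriveB; exact: diff_derivable.
  by apply/funext => y; rewrite raddfB.
- rewrite (_ : (fun y => _) = (fun y => complex.Im (f y)) - (fun y => complex.Im (g y))).
    by apply: deriveB; exact: diff_derivable.
  by apply/funext => y; rewrite raddfB.
Qed.

Lemma partials_sub s f g : schwartz f -> schwartz g ->
  partials s (fun x => f x - g x) = (fun x => partials s f x - partials s g x).
Proof.
move=> sf sg; elim: s => [//|i s IH].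
rewrite /= -/(partials s _) IH; apply/funext => x.
by apply: partial_sub; apply: schwartz_differentiable; exact: schwartz_partials.
Qed.

Lemma schwartz_sub f g : schwartz f -> schwartz g -> schwartz (fun x => f x - g x).
Proof.
move=> sf sg; split=> [s x|a s].
  rewrite partials_sub//.
  have [fr fi] := schwartz_differentiable (schwartz_partials s sf) x.
  have [gr gi] := schwartz_differentiable (schwartz_partials s sg) x.
  split.
    rewrite (_ : (fun y => _) = (fun y => complex.Re (partials s f y)) \-
      (fun y => complex.Re (partials s g y))); first exact: differentiableB.
    by apply/funext => y; rewrite raddfB.
  rewrite (_ : (fun y => _) = (fun y => complex.Im (partials s f y)) \-
    (fun y => complex.Im (partials s g y))); first exact: differentiableB.
  by apply/funext => y; rewrite raddfB.
have [c hc] := schwartz_seminorm_bound a s sf.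
have [c' hc'] := schwartz_seminorm_bound a s sg.
apply: le_lt_trans (ltry (c + c')); apply: ge_ereal_sup => _ [x _ <-].
rewrite lee_fin normcMl normc_real partials_sub//.
apply: (@le_trans _ _ (`|monomial a x| * (normc (partials s f x) + normc (partials s g x)))).
  by rewrite ler_wpM2l//; apply: le_trans (normcD _ _) _; rewrite normcNE.
by rewrite mulrDr lerD.
Qed.

Lemma expi_taylor (a : R) : `|a| <= 1 -> normc (expi a - 1 - (0 +i* a)%C) <= 2 * a ^+ 2.
Proof.
move=> a1; apply: le_trans (normc_le_ReIm _) _ => /=.
have sinle (t : R) : `|sin t| <= `|t|.
  have := @derivable_lip1 _ (@sin R) _ (fun w : R => is_derive_sin w) (@cos_max R) t 0.
  by rewrite sin0 !subr0.
have mvt (f df : R -> R) : (forall x : R, is_derive x (1 : R) f (df x)) -> f 0 = 0 ->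
    exists2 c, `|c| <= `|a| & f a = df c * a.
  move=> fd f0; have cf : continuous f.
    by move=> w; apply/differentiable_continuous/derivable1_diffP; have [] := fd w.
  have [a0|/ltW a0] := leP 0 a.
    have [c] := MVT_segment a0 (fun (w : R) _ => fd w) (continuous_subspaceT cf).
    rewrite in_itv /= f0 !subr0 => /andP[c0 ca] ->; exists c => //.
    by rewrite !ger0_norm.
  have [c] := MVT_segment a0 (fun (w : R) _ => fd w) (continuous_subspaceT cf).
  rewrite in_itv /= f0 !sub0r => /andP[c0 ca] h; exists c; first by rewrite !ler0_norm// lerN2.
  by rewrite -[LHS]opprK h mulrN opprK.
have cos1 (t : R) : `|t| <= `|a| -> `|cos t - 1| <= `|a|.
  move=> ta; have := @derivable_lip1 _ (@cos R) (fun w : R => - sin w) (fun w : R => is_derive_cos w) _ t 0.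
  rewrite cos0 subr0 => h; apply: le_trans ta; apply: h => x.
  by rewrite normrN sin_max.
have [c ca hc] : exists2 c, `|c| <= `|a| & cos a - 1 = - sin c * a.
  apply: (mvt (fun w : R => cos w - 1) (fun w : R => - sin w)); last by rewrite cos0 subrr.
  move=> w; have := is_deriveB (is_derive_cos w) (is_derive_cst (1 : R) w (1 : R)).
  by rewrite subr0.
have [e ea he] : exists2 e, `|e| <= `|a| & sin a - a = (cos e - 1) * a.
  by apply: (mvt (fun w : R => sin w - w) (fun w : R => cos w - 1)); rewrite sin0 subrr.
rewrite !subr0 hc he !normrM normrN.
have h1 : `|sin c| * `|a| <= a ^+ 2.
  by rewrite -real_normK ?num_real// expr2 ler_wpM2r//; exact: le_trans (sinle c) ca.
have h2 : `|cos e - 1| * `|a| <= a ^+ 2.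
  by rewrite -real_normK ?num_real// expr2 ler_wpM2r// cos1.
lra.
Qed.

End schwartz_functions.

(** * The Fourier transform of a Schwartz function *)

Section fourier_decay.
Context {R : realType} {d : nat}.
Local Notation lam := (lebesgue_rV R d).
Implicit Types (f g : 'rV[R]_d -> R[i]) (x y k v : 'rV[R]_d) (s : seq 'I_d).

Lemma cintegrable_char_schwartz k f : schwartz f -> cintegrable lam (fun x => char k x * f x).
Proof.
move=> sf; have [C C0 h] := schwartz_decay sf.
apply: cintegrable_dom (rintegrableZ C (rintegrable_weight d)).
  by apply: cmeasurableM; [exact: cmeasurable_char|exact: schwartz_cmeasurable].
by move=> x; rewrite normcMl normc_char mul1r.
Qed.

Lemma normc_fourier_le f (C : R) k : schwartz f -> (forall x, normc (f x) <= C * weight x) ->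
  normc (fourier f k) <= 2 * (C * weight_mass d).
Proof.
move=> sf fC; rewrite fourier_char /weight_mass -RintegralZl//; last exact: rintegrable_weight.
apply: normc_cintegral_le.
- by apply: cmeasurableM; [exact: cmeasurable_char|exact: schwartz_cmeasurable].
- by move=> x; rewrite normcMl normc_char mul1r.
- exact/rintegrableZ/rintegrable_weight.
Qed.

Lemma enorm_delta (j : 'I_d) : enorm ('e_j : 'rV[R]_d) = 1.
Proof.
apply: enormE => //; rewrite expr1n /dotp (bigD1 j)//= mxE !eqxx mulr1 big1 ?addr0// => i ij.
by rewrite mxE eqxx (negbTE ij) mulr0.
Qed.

Lemma real_difference_quotient (u : 'rV[R]_d -> R) (j : 'I_d) x (t c : R) :
  (forall z, differentiable u z) -> 0 <= t <= 1 ->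
  (forall v, enorm v <= 1 -> `|'D_'e_j u (x + v) - 'D_'e_j u x| <= c * enorm v) ->
  0 <= c ->
  `|u (x + t *: 'e_j) - u x - t * 'D_'e_j u x| <= c * t ^+ 2.
Proof.
move=> du /andP[t0 t1] lip c0; have [w /andP[w0 w1] ->] := line_MVT x (t *: 'e_j) du.
have -> : 'D_(t *: 'e_j) u (x + w *: (t *: 'e_j)) = t * 'D_'e_j u (x + w *: (t *: 'e_j)).
  by rewrite !deriveE// linearZ.
rewrite -mulrBr normrM ger0_norm// expr2 mulrCA ler_wpM2l//.
have en : enorm (w *: (t *: 'e_j : 'rV[R]_d)) = w * t.
  by rewrite !enormZ enorm_delta mulr1 !ger0_norm.
have wt : w * t <= t by rewrite ler_piMl.
apply: le_trans (lip _ _) _; first by rewrite en (le_trans wt).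
by rewrite en ler_wpM2l.
Qed.

(** The difference quotients of [f] converge to its derivative at a rate that
    is uniform against [weight], so their Fourier transforms converge as well. *)
Lemma fourier_partial (j : 'I_d) f k : schwartz f ->
  fourier (partial j f) k = (0 +i* (2 * pi * k 0 j))%C * fourier f k.
Proof.
move=> sf; have sp : schwartz (partial j f) := schwartz_partials [:: j] sf.
have df := schwartz_differentiable sf.
have [L L0 hL] := schwartz_lipschitz sp.
set th := 2 * pi * k 0 j; set F := fourier f k; set G := fourier (partial j f) k.
pose delta t x := f (x + t *: 'e_j) - f x - t%:C%C * partial j f x.
have deltaE (t : R) x : 0 <= t <= 1 -> normc (delta t x) <= 2 * (L * t ^+ 2) * weight x.
  move=> t01; apply: le_trans (normc_le_ReIm _) _.
  have Lw : 0 <= L * weight x by rewrite mulr_ge0 ?weight_ge0.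
  have lipR v : enorm v <= 1 -> `|'D_'e_j (fun y => complex.Re (f y)) (x + v) -
      'D_'e_j (fun y => complex.Re (f y)) x| <= L * weight x * enorm v.
    move=> v1; rewrite mulrAC; apply: le_trans (hL x v v1).
    exact: (normc_Re (partial j f (x + v) - partial j f x)).
  have lipI v : enorm v <= 1 -> `|'D_'e_j (fun y => complex.Im (f y)) (x + v) -
      'D_'e_j (fun y => complex.Im (f y)) x| <= L * weight x * enorm v.
    move=> v1; rewrite mulrAC; apply: le_trans (hL x v v1).
    exact: (normc_Im (partial j f (x + v) - partial j f x)).
  have hR := real_difference_quotient (fun z => (df z).1) t01 lipR Lw.
  have hI := real_difference_quotient (fun z => (df z).2) t01 lipI Lw.
  rewrite (_ : 2 * _ * _ = L * weight x * t ^+ 2 + L * weight x * t ^+ 2); last by ring.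
  rewrite /delta !raddfB /=.
  by rewrite !mul0r !oppr0 !addr0; exact: lerD.
have mf := schwartz_cmeasurable sf.
have icf := cintegrable_char_schwartz (- k) sf.
have icp := cintegrable_char_schwartz (- k) sp.
have ict (t : R) : cintegrable lam (fun x => char (- k) x * f (x + t *: 'e_j)).
  have [C C0 h] := schwartz_decay sf.
  have := rintegrable_translate (t *: 'e_j) (rintegrableZ C (rintegrable_weight d)).
  apply: cintegrable_dom.
    apply: cmeasurableM; first exact: cmeasurable_char.
    exact: (cmeasurable_comp mf (measurable_translate _)).
  by move=> x; rewrite normcMl normc_char mul1r.
have shift (t : R) : cintegral lam (fun x => char (- k) x * f (x + t *: 'e_j)) =
    expi (th * t) * F.
  rewrite -(cintegral_translate (- (t *: 'e_j)) (ict t)) /F fourier_char -cintegralZ//.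
  apply: eq_cintegral => x; rewrite subrK charD.
  have -> : char (- k) (- (t *: 'e_j)) = expi (th * t).
    rewrite /char dotpNl dotpNr opprK dotpZr dotp_delta /th; congr expi; ring.
  ring.
have intd (t : R) : cintegral lam (fun x => char (- k) x * delta t x) =
    (expi (th * t) - 1) * F - t%:C%C * G.
  have := cintegrableZ t%:C%C icp => icp'.
  transitivity (cintegral lam (fun x => char (- k) x * f (x + t *: 'e_j) - char (- k) x * f x
     - t%:C%C * (char (- k) x * partial j f x))).
    by apply: eq_cintegral => x; rewrite /delta; ring.
  rewrite cintegralB//; last exact: cintegrableB.
  rewrite cintegralB// shift cintegralZ// -!fourier_char -/F -/G; ring.
have mdelta (t : R) : cmeasurable (delta t).
  apply: cmeasurableD; last first.
    rewrite (_ : (fun x => _) = fun x => (- t%:C%C) * partial j f x).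
      by apply: cmeasurableM; [exact: cmeasurable_cst|exact: schwartz_cmeasurable].
    by apply/funext => x; rewrite mulNr.
  apply: cmeasurableD; first exact: (cmeasurable_comp mf (measurable_translate _)).
  rewrite (_ : (fun x => _) = fun x => (- 1) * f x).
    by apply: cmeasurableM; [exact: cmeasurable_cst|].
  by apply/funext => x; rewrite mulN1r.
set X := G - (0 +i* th)%C * F.
pose B : R := 2 * (2 * L * weight_mass d) + 2 * th ^+ 2 * normc F.
have B0 : 0 <= B.
  apply: addr_ge0; last first.
    by apply: mulr_ge0; [apply: mulr_ge0; [|exact: sqr_ge0]|exact: normc_ge0].
  by rewrite !mulr_ge0 ?weight_mass_ge0.
(* The errors of the difference quotient and of [expi] are both quadratic in [t]. *)
have key (t : R) : 0 < t -> t <= 1 -> `|th * t| <= 1 -> normc X <= t * B.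
  move=> t0 t1 tht; rewrite -(ler_pM2l t0).
  have t01 : 0 <= t <= 1 by rewrite (ltW t0).
  have -> : t * normc X = normc ((expi (th * t) - 1 - (0 +i* (th * t))%C) * F -
      cintegral lam (fun x => char (- k) x * delta t x)).
    rewrite intd -{1}(gtr0_norm t0) -normc_real -normcMl; congr normc.
    rewrite (_ : (0 +i* (th * t))%C = t%:C%C * (0 +i* th)%C).
      by rewrite /X; ring.
    by apply/eqP; rewrite eq_complex /= !mul0r mulr0 subr0 addr0 mulrC !eqxx.
  apply: le_trans (normcD _ _) _; rewrite normcNE normcMl.
  have h1 := ler_wpM2r (normc_ge0 F) (expi_taylor tht).
  have h2 : normc (cintegral lam (fun x => char (- k) x * delta t x)) <=
      2 * (2 * (L * t ^+ 2) * weight_mass d).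
    rewrite /weight_mass -RintegralZl//; last exact: rintegrable_weight.
    apply: normc_cintegral_le.
    - by apply: cmeasurableM; [exact: cmeasurable_char|].
    - by move=> x; rewrite normcMl normc_char mul1r; exact: deltaE.
    - exact/rintegrableZ/rintegrable_weight.
  apply: le_trans (lerD h1 h2) _.
  rewrite /B le_eqVlt; apply/orP; left; apply/eqP; ring.
suff : X = 0 by move/eqP; rewrite subr_eq0 => /eqP.
apply: normc_eq0; apply/eqP; rewrite eq_le normc_ge0 andbT.
apply/ler_addgt0Pr => e e0; rewrite add0r.
have th1 : 0 < `|th| + 1 by rewrite ltr_wpDl.
have B1 : 0 < B + 1 by rewrite ltr_wpDl.
pose t := Num.min 1 (Num.min (`|th| + 1)^-1 (e / (B + 1))).
have t0 : 0 < t by rewrite !lt_min ltr01 invr_gt0 th1 divr_gt0.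
have tt1 : t <= 1 by rewrite ge_min lexx.
have tt2 : t <= (`|th| + 1)^-1 by rewrite !ge_min lexx orbT.
have tt3 : t <= e / (B + 1) by rewrite !ge_min lexx !orbT.
apply: le_trans (key t t0 tt1 _) _.
  rewrite normrM (gtr0_norm t0); apply: (@le_trans _ _ ((`|th| + 1) * (`|th| + 1)^-1)).
    by apply: ler_pM => //; [exact: ltW|rewrite lerDl].
  by rewrite divff ?lt0r_neq0.
apply: (@le_trans _ _ (t * (B + 1))); first by rewrite ler_wpM2l ?(ltW t0)// lerDl.
by rewrite -ler_pdivlMr.
Qed.

Lemma fourier_partials_nseq (j : 'I_d) m f k : schwartz f ->
  fourier (partials (nseq m j) f) k = (0 +i* (2 * pi * k 0 j))%C ^+ m * fourier f k.
Proof.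
move=> sf; elim: m => [|m IH]; first by rewrite expr0 mul1r.
rewrite /= -/(partials _ _) fourier_partial; last exact: schwartz_partials.
by rewrite IH exprS mulrA.
Qed.

(** The transform of the [d.*2]-th derivative in one coordinate is that of [f]
    times a monomial, so [weight_from_monomials] applies. *)
Lemma fourier_decay : exists2 K : R, 0 < K & forall f (C : R), schwartz f ->
  (forall x, normc (f x) <= C * weight x) ->
  (forall j x, normc (partials (nseq d.*2 j) f x) <= C * weight x) ->
  forall k, normc (fourier f k) <= K * C * weight k.
Proof.
have [K K0 hK] := @weight_from_monomials R d.
have m1 : 0 < 2 * (weight_mass d + 1) :> R by rewrite mulr_gt0// ltr_wpDl ?weight_mass_ge0.
exists (K * (2 * (weight_mass d + 1))); first exact: mulr_gt0.
move=> f C sf fC fjC k.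
have C0 := weight_bound_ge0 fC.
have up : 2 * (C * weight_mass d) <= 2 * (weight_mass d + 1) * C.
  by rewrite -mulrA ler_wpM2l// mulrC ler_wpM2r// lerDl.
rewrite -(mulrA K); apply: hK; first exact: normc_ge0.
  exact: le_trans (normc_fourier_le k sf fC) up.
move=> j; have := normc_fourier_le k (schwartz_partials (nseq d.*2 j) sf) (fjC j).
rewrite fourier_partials_nseq// normcMl normcX => h.
apply: le_trans (le_trans h up); rewrite ler_wpM2r ?normc_ge0//.
apply: lerXn2r; rewrite ?nnegrE ?normc_ge0//.
apply: le_trans (normc_Im _); rewrite /= normrM ler_peMl//.
rewrite ger0_norm ?mulr_ge0 ?pi_ge0//.
by have := pihalf_ge1 R; lra.
Qed.

Lemma schwartz_fourier_decay f : schwartz f ->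
  exists2 C, 0 <= C & forall k, normc (fourier f k) <= C * weight k.
Proof.
move=> sf; have [K K0 hK] := fourier_decay.
have [c0 c00 h0] := schwartz_decay sf.
have hc j : exists c, 0 <= c /\ forall x, normc (partials (nseq d.*2 j) f x) <= c * weight x.
  by have [c c1 h] := schwartz_decay (schwartz_partials (nseq d.*2 j) sf); exists c.
have [c h] := choice hc; pose C := c0 + \sum_j c j.
have S0 (P : pred 'I_d) : 0 <= \sum_(j | P j) c j by apply: sumr_ge0 => j _; have [] := h j.
exists (K * C); first by rewrite mulr_ge0 ?(ltW K0)// addr_ge0.
apply: hK => //.
  by move=> x; apply: le_trans (h0 x) _; rewrite ler_wpM2r ?weight_ge0// lerDl.
move=> j x; have [_ hj] := h j; apply: le_trans (hj x) _.
by rewrite ler_wpM2r ?weight_ge0// /C (bigD1 j)//= addrCA lerDl addr_ge0.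
Qed.

End fourier_decay.

(** * Balls and spheres *)

Section balls.
Context {R : realType} {d : nat}.
Local Notation lam := (lebesgue_rV R d).

Definition eball (r : R) : set 'rV[R]_d := [set x | enorm x <= r].

Lemma measurable_eball r : measurable (eball r).
Proof.
rewrite (_ : eball r = (@enorm R d) @^-1` `]-oo, r]).
  by rewrite -[X in measurable X]setTI; exact: measurable_enorm.
by apply/seteqP; split => x /=; rewrite in_itv.
Qed.

Lemma lebesgue_eball_scale r : 0 < r -> lam (eball r) = ((r ^+ d)%:E * lam (eball 1))%E.
Proof.
move=> r0; have uB : ((r^-1)%:M : 'M[R]_d) \in unitmx.
  by rewrite unitmxE det_scalar unitfE expf_neq0// invr_neq0// gt_eqF.
have := lebesgue_mulmx uB (measurable_eball 1).
rewrite det_scalar normrX normfV -exprVn invrK gtr0_norm// => <-.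
congr (lam _); apply/seteqP; split => x /=;
  by rewrite /eball /= mul_mx_scalar enormZ gtr0_norm ?invr_gt0// ler_pdivrMl// mulr1.
Qed.

(** The unit cube lies in the ball of radius [d.+1], and the unit ball in a
    cube of side two; scaling does the rest. *)
Lemma lebesgue_eball : exists2 v : R, 0 < v &
  forall r, 0 < r -> lam (eball r) = (r ^+ d * v)%:E.
Proof.
pose I := `[-1, 1]%classic : set R.
have mI : measurable (box d I) by apply: measurable_box; exact: measurable_itv.
have le2 : (lam (eball 1) <= (2 ^+ d)%:E)%E.
  rewrite -(@lebesgue_box _ d I 2); last 2 first.
  - exact: measurable_itv.
  - by rewrite lebesgue_measure_itv /= lte_fin ifT -?EFinB; [congr EFin; lra|lra].
  apply: le_measure; rewrite ?inE//; first exact: measurable_eball.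
  move=> x xb i; rewrite /I /= in_itv /= -ler_norml.
  exact: le_trans (coord_le_enorm _ _) xb.
have : (0 <= lam (eball 1))%E by exact: measure_ge0.
case E : (lam (eball 1)) le2 => [v| |] le2 v0; [|by move: le2; rewrite leye_eq|by []].
have sc r : 0 < r -> lam (eball r) = (r ^+ d * v)%:E.
  by move=> r0; rewrite lebesgue_eball_scale// E EFinM.
exists v => //.
have := sc d.+1%:R (ltr0Sn _ _) => h.
have : (lam hcube <= lam (eball d.+1%:R))%E.
  apply: le_measure; rewrite ?inE; [exact: measurable_hcube|exact: measurable_eball|].
  by move=> x /hcube_norm h1; rewrite /eball /= (le_trans h1)// ler_nat.
rewrite lebesgue_hcube h lee_fin => h1.
by rewrite -(pmulr_rgt0 v (exprn_gt0 d (ltr0Sn R d))) (lt_le_trans _ h1).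
Qed.

End balls.

Section spheres.
Context {R : realType} {d : nat}.
Variable mu : R -> probability 'rV[R]_d R.
Hypothesis unif : forall r, radii [set: 'rV[R]_d] r -> uniform_on_sphere r (mu r).
Local Notation lam := (lebesgue_rV R d).
Local Notation nu x := (mu (enorm x)).
Implicit Types (f g : 'rV[R]_d -> R[i]) (u v : 'rV[R]_d -> R) (x y z : 'rV[R]_d).

Lemma uniform_nu x : uniform_on_sphere (enorm x) (nu x).
Proof. by apply: unif; exists x. Qed.

(** The measure is carried by the sphere through [x]. *)
Lemma eq_Rintegral_sphere x u v : measurable_fun setT u -> measurable_fun setT v ->
  (forall y, enorm y = enorm x -> u y = v y) ->
  Rintegral (nu x) setT u = Rintegral (nu x) setT v.
Proof.
move=> mu' mv uv; congr fine; apply: ae_eq_integral => //; [exact/measurable_EFinP..|].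
pose S : set 'rV[R]_d := [set y | enorm y = enorm x].
have mS : measurable S.
  rewrite (_ : S = (@enorm R d) @^-1` [set enorm x])//.
  by rewrite -[X in measurable X]setTI; exact: measurable_enorm.
exists (~` S); split; first exact: measurableC.
  by have := probability_setC (nu x) mS; rewrite (uniform_nu x).1 subee.
by move=> y /= h1 h2; apply: h1 => _; rewrite uv.
Qed.

Lemma eq_cintegral_sphere x f g : cmeasurable f -> cmeasurable g ->
  (forall y, enorm y = enorm x -> f y = g y) -> cintegral (nu x) f = cintegral (nu x) g.
Proof.
move=> [fr fi] [gr gi] fg; rewrite /cintegral.
congr Complex; apply: eq_Rintegral_sphere => // y /fg; by move->.
Qed.

Lemma cintegral_cst x c : cintegral (nu x) (fun=> c) = c.
Proof. by rewrite /cintegral !Rintegral_prob_cst; case: c. Qed.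

Lemma average_radial x f : cmeasurable f -> (forall y, enorm y = enorm x -> f y = f x) ->
  cintegral (nu x) f = f x.
Proof.
move=> mf h; rewrite -[RHS](cintegral_cst x); exact: eq_cintegral_sphere.
Qed.

Lemma normc_average_le x f (a : R) : cmeasurable f ->
  (forall y, enorm y = enorm x -> normc (f y) <= a) -> normc (cintegral (nu x) f) <= 2 * a.
Proof.
move=> mf fa; have a0 : 0 <= a := le_trans (normc_ge0 _) (fa x erefl).
pose h y : R := (enorm y == enorm x)%:R.
have mh : measurable_fun setT h.
  rewrite (_ : h = \1_[set t : R | t = enorm x] \o @enorm R d).
    by apply: measurableT_comp (@measurable_enorm R d); apply: measurable_indic; exact: measurable_set1.
  apply/funext => y; rewrite /h /= indicE; congr (nat_of_bool _)%:R.
  by apply/eqP/idP => [e|/set_mem//]; exact/mem_set.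
rewrite (eq_cintegral_sphere (g := fun y => (h y)%:C%C * f y))//; last 2 first.
- by apply: cmeasurableM => //; exact: cmeasurable_real.
- by move=> y e; rewrite /h e eqxx mul1r.
apply: normc_cintegral_prob; first by apply: cmeasurableM => //; exact: cmeasurable_real.
move=> y; rewrite /h; case: eqP => [e|_]; first by rewrite mul1r fa.
by rewrite mul0r normc_0.
Qed.

Lemma average_orthogonal x (Q : 'M[R]_d) f : Q *m Q^T = 1%:M -> cintegrable (nu x) f ->
  cintegral (nu x) (fun y => f (y *m Q)) = cintegral (nu x) f.
Proof.
move=> QQ fi; rewrite -[RHS]mul1r.
apply: (cintegral_map (measurable_rVM Q) ler01) => // A mA.
by rewrite mul1e; exact: (uniform_nu x).2.
Qed.

End spheres.

(** * Averaging over spheres *)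

Section tent.
Context {R : realType} {d : nat}.
Local Notation lam := (lebesgue_rV R d).
Implicit Types (f g : 'rV[R]_d -> R[i]) (x y z : 'rV[R]_d).

Lemma lipschitz_ccontinuous f (K : R) : 0 <= K ->
  (forall x y, normc (f x - f y) <= K * enorm (x - y)) -> ccontinuous f.
Proof.
move=> K0 h x e e0; have K1 : 0 < K + 1 by rewrite ltr_wpDl.
exists (e / (K + 1)); first exact: divr_gt0.
move=> y; rewrite ltr_pdivlMr// mulrC; apply: le_lt_trans.
by apply: le_trans (h x y) _; rewrite ler_wpM2r ?enorm_ge0// lerDl.
Qed.

Lemma lipschitz2_cmeasurable (F : 'rV[R]_d * 'rV[R]_d -> R[i]) (K : R) : 0 <= K ->
  (forall p q, normc (F p - F q) <= K * (enorm (p.1 - q.1) + enorm (p.2 - q.2))) ->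
  cmeasurable F.
Proof.
move=> K0 h; have K1 : 0 < 2 * K + 1 by rewrite ltr_wpDl// mulr_ge0.
suff H p e : 0 < e -> exists2 r, 0 < r & forall q,
    enorm (p.1 - q.1) < r -> enorm (p.2 - q.2) < r -> normc (F p - F q) < e.
  split; apply: econtinuous2_measurable => p e e0; have [r r0 hr] := H p e e0; exists r => // q h1 h2;
  apply: le_lt_trans (hr q h1 h2); rewrite -raddfB; [exact: normc_Re|exact: normc_Im].
move=> e0; exists (e / (2 * K + 1)); first exact: divr_gt0.
move=> q; rewrite !ltr_pdivlMr// => h1 h2; apply: le_lt_trans (h p q) _.
have := enorm_ge0 (p.1 - q.1); have := enorm_ge0 (p.2 - q.2); move: h1 h2.
move: (enorm _) (enorm _) => a b; nra.
Qed.

Lemma cintegrable_cmeasurable disp (T : measurableType disp) (m : {measure set T -> \bar R})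
  (f : T -> R[i]) : cintegrable m f -> cmeasurable f.
Proof.
by move=> [fr fi]; split; [have := measurable_int _ fr|have := measurable_int _ fi];
  move/measurable_EFinP.
Qed.

(** The smoothing kernel. It is Lipschitz, and it commutes with orthogonal
    maps because it depends on the distance only. *)
Definition tent (e : R) x y : R := Num.max 0 (e - enorm (x - y)).

Lemma tent_ge0 e x y : 0 <= tent e x y.
Proof. by rewrite le_max lexx. Qed.

Lemma tent_le e x y : 0 <= e -> tent e x y <= e.
Proof. by move=> e0; rewrite ge_max e0 gerBl enorm_ge0. Qed.

Lemma tent_le1 e x y : 0 <= e <= 1 -> tent e x y <= 1.
Proof. by move=> /andP[e0 e1]; exact: le_trans (tent_le _ _ e0) e1. Qed.

Lemma tentC e x y : tent e x y = tent e y x.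
Proof. by rewrite /tent enormBC. Qed.

Lemma tent_lip e x y z : `|tent e x z - tent e y z| <= enorm (x - y).
Proof.
have h (s t : R) : `|Num.max 0 s - Num.max 0 t| <= `|s - t|.
  have := ler_norm (s - t); have := ler_norm (t - s); rewrite (distrC t) ler_norml.
  move: `|s - t| => N a b.
  by rewrite /Num.max; case: ltP => h1; case: ltP => h2; apply/andP; split; lra.
apply: le_trans (h _ _) _; rewrite opprB addrC addrA subrK distrC.
have := enorm_distl (x - z) (y - z).
by rewrite opprB addrA subrK.
Qed.

Lemma tent_mulmx e (Q : 'M[R]_d) x y : Q *m Q^T = 1%:M ->
  tent e (x *m Q) (y *m Q) = tent e x y.
Proof. by move=> QQ; rewrite /tent -mulmxBl enorm_orthogonal. Qed.

Lemma tent_near e x y : tent e x y != 0 -> enorm (x - y) <= e.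
Proof. by rewrite /tent /Num.max; case: ltP => [h _|]; [rewrite -subr_ge0 ltW|rewrite eqxx]. Qed.

Lemma tent_weight e x y : 0 <= e <= 1 -> tent e x y * weight y <= 4 ^+ d * weight x.
Proof.
move=> e01; have [->|h] := eqVneq (tent e x y) 0.
  by rewrite mul0r mulr_ge0 ?weight_ge0// exprn_ge0.
apply: (@le_trans _ _ (weight y)).
  by rewrite ler_piMl ?weight_ge0 ?tent_le1.
have /andP[e0 e1] := e01.
have := weight_near (le_trans (tent_near h) e1).
by rewrite expr1n (_ : 2 * (1 + 1) = 4 :> R); last lra.
Qed.

Lemma cmeasurable_tent e : cmeasurable (fun p => (tent e p.1 p.2)%:C%C).
Proof.
apply: (@lipschitz2_cmeasurable _ 1) => // p q.
rewrite (_ : (tent e p.1 p.2)%:C%C - (tent e q.1 q.2)%:C%C =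
  (tent e p.1 p.2 - tent e q.1 q.2)%:C%C); last by rewrite raddfB.
rewrite normc_real mul1r.
rewrite (_ : _ - _ = (tent e p.1 p.2 - tent e q.1 p.2) + (tent e p.2 q.1 - tent e q.2 q.1)).
  by apply: le_trans (ler_normD _ _) _; rewrite lerD// tent_lip.
by rewrite (tentC _ p.2) (tentC _ q.2) addrA subrK.
Qed.

Lemma cmeasurable_tent1 e y : cmeasurable (fun x => (tent e x y)%:C%C).
Proof. exact: (cmeasurable_comp (cmeasurable_tent e) (pair2_measurable y)). Qed.

Lemma cmeasurable_tent2 e x : cmeasurable (fun y => (tent e x y)%:C%C).
Proof. exact: (cmeasurable_comp (cmeasurable_tent e) (pair1_measurable x)). Qed.

Lemma rintegrable_tent e x : 0 <= e <= 1 -> rintegrable lam (tent e x).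
Proof.
move=> e01; apply: (rintegrable_dom (v := fun y => 4 ^+ d * (weight x)^-1 * weight y)).
- exact: (cmeasurable_tent2 e x).1.
- move=> y; rewrite ger0_norm ?tent_ge0// mulrAC ler_pdivlMr ?weight_gt0//.
  by rewrite tentC tent_weight.
- exact/rintegrableZ/rintegrable_weight.
Qed.

(** The integral is positive because the kernel is at least [e / 2] on the
    ball of radius [e / 2]. *)
Lemma tent_mass e : 0 < e <= 1 -> exists2 c : R, 0 < c &
  forall x, Rintegral lam setT (tent e x) = c.
Proof.
move=> /andP[e0 e1]; have e01 : 0 <= e <= 1 by rewrite (ltW e0).
exists (Rintegral lam setT (tent e 0)); last first.
  move=> x; rewrite -(Rintegral_translate (- x) (rintegrable_tent 0 e01)).
  congr Rintegral; apply/funext => y; rewrite /tent sub0r enormN enormBC.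
  by [].
have [v v0 hv] := @lebesgue_eball R d.
have e2 : 0 < e / 2 by rewrite divr_gt0.
have mB : measurable (eball (e / 2) : set 'rV[R]_d) by exact: measurable_eball.
have [iB EB] := Rintegral_indicator mB (hv _ e2).
have ii := rintegrableZ (e / 2) iB.
have E : Rintegral lam setT (fun x => e / 2 * \1_(eball (e / 2)) x) = e / 2 * ((e / 2) ^+ d * v).
  by rewrite RintegralZl// EB.
have p0 : 0 < e / 2 * ((e / 2) ^+ d * v) by rewrite !mulr_gt0// exprn_gt0.
apply: lt_le_trans p0 _; rewrite -E; apply: le_Rintegral => //.
  exact: rintegrable_tent.
move=> x _; rewrite indicE; case: (boolP (x \in _)) => [/set_mem xb|_].
  rewrite mulr1 le_max; apply/orP; right; rewrite sub0r enormN.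
  by move: xb; rewrite /eball /=; lra.
by rewrite mulr0 tent_ge0.
Qed.

End tent.

(** The arithmetic of the two domination estimates in
    [cintegral_average_smoothing]: one of the two factors [s] is spent to
    trade the kernel [k] for [t]. *)
Lemma kernel_bound (R : realDomainType) (C k s a b M t W : R) : 0 <= C -> 0 <= k -> 0 <= s ->
  0 <= a -> 0 <= b -> a <= C * s ^+ 2 -> b <= W -> k * s <= M * t ->
  k * a * b <= M * W * t * (C * s).
Proof.
move=> C0 k0 s0 a0 b0 aC bW kM; have W0 := le_trans b0 bW.
apply: (@le_trans _ _ (k * (C * s ^+ 2) * W)); first by rewrite !ler_pM ?mulr_ge0.
rewrite (_ : k * _ * W = k * s * (C * s * W)); last by ring.
rewrite (_ : M * _ * _ * _ = M * t * (C * s * W)); last by ring.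
by rewrite ler_wpM2r// !mulr_ge0.
Qed.

Section averaging.
Context {R : realType} {d : nat}.
Variable mu : R -> probability 'rV[R]_d R.
Hypothesis unif : forall r, radii [set: 'rV[R]_d] r -> uniform_on_sphere r (mu r).
Local Notation lam := (lebesgue_rV R d).
Local Notation nu x := (mu (enorm x)).
Implicit Types (f g : 'rV[R]_d -> R[i]) (x y z : 'rV[R]_d).

Definition radial f := forall x y, enorm x = enorm y -> f x = f y.

Lemma weight_radial x y : enorm x = enorm y -> weight x = weight y :> R.
Proof. by rewrite /weight => ->. Qed.

Section fixed_kernel.
Variable e : R.
Hypothesis e01 : 0 < e <= 1.
Let e01' : 0 <= e <= 1.
Proof. by move: e01 => /andP[/ltW -> ->]. Qed.

Local Notation K x y := ((tent e x y)%:C%C).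

Definition kappa x z : R[i] := cintegral (nu x) (fun x' => K x' z).

Lemma normc_K x y : normc (K x y) = tent e x y.
Proof. by rewrite normc_real ger0_norm ?tent_ge0. Qed.

Lemma cintegrable_K x z : cintegrable (nu x) (fun x' => K x' z).
Proof.
apply: (@cintegrable_prob _ _ _ _ _ 1); first exact: cmeasurable_tent1.
by move=> y; rewrite normc_K tent_le1.
Qed.

Lemma kappa_lip x z z' : normc (kappa x z - kappa x z') <= 2 * enorm (z - z').
Proof.
rewrite -cintegralB; [|exact: cintegrable_K..].
apply: normc_cintegral_prob.
  exact: cintegrable_cmeasurable (cintegrableB (cintegrable_K x z) (cintegrable_K x z')).
move=> y; rewrite (_ : K y z - K y z' = (tent e y z - tent e y z')%:C%C); last by rewrite raddfB.
by rewrite normc_real tentC (tentC e y z') tent_lip.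
Qed.

Lemma kappa_mulmx x z (Q : 'M[R]_d) : Q *m Q^T = 1%:M -> kappa x (z *m Q) = kappa x z.
Proof.
move=> QQ; rewrite /kappa -(average_orthogonal unif QQ (cintegrable_K x _)).
by apply: eq_cintegral => y; rewrite tent_mulmx.
Qed.

Lemma ccontinuous_kappa x : ccontinuous (kappa x).
Proof. by apply: (@lipschitz_ccontinuous _ _ _ 2) => // y z; exact: kappa_lip. Qed.

(** Averaging the distance kernel over one sphere is the same as averaging it
    over the other one, since the average over both spheres is symmetric. *)
Lemma kappaC x z : kappa x z = kappa z x.
Proof.
have rad u v w : enorm v = enorm w -> kappa u v = kappa u w.
  by move=> /orthogonal_transitive[Q QQ <-]; rewrite kappa_mulmx.
rewrite -(average_radial unif (ccontinuous_measurable (ccontinuous_kappa x))); last first.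
  by move=> y; exact: rad.
rewrite -(average_radial unif (ccontinuous_measurable (ccontinuous_kappa z))); last first.
  by move=> y; exact: rad.
have ui := rintegrable_cst (nu x) 1; have vi := rintegrable_cst (nu z) 1.
have := @cintegral_fubini _ _ _ _ _ (nu x) (nu z) _ _ ui vi (fun p => K p.1 p.2)
  (cmeasurable_tent e).
move=> <-; last by move=> u v; rewrite normc_K mulr1 tent_le1.
  by apply: eq_cintegral => u; rewrite /kappa; apply: eq_cintegral => v; rewrite tentC.
Qed.

Lemma cmeasurable_kappa : cmeasurable (fun p => kappa p.1 p.2).
Proof.
apply: (@lipschitz2_cmeasurable _ _ _ 2) => // p q.
rewrite (_ : _ - _ = (kappa p.1 p.2 - kappa p.1 q.2) + (kappa q.2 p.1 - kappa q.2 q.1)).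
  apply: le_trans (normcD _ _) _; rewrite mulrDr addrC lerD//; exact: kappa_lip.
by rewrite (kappaC q.2) (kappaC q.2 q.1) addrA subrK.
Qed.

Lemma kappa_weight x z : normc (kappa x z) * weight z <= 2 * 4 ^+ d * weight x.
Proof.
have wz := weight_ge0 z; rewrite -[weight z]ger0_norm// -normc_real -normcMl mulrC.
rewrite -cintegralZ; last exact: cintegrable_K.
rewrite -mulrA; apply: (normc_average_le unif).
  apply: cmeasurableM; [exact: cmeasurable_cst|exact: cmeasurable_tent1].
move=> y yx; rewrite normcMl normc_real ger0_norm// normc_K mulrC -(weight_radial yx).
exact: tent_weight.
Qed.

Variables (f w : 'rV[R]_d -> R[i]) (C W : R).
Hypotheses (mf : cmeasurable f) (fC : forall x, normc (f x) <= C * weight x).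
Hypotheses (mw : cmeasurable w) (wW : forall x, normc (w x) <= W) (rw : radial w).

Let C0 : 0 <= C := weight_bound_ge0 fC.

Let W0 : 0 <= W. Proof. exact: le_trans (normc_ge0 _) (wW 0). Qed.

Definition smoothing x := cintegral lam (fun z => K x z * f z).

Let iCw : rintegrable lam (fun x => C * weight x).
Proof. exact/rintegrableZ/rintegrable_weight. Qed.

Lemma cintegrable_Kf x : cintegrable lam (fun z => K x z * f z).
Proof.
apply: cintegrable_dom iCw; first by apply: cmeasurableM => //; exact: cmeasurable_tent2.
move=> z; rewrite normcMl normc_K; apply: le_trans (fC z).
by rewrite ler_piMl ?normc_ge0// tent_le1.
Qed.

Lemma smoothing_lip x y :
  normc (smoothing x - smoothing y) <= 2 * (C * weight_mass d) * enorm (x - y).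
Proof.
rewrite -cintegralB; [|exact: cintegrable_Kf..].
have i1 : rintegrable lam (fun z => enorm (x - y) * (C * weight z)) by exact: rintegrableZ.
apply: le_trans (normc_cintegral_le _ _ i1) _.
- exact: cintegrable_cmeasurable (cintegrableB (cintegrable_Kf x) (cintegrable_Kf y)).
- move=> z; rewrite -mulrBl normcMl (_ : K x z - K y z = (tent e x z - tent e y z)%:C%C).
    by rewrite normc_real ler_pM ?normc_ge0// tent_lip.
  by rewrite raddfB.
- rewrite RintegralZl// RintegralZl//; last exact: rintegrable_weight.
  by rewrite -/(weight_mass d) le_eqVlt; apply/orP; left; apply/eqP; ring.
Qed.

Let mass_ge0 : 0 <= 2 * (C * weight_mass d).
Proof. by rewrite !mulr_ge0// weight_mass_ge0. Qed.

Lemma smoothing_cmeasurable : cmeasurable smoothing.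
Proof. exact/ccontinuous_measurable/(lipschitz_ccontinuous mass_ge0)/smoothing_lip. Qed.

Lemma cintegrable_kappaf x : cintegrable lam (fun z => kappa x z * f z).
Proof.
apply: cintegrable_dom (rintegrableZ 2 iCw).
  by apply: cmeasurableM => //; exact/ccontinuous_measurable/ccontinuous_kappa.
move=> z; rewrite normcMl ler_pM ?normc_ge0//.
rewrite -[leRHS]mulr1; apply: normc_cintegral_prob; first exact: cmeasurable_tent1.
by move=> y; rewrite normc_K tent_le1.
Qed.

Lemma average_smoothing x :
  cintegral (nu x) smoothing = cintegral lam (fun z => kappa x z * f z).
Proof.
have ui := rintegrable_cst (nu x) 1.
have := @cintegral_fubini _ _ _ _ _ (nu x) lam _ _ ui iCw (fun p => K p.1 p.2 * f p.2).
move=> ->.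
- apply: eq_cintegral => z; rewrite /kappa mulrC -cintegralZ; last exact: cintegrable_K.
  by apply: eq_cintegral => y; rewrite mulrC.
- apply: cmeasurableM; first exact: cmeasurable_tent.
  exact: (cmeasurable_comp mf measurable_snd).
- move=> y z; rewrite normcMl normc_K mul1r; apply: le_trans (fC z).
  by rewrite ler_piMl ?normc_ge0// tent_le1.
Qed.

Lemma average_smoothing_lip x y :
  normc (cintegral (nu x) smoothing - cintegral (nu y) smoothing) <=
  4 * (C * weight_mass d) * enorm (x - y).
Proof.
rewrite !average_smoothing -cintegralB; [|exact: cintegrable_kappaf..].
have i1 : rintegrable lam (fun z => 2 * enorm (x - y) * (C * weight z)) by exact: rintegrableZ.
apply: le_trans (normc_cintegral_le _ _ i1) _.
- exact: cintegrable_cmeasurable (cintegrableB (cintegrable_kappaf x) (cintegrable_kappaf y)).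
- move=> z; rewrite -mulrBl normcMl ler_pM ?normc_ge0//.
  by rewrite kappaC (kappaC y) kappa_lip.
- rewrite RintegralZl// RintegralZl//; last exact: rintegrable_weight.
  by rewrite -/(weight_mass d) le_eqVlt; apply/orP; left; apply/eqP; ring.
Qed.

Definition radial_mass z := cintegral lam (fun x => K z x * w x).

Lemma cintegrable_Kw z : cintegrable lam (fun x => K z x * w x).
Proof.
apply: cintegrable_dom (rintegrableZ W (rintegrable_tent z e01')).
  by apply: cmeasurableM => //; exact: cmeasurable_tent2.
by move=> x; rewrite normcMl normc_K mulrC ler_wpM2r// tent_ge0.
Qed.

Lemma radial_mass_radial : radial radial_mass.
Proof.
move=> x y /orthogonal_transitive[Q QQ <-].
have [uQ dQ] := det_orthogonal QQ.
rewrite /radial_mass -[RHS]mul1r.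
have := cintegral_mulmx uQ (cintegrable_Kw (x *m Q)); rewrite dQ invr1 => <-.
apply: eq_cintegral => z; rewrite tent_mulmx//; congr (_ * _).
by apply: rw; rewrite enorm_orthogonal.
Qed.

Lemma cintegrable_kappaw z : cintegrable lam (fun x => kappa x z * w x).
Proof.
apply: cintegrable_dom (rintegrableZ (2 * 4 ^+ d * (weight z)^-1 * W) (rintegrable_weight d)).
  exact: (cmeasurableM (cmeasurable_comp cmeasurable_kappa (pair2_measurable z)) mw).
move=> x; rewrite normcMl (mulrAC _ W); apply: ler_pM; rewrite ?normc_ge0//.
rewrite -(ler_pM2r (weight_gt0 z)); apply: le_trans (kappa_weight x z) _.
by rewrite (mulrAC _ (weight z)^-1) mulfVK ?gt_eqF ?weight_gt0.
Qed.

(** By symmetry [kappa] may be read as an average in [z], and the integral of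
    the kernel against [w] is already radial in [z]. The factor [weight] in
    the proof makes the double integral absolutely convergent. *)
Lemma kappa_radial_mass z :
  cintegral lam (fun x => kappa x z * w x) = radial_mass z.
Proof.
have iWw : rintegrable lam (fun x => W * weight x) by exact/rintegrableZ/rintegrable_weight.
have ui := rintegrable_cst (nu z) (4 ^+ d).
pose F (p : 'rV[R]_d * 'rV[R]_d) := (weight p.1)%:C%C * (K p.1 p.2 * w p.2).
have mwt : cmeasurable (fun x : 'rV[R]_d => (weight x)%:C%C).
  by apply: cmeasurable_real; exact: measurable_weight.
have mF : cmeasurable F.
  apply: cmeasurableM; first exact: (cmeasurable_comp mwt measurable_fst).
  apply: cmeasurableM; first exact: cmeasurable_tent.
  exact: (cmeasurable_comp mw measurable_snd).
have FW u v : normc (F (u, v)) <= 4 ^+ d * (W * weight v).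
  rewrite /F /= !normcMl normc_K normc_real ger0_norm ?weight_ge0// mulrA.
  rewrite (mulrC W) mulrA ler_pM ?normc_ge0//; first by rewrite mulr_ge0 ?tent_ge0 ?weight_ge0.
  by rewrite mulrC tentC tent_weight.
have swap := cintegral_fubini ui iWw mF FW.
have m1 : cmeasurable (fun x => cintegral lam (fun y => F (x, y))).
  exact: cintegrable_cmeasurable (cintegrable_fubini1 ui iWw mF FW).
have E x : cintegral lam (fun y => F (x, y)) = (weight x)%:C%C * radial_mass x.
  by rewrite /F /= cintegralZ//; exact: cintegrable_Kw.
have E2 x : cintegral (nu z) (fun y => F (y, x)) = (weight z)%:C%C * (kappa x z * w x).
  rewrite (kappaC x z) (_ : _ * (_ * w x) = (weight z)%:C%C * w x * kappa z x); last by ring.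
  rewrite /kappa -cintegralZ; last exact: cintegrable_K.
  apply: (eq_cintegral_sphere unif).
  - exact: (cmeasurable_comp mF (pair2_measurable x)).
  - by apply: cmeasurableM; [exact: cmeasurable_cst|exact: cmeasurable_tent1].
  - by move=> y yz; rewrite /F /= (weight_radial yz); ring.
have wz : (weight z)%:C%C != 0 :> R[i].
  by rewrite (inj_eq (@complexI R)) gt_eqF// weight_gt0.
apply: (mulfI wz); rewrite -E -(average_radial unif m1); last first.
  by move=> y yz; rewrite !E (weight_radial yz) (radial_mass_radial yz).
rewrite swap -cintegralZ.
  by apply: eq_cintegral => x; rewrite E2.
exact: cintegrable_kappaw.
Qed.

Hypothesis fC2 : forall x, normc (f x) <= C * weight x ^+ 2.

(** Smoothing by the kernel makes the double integral absolutely convergent, so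
    the average can be moved from [f] to the kernel and disappears against the
    radial function [w]. *)
Lemma cintegral_average_smoothing :
  cintegral lam (fun x => cintegral (nu x) smoothing * w x) =
  cintegral lam (fun x => smoothing x * w x).
Proof.
have iu (c : R) : rintegrable lam (fun x => c * weight x) by exact/rintegrableZ/rintegrable_weight.
have mf2 : cmeasurable (fun p : 'rV[R]_d * 'rV[R]_d => f p.2).
  exact: (cmeasurable_comp mf measurable_snd).
have mw1 : cmeasurable (fun p : 'rV[R]_d * 'rV[R]_d => w p.1).
  exact: (cmeasurable_comp mw measurable_fst).
have swap1 := cintegral_fubini (iu (2 * 4 ^+ d * W)) iCw
  (F := fun p => kappa p.1 p.2 * f p.2 * w p.1).
have swap2 := cintegral_fubini (iu (4 ^+ d * W)) iCw
  (F := fun p => K p.1 p.2 * f p.2 * w p.1).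
transitivity (cintegral lam (fun z => cintegral lam (fun x => kappa x z * f z * w x))).
  rewrite -swap1.
  - apply: eq_cintegral => x; rewrite average_smoothing mulrC -cintegralZ.
      by apply: eq_cintegral => z /=; rewrite mulrC.
    exact: cintegrable_kappaf.
  - exact: (cmeasurableM (cmeasurableM cmeasurable_kappa mf2) mw1).
  - move=> x z; rewrite -[leLHS]/(normc (kappa x z * f z * w x)) !normcMl.
    by apply: (kernel_bound C0 _ (weight_ge0 z) _ _ (fC2 z) (wW x) (kappa_weight x z));
      exact: normc_ge0.
transitivity (cintegral lam (fun z => f z * radial_mass z)).
  apply: eq_cintegral => z; rewrite -kappa_radial_mass -cintegralZ.
    by apply: eq_cintegral => x; ring.
  exact: cintegrable_kappaw.
transitivity (cintegral lam (fun z => cintegral lam (fun x => K x z * f z * w x))).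
  apply: eq_cintegral => z; rewrite -cintegralZ; last exact: cintegrable_Kw.
  by apply: eq_cintegral => x; rewrite tentC; ring.
rewrite -swap2.
- apply: eq_cintegral => x; rewrite mulrC -cintegralZ.
    by apply: eq_cintegral => z /=; rewrite mulrC.
  exact: cintegrable_Kf.
- exact: (cmeasurableM (cmeasurableM (cmeasurable_tent e) mf2) mw1).
- move=> x z; rewrite -[leLHS]/(normc (K x z * f z * w x)) !normcMl normc_K.
  apply: (kernel_bound C0 _ (weight_ge0 z) _ _ (fC2 z) (wW x) (tent_weight x z e01'));
    by [exact: tent_ge0|exact: normc_ge0].
Qed.

End fixed_kernel.

End averaging.

Section average.
Context {R : realType} {d : nat}.
Variable mu : R -> probability 'rV[R]_d R.
Hypothesis unif : forall r, radii [set: 'rV[R]_d] r -> uniform_on_sphere r (mu r).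
Local Notation lam := (lebesgue_rV R d).
Local Notation nu x := (mu (enorm x)).
Implicit Types (f g w : 'rV[R]_d -> R[i]) (x y z : 'rV[R]_d).

Definition average f x := cintegral (nu x) f.

Lemma average_is_radial f : radial (average f).
Proof. by move=> x y; rewrite /average => ->. Qed.

Lemma average_decay f C : cmeasurable f -> (forall x, normc (f x) <= C * weight x) ->
  forall x, normc (average f x) <= 2 * C * weight x.
Proof.
move=> mf fC x; rewrite -mulrA; apply: (normc_average_le unif mf) => y yx.
by rewrite -(weight_radial yx).
Qed.

Lemma cintegrable_average f C x : cmeasurable f -> 0 <= C ->
  (forall x, normc (f x) <= C * weight x) -> cintegrable (nu x) f.
Proof.
move=> mf C0 fC; apply: (@cintegrable_prob _ _ _ (nu x) f C mf) => y.
by apply: le_trans (fC y) _; rewrite ler_piMr// weight_le1.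
Qed.

Section approximation.
Variables (f : 'rV[R]_d -> R[i]) (C L : R).
Hypotheses (mf : cmeasurable f) (C0 : 0 <= C) (L0 : 0 <= L).
Hypothesis fC : forall x, normc (f x) <= C * weight x.
Hypothesis fL : forall x v, enorm v <= 1 -> normc (f (x + v) - f x) <= L * enorm v * weight x.

Lemma smoothing_approx e c x : 0 < e <= 1 -> (forall x, Rintegral lam setT (tent e x) = c) ->
  normc (smoothing e f x - c%:C%C * f x) <= 2 * (L * e * c) * weight x.
Proof.
move=> e01 hc; have /andP[e0 e1] := e01; have e01' : 0 <= e <= 1 by rewrite (ltW e0).
have it := rintegrable_tent x e01'.
have iK : cintegrable lam (fun y => (tent e x y)%:C%C).
  apply: (cintegrable_dom _ _ it); first exact: cmeasurable_tent2.
  by move=> y; rewrite normc_K.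
have -> : c%:C%C * f x = cintegral lam (fun y => f x * (tent e x y)%:C%C).
  rewrite cintegralZ// mulrC; congr (_ * _); rewrite /cintegral -(hc x).
  by rewrite /= /Rintegral integral0.
rewrite -cintegralB; [|exact: (cintegrable_Kf e01 mf fC)|exact: cintegrableZ].
have ib : rintegrable lam (fun y => L * e * weight x * tent e x y) by exact: rintegrableZ.
apply: le_trans (normc_cintegral_le _ _ ib) _.
- apply: cintegrable_cmeasurable (cintegrableB _ (cintegrableZ _ iK)).
  exact: (cintegrable_Kf e01 mf fC).
- move=> y; rewrite (mulrC (f x)) -mulrBr normcMl normc_K mulrC.
  have [->|nt] := eqVneq (tent e x y) 0; first by rewrite !mulr0.
  rewrite ler_wpM2r ?tent_ge0//; have xy := tent_near nt.
  have yx : enorm (y - x) <= e by rewrite enormBC.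
  have := fL x (le_trans yx e1); rewrite (addrC x) subrK => h; apply: le_trans h _.
  by rewrite ler_wpM2r ?weight_ge0// ler_wpM2l.
- rewrite RintegralZl// hc le_eqVlt; apply/orP; left; apply/eqP; ring.
Qed.

Lemma average_approx e c x : 0 < e <= 1 -> (forall x, Rintegral lam setT (tent e x) = c) ->
  normc (cintegral (nu x) (smoothing e f) - c%:C%C * average f x) <=
  4 * (L * e * c) * weight x.
Proof.
move=> e01 hc; have ms := smoothing_cmeasurable e01 mf fC.
have iS : cintegrable (nu x) (smoothing e f).
  apply: (@cintegrable_prob _ _ _ (nu x) _ (2 * (C * weight_mass d)) ms) => y.
  apply: le_trans (normc_cintegral_le _ _ (rintegrableZ C (rintegrable_weight d))) _.
  - exact: cintegrable_cmeasurable (cintegrable_Kf e01 mf fC y).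
  - move=> z; rewrite normcMl normc_K; apply: le_trans (fC z).
    by rewrite ler_piMl ?normc_ge0// tent_le1// (ltW (andP e01).1) (andP e01).2.
  - by rewrite RintegralZl//; exact: rintegrable_weight.
have iA := cintegrable_average x mf C0 fC.
rewrite /average -cintegralZ// -cintegralB//; last exact: cintegrableZ.
rewrite (_ : 4 * _ * _ = 2 * (2 * (L * e * c) * weight x)); last by ring.
apply: (normc_average_le unif).
  exact: cintegrable_cmeasurable (cintegrableB iS (cintegrableZ _ iA)).
move=> y yx; rewrite -(weight_radial yx); exact: smoothing_approx.
Qed.

(** The average is a uniform limit of the averages of the smoothed functions,
    which inherit the Lipschitz continuity of the kernel. *)
Lemma average_continuous : ccontinuous (average f).
Proof.
(* Two errors of [average_approx], each at most [e / 3], and a Lipschitz term at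
   most [e / 4]. *)
move=> x e e0; pose L1 := 12 * (L + 1).
have L10 : 0 < L1 by rewrite mulr_gt0// ltr_wpDl.
pose s := Num.min 1 (e / L1).
have s0 : 0 < s by rewrite lt_min ltr01 divr_gt0.
have s01 : 0 < s <= 1 by rewrite s0 ge_min lexx.
have sL : 12 * (L * s) <= e.
  have : s <= e / L1 by rewrite ge_min lexx orbT.
  by rewrite ler_pdivlMr// /L1 => h; move: (ltW s0) h; lra.
have [c c0 hc] := @tent_mass R d s s01.
pose K := 4 * (C * weight_mass d) + 1.
have K0 : 0 < K by rewrite ltr_wpDl// !mulr_ge0// weight_mass_ge0.
exists (c * e / (4 * K)); first by rewrite divr_gt0 ?mulr_gt0.
move=> y; rewrite ltr_pdivlMr ?mulr_gt0// => xy.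
rewrite -(ltr_pM2l c0) -{1}(ger0_norm (ltW c0)) -normc_real -normcMl mulrBr.
have hx := average_approx x s01 hc; have hy := average_approx y s01 hc.
have hl := average_smoothing_lip unif s01 mf fC x y.
move: hx hy hl; set X := cintegral _ _; set Y := cintegral (nu y) _.
set ax := c%:C%C * _; set ay := c%:C%C * _ => hx hy hl.
have -> : ax - ay = - (X - ax) + (X - Y) + (Y - ay).
  by ring.
apply: le_lt_trans (normcD _ _) _.
apply: le_lt_trans (lerD (normcD _ _) (lexx _)) _; rewrite normcNE.
have w1 z (t : R) : 0 <= t -> t * weight z <= t by move=> t0; rewrite ler_piMr// weight_le1.
have Lc : 0 <= 4 * (L * s * c) by rewrite !mulr_ge0// ltW.
have hx' := le_trans hx (w1 x _ Lc); have hy' := le_trans hy (w1 y _ Lc).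
have hl' : normc (X - Y) <= c * e / 4.
  apply: le_trans hl _; rewrite ler_pdivlMr//; apply: le_trans (ltW xy).
  by rewrite /K; have := enorm_ge0 (x - y); nra.
have cs : c * (12 * (L * s)) <= c * e by rewrite ler_pM2l.
apply: le_lt_trans (lerD (lerD hx' hl') hy') _.
have : 0 < c * e by exact: mulr_gt0.
move: cs; lra.
Qed.

Hypothesis fC2 : forall x, normc (f x) <= C * weight x ^+ 2.

(** The identity is exact for the smoothed functions, and smoothing costs an
    error proportional to the radius of the kernel, uniformly against
    [weight]. *)
Lemma average_pairing w W : cmeasurable w -> (forall x, normc (w x) <= W) -> radial w ->
  cintegral lam (fun x => average f x * w x) = cintegral lam (fun x => f x * w x).
Proof.
move=> mw wW rw; have W0 : 0 <= W := le_trans (normc_ge0 _) (wW 0).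
have mA := ccontinuous_measurable average_continuous.
have bnd g (c : R) : cmeasurable g -> (forall x, normc (g x) <= c * weight x) ->
    cintegrable lam (fun x => g x * w x) /\
    normc (cintegral lam (fun x => g x * w x)) <= 2 * (c * W * weight_mass d).
  move=> mg gc; have mgw := cmeasurableM mg mw.
  have i1 := rintegrableZ (c * W) (rintegrable_weight d).
  have le1 x : normc (g x * w x) <= c * W * weight x.
    by rewrite normcMl mulrAC ler_pM ?normc_ge0.
  split; first exact: cintegrable_dom mgw le1 i1.
  apply: le_trans (normc_cintegral_le mgw le1 i1) _.
  by rewrite RintegralZl//; exact: rintegrable_weight.
have iA := (bnd _ _ mA (average_decay mf fC)).1; have iF := (bnd _ _ mf fC).1.
apply/eqP; rewrite -subr_eq0; apply/eqP/normc_eq0/eqP; rewrite eq_le normc_ge0 andbT.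
apply/ler_addgt0Pr => e e0; rewrite add0r.
pose B := 12 * (L * W * weight_mass d) + 1.
have B0 : 0 < B by rewrite ltr_wpDl// !mulr_ge0// weight_mass_ge0.
pose s := Num.min 1 (e / B).
have s0 : 0 < s by rewrite lt_min ltr01 divr_gt0.
have s01 : 0 < s <= 1 by rewrite s0 ge_min lexx.
have sB : s * B <= e by rewrite -ler_pdivlMr// ge_min lexx orbT.
have [c c0 hc] := @tent_mass R d s s01.
pose S := smoothing s f; pose AS x := cintegral (nu x) S.
have mS : cmeasurable S := smoothing_cmeasurable s01 mf fC.
have mAS : cmeasurable AS.
  apply/ccontinuous_measurable/(@lipschitz_ccontinuous _ _ _ (4 * (C * weight_mass d))).
    by rewrite !mulr_ge0// weight_mass_ge0.
  exact: (average_smoothing_lip unif s01 mf fC).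
have mcst g : cmeasurable g -> cmeasurable (fun x => c%:C%C * g x).
  by move=> mg; apply: cmeasurableM mg; exact: cmeasurable_cst.
have mdiff g h : cmeasurable g -> cmeasurable h -> cmeasurable (fun x => g x - c%:C%C * h x).
  move=> mg mh; have := cmeasurableD mg (cmeasurableM (cmeasurable_cst (- c%:C%C)) mh).
  by under eq_fun do rewrite mulNr.
have [i1 h1] := bnd _ _ (mdiff _ _ mAS mA) (fun x => average_approx x s01 hc).
have [i2 h2] := bnd _ _ (mdiff _ _ mS mf) (fun x => smoothing_approx x s01 hc).
have key := cintegral_average_smoothing unif s01 mf fC mw wW rw fC2.
rewrite -(ler_pM2l c0) -{1}(ger0_norm (ltW c0)) -normc_real -normcMl mulrBr.
have icA : cintegrable lam (fun x => c%:C%C * (average f x * w x)) by exact: cintegrableZ.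
have icF : cintegrable lam (fun x => c%:C%C * (f x * w x)) by exact: cintegrableZ.
have iAS : cintegrable lam (fun x => AS x * w x).
  have := cintegrableD i1 icA; congr cintegrable; apply/funext => x.
  by rewrite mulrBl mulrA subrK.
have iS : cintegrable lam (fun x => S x * w x).
  have := cintegrableD i2 icF; congr cintegrable; apply/funext => x.
  by rewrite mulrBl mulrA subrK.
have e1 : cintegral lam (fun x => (AS x - c%:C%C * average f x) * w x) =
    cintegral lam (fun x => AS x * w x) - c%:C%C * cintegral lam (fun x => average f x * w x).
  rewrite -cintegralZ; last exact: iA.
  rewrite -cintegralB; [|exact: iAS|exact: icA].
  by apply: eq_cintegral => x; rewrite mulrBl mulrA.
have e2 : cintegral lam (fun x => (S x - c%:C%C * f x) * w x) =
    cintegral lam (fun x => S x * w x) - c%:C%C * cintegral lam (fun x => f x * w x).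
  rewrite -cintegralZ; last exact: iF.
  rewrite -cintegralB; [|exact: iS|exact: icF].
  by apply: eq_cintegral => x; rewrite mulrBl mulrA.
rewrite e1 in h1; rewrite e2 in h2; rewrite -/S -/AS in key.
rewrite (_ : _ - _ = (cintegral lam (fun x => S x * w x) -
   c%:C%C * cintegral lam (fun x => f x * w x)) - (cintegral lam (fun x => AS x * w x) -
   c%:C%C * cintegral lam (fun x => average f x * w x))); last first.
  by rewrite key; ring.
apply: le_trans (normcD _ _) _; rewrite normcNE; apply: le_trans (lerD h2 h1) _.
apply: (@le_trans _ _ (c * (s * B))); last by rewrite ler_pM2l.
have : 0 <= c * s := mulr_ge0 (ltW c0) (ltW s0).
by rewrite /B; lra.
Qed.

End approximation.

End average.

Section fourier_average.
Context {R : realType} {d : nat}.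
Variable mu : R -> probability 'rV[R]_d R.
Hypothesis unif : forall r, radii [set: 'rV[R]_d] r -> uniform_on_sphere r (mu r).
Local Notation lam := (lebesgue_rV R d).
Local Notation nu x := (mu (enorm x)).
Implicit Types (f g w : 'rV[R]_d -> R[i]) (x y z k : 'rV[R]_d).

(** The bound [weight_from_monomials] for the square root of [normc f]. *)
Lemma schwartz_decay_sqr f : schwartz f ->
  exists2 C, 0 <= C & forall x, normc (f x) <= C * weight x ^+ 2.
Proof.
move=> sf; have [K K0 hK] := @weight_from_monomials R d.
have [c0 h0] := schwartz_seminorm_bound (fun=> 0%N) [::] sf.
have hc (j : 'I_d) : exists c, forall x, `|x 0 j| ^+ d.*2 ^+ 2 * normc (f x) <= c.
  have [c h] := schwartz_seminorm_bound (fun i => if i == j then (d.*2 * 2)%N else 0%N) [::] sf.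
  exists c => x; have := h x; rewrite /monomial (bigD1 j)//= eqxx big1.
    by rewrite mulr1 normrX exprM.
  by move=> i /negbTE ->; rewrite expr0.
have [c hcj] := choice hc.
have {}h0 x : normc (f x) <= c0 by have := h0 x; rewrite /monomial big1// normr1 mul1r.
have c00 : 0 <= c0 := le_trans (normc_ge0 _) (h0 0).
have cj0 j : 0 <= c j by apply: le_trans (hcj j 0); rewrite mulr_ge0 ?normc_ge0// exprn_ge0// exprn_ge0.
pose M := c0 + \sum_j c j; have M0 : 0 <= M by rewrite addr_ge0// sumr_ge0.
exists ((K * Num.sqrt M) ^+ 2); first exact: sqr_ge0.
move=> x; rewrite -[normc (f x)]sqr_sqrtr ?normc_ge0// -exprMn.
apply: lerXn2r; rewrite ?nnegrE ?sqrtr_ge0//.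
  by rewrite mulr_ge0 ?weight_ge0// mulr_ge0 ?sqrtr_ge0// ltW.
apply: hK; first exact: sqrtr_ge0.
  rewrite ler_sqrt//; apply: le_trans (h0 x) _.
  by rewrite lerDl sumr_ge0.
move=> j; rewrite -[X in X * _]ger0_norm ?exprn_ge0// -sqrtr_sqr -sqrtrM ?sqr_ge0//.
rewrite ler_sqrt//; apply: le_trans (hcj j x) _.
by rewrite /M (bigD1 j)//= addrCA lerDl addr_ge0// sumr_ge0.
Qed.

Lemma measurable_dotp2 disp (T : measurableType disp) (a b : T -> 'rV[R]_d) :
  measurable_fun setT a -> measurable_fun setT b -> measurable_fun setT (fun t => dotp (a t) (b t)).
Proof.
move=> ma mb; apply: measurable_sum => i; apply: measurable_funM.
- exact: (measurableT_comp (measurable_rV_coord i) ma).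
- exact: (measurableT_comp (measurable_rV_coord i) mb).
Qed.

Lemma cmeasurable_char2 disp (T : measurableType disp) (a b : T -> 'rV[R]_d) :
  measurable_fun setT a -> measurable_fun setT b -> cmeasurable (fun t => char (- a t) (b t)).
Proof.
move=> ma mb; apply: cmeasurable_expi; apply: measurable_funM => //.
apply: measurable_dotp2 => //.
rewrite (_ : (fun _ => _) = fun t => (-1) *: a t); first exact: measurable_rVZ.
by apply/funext => t; rewrite scaleN1r.
Qed.

(** Fubini's theorem yields measurability of integrable functions only; a
    bounded function becomes integrable when it is multiplied by [weight]. *)
Lemma cmeasurable_unweight f : cmeasurable (fun x => (weight x)%:C%C * f x) -> cmeasurable f.
Proof.
move=> mwf; have mi : cmeasurable (fun x : 'rV[R]_d => ((weight x)^-1)%:C%C).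
  apply: cmeasurable_real; rewrite (_ : (fun _ => _) = fun x => (1 + enorm x ^+ 2) ^+ d).
    apply: measurable_funX; apply: measurable_funD => //.
    by apply: measurable_funX; exact: measurable_enorm.
  by apply/funext => x; rewrite /weight exprVn invrK.
have := cmeasurableM mi mwf; congr cmeasurable; apply/funext => x.
by rewrite mulrA -rmorphM /= mulVf ?mul1r// gt_eqF// weight_gt0.
Qed.

Section decaying.
Variables (g : 'rV[R]_d -> R[i]) (C : R).
Hypotheses (mg : cmeasurable g) (gC : forall x, normc (g x) <= C * weight x).

Let iC : rintegrable lam (fun x => C * weight x).
Proof. exact/rintegrableZ/rintegrable_weight. Qed.

Lemma fourier_cmeasurable : cmeasurable (fourier g).
Proof.
apply: cmeasurable_unweight.
have mF : cmeasurable (fun p : 'rV[R]_d * 'rV[R]_d =>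
    (weight p.1)%:C%C * (char (- p.1) p.2 * g p.2)).
  apply: cmeasurableM.
    apply: (cmeasurable_comp (f := fun x => (weight x)%:C%C) _ measurable_fst).
    by apply: cmeasurable_real; exact: measurable_weight.
  apply: cmeasurableM; first exact: cmeasurable_char2 measurable_fst measurable_snd.
  exact: (cmeasurable_comp mg measurable_snd).
have Fle u v : normc ((weight u)%:C%C * (char (- u) v * g v)) <= weight u * (C * weight v).
  rewrite !normcMl normc_char mul1r normc_real ger0_norm ?weight_ge0//.
  by rewrite ler_wpM2l ?weight_ge0.
have := cintegrable_cmeasurable (cintegrable_fubini1 (rintegrable_weight d) iC mF Fle).
congr cmeasurable; apply/funext => k /=; rewrite fourier_char cintegralZ//.
apply: cintegrable_dom iC; first exact: cmeasurableM (cmeasurable_char _) mg.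
by move=> x; rewrite normcMl normc_char mul1r.
Qed.

Lemma cintegrable_char_decaying k : cintegrable lam (fun x => char (- k) x * g x).
Proof.
apply: cintegrable_dom iC; first exact: cmeasurableM (cmeasurable_char _) mg.
by move=> x; rewrite normcMl normc_char mul1r.
Qed.

Lemma fourier_radial : radial g -> radial (fourier g).
Proof.
move=> rg x y /orthogonal_transitive[Q QQ <-]; rewrite !fourier_char -[RHS]mul1r.
have [uQ dQ] := det_orthogonal QQ.
have := cintegral_mulmx uQ (cintegrable_char_decaying (x *m Q)); rewrite dQ invr1 => <-.
apply: eq_cintegral => z; rewrite -(rg z (z *m Q)) ?enorm_orthogonal//; congr (_ * _).
by rewrite /char -mulNmx dotp_mulmxl -mulmxA QQ mulmx1.
Qed.

End decaying.

Section fourier_sphere.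
Variable x : 'rV[R]_d.
Local Notation w := (fourier_measure (nu x)).

Lemma fourier_measure_char y : w y = cintegral (nu x) (fun k => char (- k) y).
Proof. by apply: eq_cintegral => k; rewrite /char dotpNl mulrN dotpC. Qed.

Lemma cintegrable_char_sphere y : cintegrable (nu x) (fun k => char (- k) y).
Proof.
apply: (@cintegrable_prob _ _ _ _ _ 1); last by move=> k; rewrite normc_char.
exact: cmeasurable_char2.
Qed.

Lemma fourier_measure_le y : normc (w y) <= 2.
Proof.
rewrite -[leRHS]mulr1 fourier_measure_char; apply: normc_cintegral_prob.
  exact: cmeasurable_char2.
by move=> k; rewrite normc_char.
Qed.

Lemma fourier_measure_radial : radial w.
Proof.
move=> y z /orthogonal_transitive[Q QQ <-]; rewrite !fourier_measure_char.
rewrite -(average_orthogonal unif QQ (cintegrable_char_sphere (y *m Q))).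
by apply: eq_cintegral => k; rewrite /char -mulNmx dotp_mulmxl -mulmxA QQ mulmx1.
Qed.

Lemma fourier_measure_cmeasurable : cmeasurable w.
Proof.
apply: cmeasurable_unweight.
have mF : cmeasurable (fun p : 'rV[R]_d * 'rV[R]_d => (weight p.1)%:C%C * char (- p.2) p.1).
  apply: cmeasurableM.
    apply: (cmeasurable_comp (f := fun x => (weight x)%:C%C) _ measurable_fst).
    by apply: cmeasurable_real; exact: measurable_weight.
  exact: cmeasurable_char2 measurable_snd measurable_fst.
have Fle (u v : 'rV[R]_d) : normc ((weight u)%:C%C * char (- v) u) <= weight u * 1.
  by rewrite normcMl normc_char normc_real ger0_norm ?weight_ge0.
have := cintegrable_cmeasurable
  (cintegrable_fubini1 (rintegrable_weight d) (rintegrable_cst (nu x) 1) mF Fle).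
congr cmeasurable; apply/funext => y /=; rewrite fourier_measure_char cintegralZ//.
exact: cintegrable_char_sphere.
Qed.

Lemma average_fourier g C : cmeasurable g -> (forall x, normc (g x) <= C * weight x) ->
  cintegral (nu x) (fourier g) = cintegral lam (fun y => w y * g y).
Proof.
move=> mg gC.
have iC : rintegrable lam (fun x => C * weight x) by exact/rintegrableZ/rintegrable_weight.
transitivity (cintegral (nu x) (fun k => cintegral lam (fun y => char (- k) y * g y))).
  by apply: eq_cintegral => k; rewrite fourier_char.
rewrite (cintegral_fubini (rintegrable_cst (nu x) 1) iC
  (F := fun p => char (- p.1) p.2 * g p.2)).
- apply: eq_cintegral => y /=; rewrite fourier_measure_char [RHS]mulrC -cintegralZ.
    by apply: eq_cintegral => k; rewrite mulrC.
  exact: cintegrable_char_sphere.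
- apply: cmeasurableM; first exact: cmeasurable_char2 measurable_fst measurable_snd.
  exact: (cmeasurable_comp mg measurable_snd).
- by move=> k y; rewrite normcMl normc_char !mul1r.
Qed.

End fourier_sphere.

(** The Fourier transform of the uniform measure on a sphere is radial, so [f] may
    be replaced by its average when it is integrated against it. *)
Lemma fourier_averageE f x : schwartz f -> fourier (average mu f) x = average mu (fourier f) x.
Proof.
move=> sf; have [C C0 fC2] := schwartz_decay_sqr sf.
have fC y : normc (f y) <= C * weight y.
  apply: le_trans (fC2 y) _; rewrite ler_wpM2l// expr2.
  by rewrite ler_piMl ?weight_ge0// weight_le1.
have [L L0 fL] := schwartz_lipschitz sf.
have mf := schwartz_cmeasurable sf.
have mA := ccontinuous_measurable (average_continuous unif mf C0 L0 fC fL).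
have AC := average_decay unif mf fC.
have mw := fourier_measure_cmeasurable x.
rewrite {2}/average (average_fourier x mf fC).
transitivity (cintegral lam (fun y => fourier_measure (nu x) y * average mu f y)); last first.
  transitivity (cintegral lam (fun y => average mu f y * fourier_measure (nu x) y)).
    by apply: eq_cintegral => y; rewrite mulrC.
  rewrite (average_pairing unif mf C0 L0 fC fL fC2 mw (fourier_measure_le x)
    (fourier_measure_radial x)).
  by apply: eq_cintegral => y; rewrite mulrC.
rewrite -(average_fourier x mA AC); apply/esym/(average_radial unif).
  exact: fourier_cmeasurable mA AC.
by move=> y; apply: fourier_radial mA AC _ _ _; exact: average_is_radial.
Qed.

End fourier_average.

(** * Lattices *)

Section lattice_basis.
Context {R : realType} {d : nat}.
Local Notation lam := (lebesgue_rV R d).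
Implicit Types (f g : 'rV[R]_d -> R[i]) (x y z k : 'rV[R]_d) (B M : 'M[R]_d).

(** The points whose image under [M] is an integer vector; a lattice with basis
    matrix [B] is [pullback (invmx B)] and its dual is [pullback B^T]. *)
Definition pullback M : set 'rV[R]_d := [set x | Zd (x *m M)].

Lemma full_lattice_pullback G : full_lattice G ->
  exists2 B : 'M[R]_d, B \in unitmx & G = pullback (invmx B).
Proof.
move=> [B fB ->]; have uB : B \in unitmx by rewrite -row_free_unit.
exists B => //; apply/seteqP; split => x /=.
  move=> [n ->]; have -> : \sum_i row i B *~ n i = (\row_i (n i)%:~R) *m B.
    by rewrite mulmx_sum_row; apply: eq_bigr => i _; rewrite mxE scaler_int.
  by rewrite /pullback /= mulmxK// => i; rewrite mxE intr_int.
move=> h; have /choice[n hn] : forall i, exists n : int, (x *m invmx B) 0 i = n%:~R.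
  by move=> i; have /intrP[n ->] := h i; exists n.
exists n; rewrite -[LHS](mulmxKV uB) mulmx_sum_row; apply: eq_bigr => i _.
by rewrite hn scaler_int.
Qed.

Lemma dual_lattice_pullback B : B \in unitmx ->
  dual_lattice (pullback (invmx B)) = pullback B^T.
Proof.
move=> uB; apply/seteqP; split => y /= h.
  move=> i; rewrite -dotp_delta dotp_mulmxl trmxK; apply: h.
  rewrite /pullback /= mulmxK// => j; rewrite mxE.
  by case: (_ && _); [exact: rpred1|exact: rpred0].
move=> x xG; rewrite -(mulmxKV uB x) -[B in _ *m B]trmxK -dotp_mulmxl.
exact: dotp_int.
Qed.

Lemma mulmx_inj M : M \in unitmx -> injective (fun x : 'rV[R]_d => x *m M).
Proof. by move=> uM; apply: (can_inj (g := fun x => x *m invmx M)) => x; rewrite mulmxK. Qed.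

Lemma mem_pullback M x : (x \in pullback M) = (x *m M \in Zd).
Proof. by apply/idP/idP => /set_mem h; exact/mem_set. Qed.

Lemma sum_le_weight_pullback M : M \in unitmx ->
  exists C : R, sum_le (weight \_ (pullback M)) C.
Proof.
move=> uM; have [c c0 hc] := weight_mulmx M.
exists (c * (cubeK R d * weight_mass d)).
apply: le_sum_le (sum_leZ (ltW c0) (sum_le_inj (mulmx_inj uM) (@sum_le_weight_Zd R d))) => x; rewrite !patchE mem_pullback; case: ifP => _.
  by rewrite weight_ge0 hc.
by rewrite mulr0 lexx.
Qed.

(** On a ball [weight] is bounded below, and its sum over the lattice is
    finite. *)
Lemma finite_pullback_ball M (r : R) : M \in unitmx ->
  finite_set (pullback M `&` eball r).
Proof.
move=> uM; have [C [w0 hC]] := sum_le_weight_pullback uM.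
apply: contrapT => /(infinite_set_fset (Num.truncn (C * (1 + r ^+ 2) ^+ d)).+1)[A AG].
apply/negP; rewrite -ltnNge ltnS.
have q0 : 0 < (1 + r ^+ 2) ^+ d by rewrite exprn_gt0// ltr_pwDl// sqr_ge0.
have C0 : 0 <= C := sum_le_ge0 (conj w0 hC).
rewrite truncn_ge_nat ?mulr_ge0 ?(ltW q0)//.
rewrite -ler_pdivrMr//; apply: le_trans (hC A).
rewrite (_ : _ / _ = \sum_(x <- A) ((1 + r ^+ 2) ^+ d)^-1); last first.
  by rewrite big_const_seq count_predT iter_addr_0 mulr_natl.
rewrite big_seq [leRHS]big_seq; apply: ler_sum => x xA; have [xG xr] := AG x xA.
rewrite patchE mem_set// /weight exprVn lef_pV2 ?posrE ?exprn_gt0 ?weight_den_gt0 ?ltr_pwDl ?sqr_ge0//.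
apply: lerXn2r; rewrite ?nnegrE ?addr_ge0 ?sqr_ge0//.
rewrite lerD2l; apply: lerXn2r; rewrite ?nnegrE ?enorm_ge0//.
exact: le_trans (enorm_ge0 _) xr.
Qed.

Lemma finite_pullback_sphere M (r : R) : M \in unitmx ->
  finite_set (pullback M `&` [set x | enorm x = r]).
Proof.
move=> uM; apply: sub_finite_set (finite_pullback_ball r uM) => x [xM xr]; split => //.
by rewrite /eball /= xr.
Qed.

Lemma ccontinuous_mulmx g M : ccontinuous g -> ccontinuous (fun x => g (x *m M)).
Proof.
move=> cg x e /(cg (x *m M))[r r0 hr]; have [c c0 hc] := enorm_mulmx M.
exists (r / c); first exact: divr_gt0.
move=> y; rewrite ltr_pdivlMr// mulrC => h; apply: hr.
by rewrite -mulmxBl; apply: le_lt_trans h; exact: hc.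
Qed.

Lemma fourier_mulmx g B k : B \in unitmx -> cintegrable lam (fun x => char (- (k *m B)) x * g x) ->
  fourier (fun x => g (x *m invmx B^T)) k = `|\det B|%:C%C * fourier g (k *m B).
Proof.
move=> uB ig; have uBT : invmx B^T \in unitmx by rewrite unitmx_inv unitmx_tr.
rewrite !fourier_char; have := cintegral_mulmx uBT ig.
rewrite det_inv det_tr normfV invrK => <-; apply: eq_cintegral => x.
congr (_ * _); rewrite /char -mulNmx dotp_mulmxl -mulmxA mulVmx ?unitmx_tr//.
by rewrite mulmx1.
Qed.

Lemma hasum_pullback M f s : M \in unitmx ->
  hasum (onset Zd f) s -> hasum (onset (pullback M) (fun x => f (x *m M))) s.
Proof.
move=> uM Fs; have := hasum_bij (mulmxK uM) (mulmxKV uM) Fs.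
by apply: eq_hasum => x; rewrite /onset mem_pullback.
Qed.

(** Poisson summation for a lattice, transported from the integer lattice by a
    linear change of variables. *)
Lemma poisson_lattice B g C C' : B \in unitmx -> ccontinuous g ->
  (forall x, normc (g x) <= C * weight x) ->
  (forall k, normc (fourier g k) <= C' * weight k) ->
  exists2 s, hasum (onset (pullback B^T) g) s &
  hasum (onset (pullback (invmx B)) (fourier g)) ((`|\det B|^-1)%:C%C * s).
Proof.
move=> uB cg gC hC.
have mg := ccontinuous_measurable cg.
have uBT : B^T \in unitmx by rewrite unitmx_tr.
have C0 := weight_bound_ge0 gC; have C'0 := weight_bound_ge0 hC.
have D0 : 0 < `|\det B| by rewrite normr_gt0 -unitfE -unitmxE.
pose h x := g (x *m invmx B^T).
have hE k : fourier h k = `|\det B|%:C%C * fourier g (k *m B).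
  by apply: fourier_mulmx => //; exact: (cintegrable_char_decaying mg gC).
have [c1 c10 hc1] := weight_mulmx B^T.
have [c2 c20 hc2] := weight_mulmx (invmx B).
have hdec x : normc (h x) <= C * c1 * weight x.
  apply: le_trans (gC _) _; rewrite -mulrA ler_wpM2l//.
  by have := hc1 (x *m invmx B^T); rewrite mulmxKV.
have hhat k : normc (fourier h k) <= `|\det B| * (C' * c2) * weight k.
  rewrite hE normcMl normc_real normr_id -mulrA ler_wpM2l//.
  apply: le_trans (hC _) _; rewrite -mulrA ler_wpM2l//.
  by have := hc2 (k *m B); rewrite mulmxK.
have [s h1 h2] := poisson_Zd (ccontinuous_mulmx (invmx B^T) cg) hdec hhat.
exists s.
  have := hasum_pullback uBT h1; apply: eq_hasum => x.
  by rewrite /onset /h mulmxK.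
have uBi : invmx B \in unitmx by rewrite unitmx_inv.
have := hasumZ (`|\det B|^-1)%:C%C (hasum_pullback uBi h2).
apply: eq_hasum => x; rewrite /onset; case: ifP => _; last by rewrite mulr0.
by rewrite hE mulmxKV// mulrA -rmorphM /= mulVf ?mul1r// gt_eqF.
Qed.

End lattice_basis.

(** * The density of a lattice *)

Section density.
Context {R : realType} {d : nat}.
Local Notation lam := (lebesgue_rV R d).
Implicit Types (x y z k : 'rV[R]_d) (r t : R).

Lemma expr1D_le t n : 0 <= t <= 1 -> (1 + t) ^+ n <= 1 + 2 ^+ n * t.
Proof.
move=> /andP[t0 t1]; suff : (1 + t) ^+ n <= 1 + (2 ^+ n - 1) * t.
  by move=> h; apply: le_trans h _; rewrite lerD2l ler_wpM2r// gerBl.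
elim: n => [|n IH]; first by rewrite !expr0 subrr mul0r addr0.
have c1 : 1 <= 2 ^+ n :> R by rewrite exprn_ege1// ler1n.
rewrite !exprS; apply: (@le_trans _ _ ((1 + t) * (1 + (2 ^+ n - 1) * t))).
  by rewrite ler_wpM2l// addr_ge0.
have : 0 <= (2 ^+ n - 1) * t * (1 - t) by rewrite !mulr_ge0// subr_ge0.
by move: (2 ^+ n) => c; lra.
Qed.

Lemma expr1B_ge t n : 0 <= t <= 1 -> 1 - 2 ^+ n * t <= (1 - t) ^+ n.
Proof.
move=> t01; apply: le_trans (bernoulli_le n t01); rewrite lerD2l lerN2 ler_wpM2r//.
  by case/andP: t01.
by rewrite -natrX ler_nat ltnW// ltn_expl.
Qed.

Variable B : 'M[R]_d.
Hypothesis uB : B \in unitmx.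
Local Notation G := (pullback (invmx B)).
Local Notation N r := #|` fset_set (G `&` eball r)|.

Let D0 : 0 < `|\det B|. Proof. by rewrite normr_gt0 -unitfE -unitmxE. Qed.

Lemma Rintegral_eball_mulmx v r : 0 < r -> lam (eball r) = (r ^+ d * v)%:E ->
  rintegrable lam (fun x => \1_(eball r) (x *m B)) /\
  Rintegral lam setT (fun x => \1_(eball r) (x *m B)) = `|\det B|^-1 * (r ^+ d * v).
Proof.
move=> r0 hv; have mB := @measurable_eball R d r.
have [ii EB] := Rintegral_indicator mB hv.
have c0 : 0 <= `|\det B|^-1 by rewrite invr_ge0.
have mE A : measurable A -> _ := @lebesgue_mulmx R d B A uB.
split; first exact: (rintegrable_map (measurable_rVM B) c0 mE ii).
by rewrite (Rintegral_map (measurable_rVM B) c0 mE ii) EB.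
Qed.

(** Each lattice point contributes the unit volume of a cube of coordinates;
    [nearest y *m B] is the lattice point whose cell contains [y *m B]. *)
Lemma Rintegral_lattice_cells r :
  Rintegral lam setT (fun y => (enorm (nearest y *m B) <= r)%R%:R) = (N r)%:R /\
  rintegrable lam (fun y => (enorm (nearest y *m B) <= r)%R%:R).
Proof.
have uBi : invmx B \in unitmx by rewrite unitmx_inv.
have fG := finite_pullback_ball r uBi.
pose A := fset_set (G `&` eball r).
have AP n : n \in A -> G n /\ enorm n <= r by rewrite /A in_fset_set// => /set_mem.
have iF n := rintegrable_hcube (n *m invmx B).
have [sE iS] := Rintegral_sum A iF.
have E y : \sum_(n <- A) \1_hcube (y - n *m invmx B) = (enorm (nearest y *m B) <= r)%R%:R :> R.
  transitivity (\sum_(n <- A) (n == nearest y *m B)%:R : R).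
    rewrite !big_seq; apply: eq_bigr => n /AP[Gn _].
    rewrite indic_hcube//; congr (nat_of_bool _)%:R.
    by apply/eqP/eqP => [<-|->]; rewrite ?mulmxKV ?mulmxK.
  have nA : (nearest y *m B \in A) = (enorm (nearest y *m B) <= r).
    rewrite /A in_fset_set//; apply/idP/idP => [/set_mem[]//|h].
    by apply/mem_set; split => //; rewrite /pullback /= mulmxK//; exact: Zd_nearest.
  rewrite -nA; case: (boolP (nearest y *m B \in A)) => yA.
    rewrite (big_fsetD1 _ yA) /= eqxx big1_fset ?addr0// => n.
    by rewrite !inE => /andP[/negbTE ->].
  by rewrite big1_fset// => n nA' _; case: eqP nA' yA => // -> ->.
have E' : (fun y => \sum_(n <- A) \1_hcube (y - n *m invmx B) : R) =
    (fun y => (enorm (nearest y *m B) <= r)%R%:R) by apply/funext.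
rewrite E' in sE iS; split => //; rewrite -sE.
rewrite (eq_bigr (fun=> 1)) ?big_const_seq ?count_predT ?iter_addr_0// => n _.
by rewrite (Rintegral_translate (u := \1_hcube) _ rintegrable_indic_hcube) Rintegral_indic_hcube.
Qed.

(** The cells have bounded diameter, so the union of the cells of the points
    in a ball lies between two concentric balls. *)
Lemma lattice_count : exists2 b : R, 0 <= b &
  forall v r, (forall r, 0 < r -> lam (eball r) = (r ^+ d * v)%:E) -> b < r ->
  `|\det B|^-1 * ((r - b) ^+ d * v) <= (N r)%:R <= `|\det B|^-1 * ((r + b) ^+ d * v).
Proof.
have [c c0 hc] := enorm_mulmx B; pose b := c * d%:R; exists b; first by rewrite mulr_ge0// ltW.
move=> v r hv br; have b0 : 0 <= b by rewrite mulr_ge0// ltW.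
have rb0 : 0 < r - b by rewrite subr_gt0.
have rb1 : 0 < r + b by rewrite ltr_wpDr// (le_lt_trans b0).
have [<- iN] := Rintegral_lattice_cells r.
have [i1 <-] := Rintegral_eball_mulmx rb0 (hv _ rb0).
have [i2 <-] := Rintegral_eball_mulmx rb1 (hv _ rb1).
have near y : enorm (y *m B - nearest y *m B) <= b.
  rewrite -mulmxBl; apply: le_trans (hc _) _; rewrite ler_wpM2l ?(ltW c0)//.
  by apply: hcube_norm; apply/nearestE => //; exact: Zd_nearest.
apply/andP; split; apply: le_Rintegral => // y _; rewrite indicE.
- case: (boolP (_ \in _)) => [/set_mem h|_]; last by rewrite ler0n.
  suff -> : enorm (nearest y *m B) <= r by [].
  have := enorm_distl (nearest y *m B) (y *m B).
  by move: (near y) h; rewrite enormBC ler_norml /eball /= => h1 h2 /andP[_ h3]; lra.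
- case: (boolP (_ \in _)) => [_|h]; first by case: (enorm _ <= r); rewrite ?lexx ?ler01.
  suff /negbTE -> : ~~ (enorm (nearest y *m B) <= r) by [].
  apply/negP => h2; move/negP: h; apply.
  apply/mem_set; rewrite /eball /=; have := enorm_distl (y *m B) (nearest y *m B).
  by move: (near y) h2; rewrite ler_norml => h1 h2 /andP[_ h3]; lra.
Qed.

Lemma dens_pullback : dens G = `|\det B|^-1.
Proof.
apply: cvg_lim => //=; have [v v0 hv] := @lebesgue_eball R d.
have [b b0 hN] := lattice_count.
pose D := `|\det B|^-1; have D1 : 0 < D by rewrite invr_gt0.
pose q : R := 2 ^+ d * D * b; have q0 : 0 <= q by rewrite !mulr_ge0// ltW.
apply/cvgrPdist_le => e e0; near=> r.
have r0 : 0 < r by near: r; apply: nbhs_pinfty_gt; exact: num_real.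
have rb : b < r by near: r; apply: nbhs_pinfty_gt; exact: num_real.
have rq : q / e <= r by near: r; apply: nbhs_pinfty_ge; exact: num_real.
have /andP[h1 h2] := hN v r hv rb.
rewrite -/(eball r) [X in fine X](hv _ r0) /=.
set n : R := (N r)%:R in h1 h2 *.
have t01 : 0 <= b / r <= 1 by rewrite divr_ge0 ?(ltW r0)// ler_pdivrMr// mul1r ltW.
have P0 : 0 < r ^+ d * v by rewrite mulr_gt0// exprn_gt0.
have E1 : (r + b) ^+ d = (1 + b / r) ^+ d * r ^+ d.
  by rewrite -exprMn mulrDl mul1r divfK// gt_eqF.
have E2 : (r - b) ^+ d = (1 - b / r) ^+ d * r ^+ d.
  by rewrite -exprMn mulrBl mul1r divfK// gt_eqF.
have u1 : n / (r ^+ d * v) <= D * (1 + 2 ^+ d * (b / r)).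
  rewrite ler_pdivrMr//; apply: le_trans h2 _; rewrite E1 -/D -!mulrA ler_wpM2l ?(ltW D1)//.
  by rewrite !mulrA -!mulrA ler_wpM2r ?(ltW P0)//; have := expr1D_le d t01; rewrite mulrA.
have u2 : D * (1 - 2 ^+ d * (b / r)) <= n / (r ^+ d * v).
  rewrite ler_pdivlMr//; apply: le_trans h1; rewrite E2 -/D -!mulrA ler_wpM2l ?(ltW D1)//.
  by rewrite !mulrA -!mulrA ler_wpM2r ?(ltW P0)//; have := expr1B_ge d t01; rewrite mulrA.
have le_e : D * (2 ^+ d * (b / r)) <= e.
  rewrite (_ : D * _ = q / r); last by rewrite /q; ring.
  by rewrite ler_pdivrMr// mulrC -ler_pdivrMr.
rewrite -/D ler_norml; move: u1 u2 le_e; rewrite mulrDr mulrBr mulr1.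
by move=> a1 a2 a3; apply/andP; split; lra.
Unshelve. all: by end_near.
Qed.

End density.

(** * Sums of spherical means over lattices *)

Section functionals.
Context {R : realType} {d : nat}.
Local Notation lam := (lebesgue_rV R d).
Implicit Types (T : functional R d) (f g h : 'rV[R]_d -> R[i]) (x y k : 'rV[R]_d).

Definition decaying f := cmeasurable f /\ exists C, forall x, normc (f x) <= C * weight x.

Lemma decaying_schwartz f : schwartz f -> decaying f.
Proof.
by move=> sf; split; [exact: schwartz_cmeasurable|have [C _ h] := schwartz_decay sf; exists C].
Qed.

Lemma decaying_fourier f : schwartz f -> decaying (fourier f).
Proof.
move=> sf; have [C _ h] := schwartz_decay sf; split.
  exact: fourier_cmeasurable (schwartz_cmeasurable sf) h.
by have [C' _ h'] := schwartz_fourier_decay sf; exists C'.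
Qed.

Lemma decaying_lin c f g : decaying f -> decaying g -> decaying (fun x => c * f x + g x).
Proof.
move=> [mf [C hC]] [mg [D hD]]; split.
  by apply: cmeasurableD => //; apply: cmeasurableM => //; exact: cmeasurable_cst.
exists (normc c * C + D) => x; apply: le_trans (normcD _ _) _.
by rewrite normcMl mulrDl -mulrA lerD// ler_wpM2l ?normc_ge0.
Qed.

Lemma fourier_lin c f g : decaying f -> decaying g ->
  fourier (fun x => c * f x + g x) = (fun k => c * fourier f k + fourier g k).
Proof.
move=> [mf [C hC]] [mg [D hD]]; apply/funext => k; rewrite !fourier_char.
have i1 := cintegrable_char_decaying mf hC k; have i2 := cintegrable_char_decaying mg hD k.
rewrite -cintegralZ// -cintegralD//; last exact: cintegrableZ.
by apply: eq_cintegral => x; rewrite mulrDr mulrCA.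
Qed.

Definition decay_linear T := forall c f g, decaying f -> decaying g ->
  T (fun x => c * f x + g x) = c * T f + T g.

Definition decay_bounded T := exists2 A : R, 0 <= A & forall h C, cmeasurable h ->
  (forall x, normc (h x) <= C * weight x) -> normc (T h) <= A * C.

(** By linearity continuity need only be checked at zero, where
    [order_le_decay] turns small seminorms into small multiples of [weight]. *)
Lemma seminorm_bounded_tempered T :
  (forall c f g, schwartz f -> schwartz g -> T (fun x => c * f x + g x) = c * T f + T g) ->
  (exists2 A : R, 0 <= A & forall h C, schwartz h -> (forall x, normc (h x) <= C * weight x) ->
    (forall j x, normc (partials (nseq d.*2 j) h x) <= C * weight x) -> normc (T h) <= A * C) ->
  tempered T.
Proof.
move=> linT [A A0 hA]; split => // f sf e e0.
have [K K0 hK] := @order_le_decay R d.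
have AK : 0 < A * K + 1 by rewrite ltr_wpDl// mulr_ge0// ltW.
exists (d.*2 + d.*2)%N; exists (e / (2 * (A * K + 1))); first by rewrite divr_gt0 ?mulr_gt0.
set delta := e / _ => g sg near.
have sh := schwartz_sub sg sf.
have ol : order_le (d.*2 + d.*2) delta (fun x => g x - f x).
  by move=> a s aN sN; apply: schwartz_seminorm_ub; apply: ltW; exact: near.
have -> : T g - T f = T (fun x => g x - f x).
  rewrite (_ : (fun x => g x - f x) = (fun x => -1 * f x + g x)); last first.
    by apply/funext => x; rewrite mulN1r addrC.
  by rewrite linT// mulN1r addrC.
apply: le_lt_trans (hA _ (K * delta) sh _ _) _.
- exact: (hK _ [::] _ ol).
- by move=> j x; apply: (hK _ _ _ ol); rewrite size_nseq.
have d0 : 0 < delta by rewrite divr_gt0 ?mulr_gt0.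
rewrite mulrA; apply: (@lt_le_trans _ _ (2 * (A * K + 1) * delta)).
  by rewrite ltr_pM2r//; move: AK; lra.
by rewrite /delta mulrC divfK// gt_eqF// mulr_gt0.
Qed.

Lemma decay_tempered T : decay_linear T -> decay_bounded T -> tempered T.
Proof.
move=> linT [A A0 hA]; apply: seminorm_bounded_tempered.
  by move=> c f g sf sg; apply: linT; exact: decaying_schwartz.
by exists A => // h C sh hC _; apply: hA => //; exact: schwartz_cmeasurable.
Qed.

Lemma decay_fourier_tempered T : decay_linear T -> decay_bounded T ->
  tempered (fourier_distribution T).
Proof.
move=> linT [A A0 hA]; apply: seminorm_bounded_tempered.
  move=> c f g sf sg; rewrite /fourier_distribution fourier_lin; [|exact: decaying_schwartz..].
  by apply: linT; exact: decaying_fourier.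
have [K K0 hK] := @fourier_decay R d.
exists (A * K); first by rewrite mulr_ge0// ltW.
move=> h C sh hC hP; rewrite -mulrA; apply: hA; last exact: hK.
exact: fourier_cmeasurable (schwartz_cmeasurable sh) hC.
Qed.

Lemma eq_tempered T T' : (forall f, decaying f -> T f = T' f) -> tempered T -> tempered T'.
Proof.
move=> TT [linT cT]; split.
  move=> c f g sf sg; have df := decaying_schwartz sf; have dg := decaying_schwartz sg.
  by rewrite -!TT//; [exact: linT|exact: decaying_lin].
move=> f sf e e0; have [N [dl d0 h]] := cT f sf e e0; exists N, dl => // g sg near.
by rewrite -!TT; [exact: h|exact: decaying_schwartz..].
Qed.

End functionals.

Section spherical_sums.
Context {R : realType} {d : nat}.
Variable mu : R -> probability 'rV[R]_d R.
Hypothesis unif : forall r, radii [set: 'rV[R]_d] r -> uniform_on_sphere r (mu r).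
Local Notation lam := (lebesgue_rV R d).
Local Notation nu x := (mu (enorm x)).
Implicit Types (f g h : 'rV[R]_d -> R[i]) (x y k : 'rV[R]_d) (M : 'M[R]_d).

Lemma average_lin c f g x : decaying f -> decaying g ->
  average mu (fun x => c * f x + g x) x = c * average mu f x + average mu g x.
Proof.
have int h : decaying h -> cintegrable (nu x) h.
  by move=> [mh [C hC]]; exact: cintegrable_average mh (weight_bound_ge0 hC) hC.
move=> /int i1 /int i2; rewrite /average cintegralD ?cintegralZ//.
exact: cintegrableZ.
Qed.

Lemma average_functional (c : R[i]) x :
  decay_linear (fun f => c * cintegral (nu x) f) /\
  decay_bounded (fun f => c * cintegral (nu x) f).
Proof.
split.
  move=> a f g df dg; have := average_lin a x df dg; rewrite /average => ->.
  by rewrite mulrDr mulrCA.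
exists (normc c * 2); first by rewrite mulr_ge0 ?normc_ge0.
move=> h C mh hC; rewrite normcMl -!mulrA ler_wpM2l ?normc_ge0//.
have C0 := weight_bound_ge0 hC.
apply: normc_cintegral_prob => // y; apply: le_trans (hC y) _.
by rewrite ler_piMr// weight_le1.
Qed.

Section lattice_sum.
Variable M : 'M[R]_d.
Hypothesis uM : M \in unitmx.
Local Notation P := (pullback M).

(** The default value [0] does not occur on decaying functions, by
    [lattice_sumP]. *)
Definition lattice_sum f : R[i] := xget 0 [set s | hasum (onset P (average mu f)) s].

Lemma lattice_sumE f s : hasum (onset P (average mu f)) s -> lattice_sum f = s.
Proof. by move=> hs; apply: hasum_unique (xgetI 0 hs) hs. Qed.

Lemma lattice_average_le f C : cmeasurable f -> (forall x, normc (f x) <= C * weight x) ->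
  forall x, normc (onset P (average mu f) x) <= 2 * C * (weight \_ P) x.
Proof.
move=> mf fC x; rewrite /onset patchE; case: ifP => _; first exact: average_decay.
by rewrite normc_0 mulr0.
Qed.

Lemma lattice_sumP f : decaying f -> hasum (onset P (average mu f)) (lattice_sum f).
Proof.
move=> [mf [C fC]]; have [W hW] := sum_le_weight_pullback uM.
have C20 : 0 <= 2 * C by rewrite mulr_ge0// (weight_bound_ge0 fC).
have [s hs] := dominated_hasum (sum_leZ C20 hW) (lattice_average_le mf fC).
exact: (xgetI 0 hs).
Qed.

Lemma lattice_sum_linear : decay_linear lattice_sum.
Proof.
move=> c f g df dg; apply: lattice_sumE.
apply: eq_hasum (hasumD (hasumZ c (lattice_sumP df)) (lattice_sumP dg)) => x.
rewrite /onset; case: ifP => _; first by rewrite average_lin.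
by rewrite mulr0 addr0.
Qed.

Lemma lattice_sum_bounded : decay_bounded lattice_sum.
Proof.
have [W hW] := sum_le_weight_pullback uM; have W0 := sum_le_ge0 hW.
exists (2 * W); first by rewrite mulr_ge0.
move=> h C mh hC; rewrite mulrAC.
have C20 : 0 <= 2 * C by rewrite mulr_ge0// (weight_bound_ge0 hC).
apply: hasum_norm_le (sum_leZ C20 hW) (lattice_average_le mh hC) _.
by apply: lattice_sumP; split => //; exists C.
Qed.

(** A shell is a finite fibre of [enorm] on the lattice, and the average of
    [f] is constant on it. *)
Lemma hasum_shells f s : hasum (onset P (average mu f)) s ->
  hasum (fun r => if r \in radii P then (shelling P r)%:R * cintegral (mu r) f else 0) s.
Proof.
move=> hs; pose fib r := fset_set (P `&` [set x | enorm x = r]).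
have fin r := finite_pullback_sphere r uM.
have fibP r x : (x \in fib r) = (x \in P `&` [set x | enorm x = r]) by rewrite /fib in_fset_set.
have := hasum_fibres (h := @enorm R d) (fib := fib) _ _ hs.
move=> h; apply: eq_hasum (h _ _) => [r|x r|x].
- case: (boolP (r \in radii P)) => [_|rP].
    rewrite (eq_big_seq (fun=> cintegral (mu r) f)).
      by rewrite big_const_seq count_predT iter_addr_0 mulr_natl.
    by move=> x; rewrite fibP => /set_mem[Px <-]; rewrite onset_in.
  rewrite big1_fset// => x; rewrite fibP => /set_mem[Px xr].
  by move: rP; rewrite mem_set//; exists x.
- by move=> /eqP xr; rewrite fibP; apply/negP => /set_mem[].
- move=> xP; rewrite fibP; apply/mem_set; split => //=.
  by apply: contrapT => nP; move: xP; rewrite onset_out// eqxx.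
Qed.

End lattice_sum.

Lemma hasum_totally (D : set R) (F : R -> R[i]) s :
  hasum (fun r => if r \in D then F r else 0) s ->
  (fun A : {fset R} => \sum_(r <- A | r \in D) F r : R[i]^o) @ summability.totally -->
  (s : R[i]^o).
Proof.
move=> hs; have FF := @summability.totally_filter R.
apply/cvgrPdist_lt => e e0.
have [Re0 ->] : 0 < complex.Re e /\ e = (complex.Re e)%:C%C.
  by move: e0; case: e => a b; rewrite ltcE /= => /andP[/eqP -> ->].
have [A hA] := hs _ Re0; exists A => // B AB /=.
rewrite [X in X < _](normc_norm (s - _)) ltcR normcBC big_mkcond.
exact: hA.
Qed.

End spherical_sums.

(** * The summation formula for shells *)

Section summation_formula.
Context {R : realType} {d : nat}.
Variable mu : R -> probability 'rV[R]_d R.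
Hypothesis unif : forall r, radii [set: 'rV[R]_d] r -> uniform_on_sphere r (mu r).
Local Notation lam := (lebesgue_rV R d).
Implicit Types (f g h : 'rV[R]_d -> R[i]) (x y k : 'rV[R]_d).

Lemma shell_sum_distribution (M : 'M[R]_d) : M \in unitmx ->
  distribution_sum (radii (pullback M))
    (fun r f => (shelling (pullback M) r)%:R * measure_distribution (mu r) f)
    (lattice_sum mu M).
Proof.
move=> uM; split.
- move=> _ [x Px <-].
  have [l b] := average_functional mu (shelling (pullback M) (enorm x))%:R x.
  exact: decay_tempered l b.
- exact: decay_tempered (lattice_sum_linear unif uM) (lattice_sum_bounded unif uM).
- move=> f /decaying_schwartz df.
  exact: (hasum_totally (hasum_shells uM (lattice_sumP unif uM df))).
Qed.

Lemma function_distribution_fourier x f : decaying f ->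
  function_distribution (fourier_measure (mu (enorm x))) f =
  cintegral (mu (enorm x)) (fourier f).
Proof. by move=> [mf [C fC]]; rewrite (average_fourier mu x mf fC). Qed.

Lemma shell_sum_fourier_distribution (M : 'M[R]_d) : M \in unitmx ->
  distribution_sum (radii (pullback M))
    (fun r f => (shelling (pullback M) r)%:R *
       function_distribution (fourier_measure (mu r)) f)
    (fourier_distribution (lattice_sum mu M)).
Proof.
move=> uM; split.
- move=> _ [x Px <-].
  have [l b] := average_functional mu (shelling (pullback M) (enorm x))%:R x.
  apply: eq_tempered (decay_fourier_tempered l b) => f df.
  by rewrite function_distribution_fourier.
- exact: decay_fourier_tempered (lattice_sum_linear unif uM) (lattice_sum_bounded unif uM).
- move=> f sf; have df := decaying_fourier sf.
  suff E : hasum (fun r => if r \in radii (pullback M) then (shelling (pullback M) r)%:R *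
      function_distribution (fourier_measure (mu r)) f else 0)
      (fourier_distribution (lattice_sum mu M) f) by exact: (hasum_totally E).
  apply: eq_hasum (hasum_shells uM (lattice_sumP unif uM df)) => r.
  case: (boolP (r \in _)) => // /set_mem[x Px <-].
  by rewrite function_distribution_fourier//; exact: decaying_schwartz.
Qed.

(** Poisson summation for the average of [f], whose Fourier transform is the
    average of that of [f]. *)
Lemma fourier_lattice_sum (B : 'M[R]_d) f : B \in unitmx -> schwartz f ->
  lattice_sum mu (invmx B) (fourier f) = (`|\det B|^-1)%:C%C * lattice_sum mu B^T f.
Proof.
move=> uB sf; have [C C0 fC] := schwartz_decay sf.
have [L L0 fL] := schwartz_lipschitz sf; have mf := schwartz_cmeasurable sf.
have [C' C'0 hC] := schwartz_fourier_decay sf.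
have cA := average_continuous unif mf C0 L0 fC fL.
have E k : fourier (average mu f) k = average mu (fourier f) k by exact: fourier_averageE.
have hA k : normc (fourier (average mu f) k) <= 2 * C' * weight k.
  rewrite E; apply: average_decay => //; exact: fourier_cmeasurable mf fC.
have [s h1 h2] := poisson_lattice uB cA (average_decay unif mf fC) hA.
rewrite (lattice_sumE h1); apply: lattice_sumE.
by apply: eq_hasum h2 => x; rewrite /onset E.
Qed.

End summation_formula.

Theorem theorem3 (R : realType) (d : nat) (G : set 'rV[R]_d)
    (mu : R -> probability 'rV[R]_d R) :
  full_lattice G ->
  (forall r, radii [set: 'rV[R]_d] r -> uniform_on_sphere r (mu r)) ->
  exists S U : functional R d,
  [/\ distribution_sum (radii G)
        (fun r f => (shelling G r)%:R * measure_distribution (mu r) f) S,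
      distribution_sum (radii G)
        (fun r f => (shelling G r)%:R *
           function_distribution (fourier_measure (mu r)) f)
        (fourier_distribution S),
      distribution_sum (radii (dual_lattice G))
        (fun r f => (shelling (dual_lattice G) r)%:R *
           measure_distribution (mu r) f) U &
      forall f, schwartz f ->
        fourier_distribution S f = (dens G)%:C%C * U f].
Proof.
move=> /full_lattice_pullback[B uB ->] unif.
have uBi : invmx B \in unitmx by rewrite unitmx_inv.
have uBT : B^T \in unitmx by rewrite unitmx_tr.
exists (lattice_sum mu (invmx B)), (lattice_sum mu B^T).
rewrite dual_lattice_pullback// dens_pullback//; split.
- exact: shell_sum_distribution.
- exact: shell_sum_fourier_distribution.
- exact: shell_sum_distribution.
- by move=> f; exact: fourier_lattice_sum.
Qed.
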